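(* Let $A$ be an asymmetric fuzzy number, $\Omega\subseteq\mathbb{R}^n$ open, $k\in\mathbb{N}$ and $1\le p<\infty$. The fuzzy Sobolev space $(W^{k,p}(\Omega,\mathbb{C}_{\mathcal{F}(A)}),\|\cdot\|_{\tilde p,k})$ is a Banach space.
   Context: A fuzzy number is a function $A:\mathbb{R}\to[0,1]$ whose level sets $[A]_\alpha=\{x: A(x)\ge\alpha\}$ ($0<\alpha\le1$) and $[A]_0=\overline{\{x:A(x)>0\}}$ are all nonempty closed bounded intervals; sums and real multiples of fuzzy numbers are taken level-wise, and real numbers are identified with singletons. A complex fuzzy number is an expression $C+iD$ with $C,D$ fuzzy numbers. $A$ is asymmetric if for every $y\in\mathbb{R}$ there is $x_0\in\mathbb{R}$ with $A(y-x_0)\ne A(y+x_0)$. For $u,v\in\mathbb{C}$ put $u+vA:=(\mathrm{Re}\,u+(\mathrm{Re}\,v)A)+i(\mathrm{Im}\,u+(\mathrm{Im}\,v)A)$ and $\mathbb{C}_{\mathcal{F}(A)}:=\{u+vA: u,v\in\mathbb{C}\}$. For asymmetric $A$ the map $\psi(u,v)=u+vA$ is a bijection $\mathbb{C}^2\to\mathbb{C}_{\mathcal{F}(A)}$, and $\mathbb{C}_{\mathcal{F}(A)}$ is a two-dimensional complex vector space with operations transported by $\psi$: $(u+vA)\oplus(z+wA)=(u+z)+(v+w)A$, $\lambda(u+vA)=\lambda u+\lambda vA$. Operations on functions with values in $\mathbb{C}_{\mathcal{F}(A)}$ are pointwise. Let $m(A)$ be the midpoint of the interval $[A]_1$. The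 $A$-cross product is $(u+vA)\odot(z+wA)=(uz-m(A)^2vw)+(uw+zv+2m(A)vw)A$. On $\mathbb{C}_{\mathcal{F}(A)}$, $\|u+vA\|_{\tilde p}=(|u+m(A)v|^p+|v|^p)^{1/p}$. A function $F=u+vA$ with $u,v:\Omega\to\mathbb{C}$ is integrable on a set if $u$ and $v$ are, and then $\int F=\int u+(\int v)A$. $L^p(\Omega,\mathbb{C}_{\mathcal{F}(A)})$ is the set of (measurable) $F:\Omega\to\mathbb{C}_{\mathcal{F}(A)}$ with $\|F\|_{\tilde p}:=\bigl(\int_\Omega\|F(\omega)\|_{\tilde p}^p\,d\omega\bigr)^{1/p}<\infty$ (functions equal a.e. identified); $L^1_{\mathrm{loc}}(\Omega,\mathbb{C}_{\mathcal{F}(A)})$ is the set of functions integrable on every compact subset of $\Omega$; $C_c^\infty(\Omega,\mathbb{C}_{\mathcal{F}(A)})$ is the set of infinitely differentiable functions with compact support in $\Omega$. For $\alpha\in\mathbb{N}_0^n$, $|\alpha|=\sum_i\alpha_i$, and $F,G\in L^1_{\mathrm{loc}}(\Omega,\mathbb{C}_{\mathcal{F}(A)})$, $G$ is the $\alpha^{th}$-weak partial derivative of $F$, written $G=D^\alpha F$, if for all $\Phi\in C_c^\infty(\Omega,\mathbb{C}_{\mathcal{F}(A)})$, $$\int_\Omega F(\omega)\odot D^\alpha\Phi(\omega)\,d\omega=(-1)^{|\alpha|}\int_\Omega G(\omega)\odot\Phi(\omega)\,d\omega.$$ $W^{k,p}(\Omega,\mathbb{C}_{\mathcal{F}(A)})$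 is the set of $F\in L^p(\Omega,\mathbb{C}_{\mathcal{F}(A)})$ having weak derivatives $D^\alpha F\in L^p(\Omega,\mathbb{C}_{\mathcal{F}(A)})$ for all $|\alpha|\le k$, with norm $\|F\|_{\tilde p,k}=\sum_{|\alpha|\le k}\|D^\alpha F\|_{\tilde p}$. *)

(* Defs.v *)
From HB Require Import structures.
From mathcomp Require Import all_boot all_order all_algebra.
From mathcomp Require Import all_classical all_reals all_analysis.
From mathcomp Require Import complex lra.

Set Implicit Arguments.
Unset Strict Implicit.
Unset Printing Implicit Defensive.
Import Order.TTheory GRing.Theory Num.Theory.
Import numFieldNormedType.Exports.
Local Open Scope classical_set_scope.
Local Open Scope ring_scope.

Fact rV_display : measure_display. Proof. exact: default_measure_display. Qed.

(* The sigma-algebra on R^n generated by the coordinates; it is the Borel one. *)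
Section measurable_rV.
Context (R : realType) (n : nat).

Definition rV_coords (i : 'I_n) (x : 'rV[R]_n) : R := x ord0 i.

Let rV_set0 : g_sigma_preimage rV_coords set0.
Proof. exact: sigma_algebra0. Qed.

Let rV_setC A : g_sigma_preimage rV_coords A -> g_sigma_preimage rV_coords (~` A).
Proof. exact: sigma_algebraC. Qed.

Let rV_bigcup (F : _^nat) : (forall i, g_sigma_preimage rV_coords (F i)) ->
  g_sigma_preimage rV_coords (\bigcup_i (F i)).
Proof. exact: sigma_algebra_bigcup. Qed.

HB.instance Definition _ := @isMeasurable.Build rV_display 'rV[R]_n
  (g_sigma_preimage rV_coords) rV_set0 rV_setC rV_bigcup.

Lemma measurable_rV_coords (i : 'I_n) :
  measurable_fun [set: 'rV[R]_n] (rV_coords i).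
Proof.
move=> _ Y mY; rewrite setTI; apply: sub_sigma_algebra => /=.
rewrite -bigcup_seq/=; exists i => /=; first by rewrite mem_index_enum.
by exists Y => //; rewrite setTI.
Qed.

Lemma measurable_fun_rVP d (T : measurableType d) (f : T -> 'rV[R]_n) :
  (forall i, measurable_fun setT (fun x => f x ord0 i)) ->
  measurable_fun setT f.
Proof.
move=> mf _ A mA; rewrite setTI.
have : preimage_set_system setT f (g_sigma_preimage rV_coords) (f @^-1` A).
  by exists A => //; rewrite setTI.
rewrite -g_sigma_preimage_comp; apply: smallest_sub.
  exact: sigma_algebra_measurable.
move=> B; rewrite -bigcup_seq /= => -[i _ [C mC <-]]; exact: mf.
Qed.

End measurable_rV.

Section lebesgue_rV.
Context (R : realType).

Definition cons_rV (n : nat) (z : R * 'rV[R]_n) : 'rV[R]_n.+1 :=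
  \row_i oapp (z.2 ord0) z.1 (unlift ord0 i).

Lemma cons_rV0 n z : @cons_rV n z ord0 ord0 = z.1.
Proof. by rewrite mxE unlift_none. Qed.

Lemma cons_rVS n z i : @cons_rV n z ord0 (lift ord0 i) = z.2 ord0 i.
Proof. by rewrite mxE liftK. Qed.

Lemma measurable_cons_rV n : measurable_fun setT (@cons_rV n).
Proof.
apply: measurable_fun_rVP => i; have [j ->|->] := unliftP ord0 i.
  under eq_fun do rewrite cons_rVS.
  exact: (measurableT_comp (measurable_rV_coords j) measurable_snd).
under eq_fun do rewrite cons_rV0.
exact: measurable_fst.
Qed.

Definition uncons_rV n (x : 'rV[R]_n.+1) : R * 'rV[R]_n :=
  (x ord0 ord0, \row_i x ord0 (lift ord0 i)).

Lemma cons_rVK n : cancel (@cons_rV n) (@uncons_rV n).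
Proof.
move=> [a v]; rewrite /uncons_rV cons_rV0; congr pair.
by apply/rowP => i; rewrite mxE cons_rVS.
Qed.

Lemma measurable_uncons_rV n : measurable_fun setT (@uncons_rV n).
Proof.
apply: measurable_fun_pair; first exact: measurable_rV_coords.
apply: measurable_fun_rVP => i; under eq_fun do rewrite mxE.
exact: measurable_rV_coords.
Qed.

Section step.
Context (n : nat) (mu : {sigma_finite_measure set 'rV[R]_n -> \bar R}).
Local Notation leb1 := (@lebesgue_measure R).

Definition lebesgue_cons : set 'rV[R]_n.+1 -> \bar R :=
  pushforward (leb1 \x mu)%E (@cons_rV n).

Let lebesgue_cons0 : lebesgue_cons set0 = 0%E.
Proof. by rewrite /lebesgue_cons /pushforward preimage_set0 measure0. Qed.

Let lebesgue_cons_ge0 A : (0 <= lebesgue_cons A)%E.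
Proof. exact: integral_ge0. Qed.

Let lebesgue_cons_sigma_additive : semi_sigma_additive lebesgue_cons.
Proof.
exact: (@measure_semi_sigma_additive _ _ _
  (measure_function_pushforward__canonical__measure_function_Measure
     (leb1 \x mu)%E (@measurable_cons_rV n))).
Qed.

HB.instance Definition _ := isMeasure.Build _ _ _ lebesgue_cons
  lebesgue_cons0 lebesgue_cons_ge0 lebesgue_cons_sigma_additive.

Let lebesgue_cons_sigma_finite : sigma_finite setT lebesgue_cons.
Proof.
have /sigma_finiteP[F [TF ndF Foo]] := sigma_finiteT leb1.
have /sigma_finiteP[G [TG ndG Goo]] := sigma_finiteT mu.
exists (fun k => @uncons_rV n @^-1` (F k `*` G k)).
  rewrite -preimage_bigcup; apply/esym; rewrite -subTset => x _.
  have [i _ Fi] : (\bigcup_k F k) (uncons_rV x).1 by rewrite -TF.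
  have [j _ Gj] : (\bigcup_k G k) (uncons_rV x).2 by rewrite -TG.
  exists (maxn i j) => //; split.
    by move: Fi; exact/subsetPset/ndF/leq_maxl.
  by move: Gj; exact/subsetPset/ndG/leq_maxr.
move=> k; have [mF Fkoo] := Foo k; have [mG Gkoo] := Goo k; split.
  rewrite -[X in measurable X]setTI; apply: measurable_uncons_rV => //.
  exact: measurableX.
rewrite /lebesgue_cons /pushforward -comp_preimage.
rewrite (_ : _ \o _ = id); last by apply/funext => z /=; rewrite cons_rVK.
by rewrite preimage_id product_measure1E// lte_mul_pinfty// ge0_fin_numE.
Qed.
HB.instance Definition _ := Measure_isSigmaFinite.Build _ _ _ lebesgue_cons
  lebesgue_cons_sigma_finite.
End step.

(* Lebesgue measure on R^n (restricted to the Borel sets), by R^(n+1) = R x R^n. *)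
Fixpoint lebesgue_rV (n : nat) : {sigma_finite_measure set 'rV[R]_n -> \bar R} :=
  if n is m.+1 then lebesgue_cons (lebesgue_rV m) else \d_(0 : 'rV[R]_0).

Lemma lebesgue_rV_box n (a b : 'I_n -> R) : (forall i, a i <= b i) ->
  lebesgue_rV n [set x | forall i, a i <= x ord0 i <= b i] =
  (\prod_(i < n) (b i - a i))%:E.
Proof.
elim: n a b => [|n IH] a b ab.
  by rewrite big_ord0 /= diracE mem_set// => -[].
rewrite big_ord_recl /= /lebesgue_cons /pushforward.
rewrite (_ : _ @^-1` _ = `[a ord0, b ord0]%classic `*`
  [set x : 'rV[R]_n | forall i, a (lift ord0 i) <= x ord0 i <= b (lift ord0 i)]).
  rewrite product_measure1E//; last first.
    rewrite (_ : [set x | _] = \bigcap_(i in [set: 'I_n])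
      (@rV_coords R n i @^-1` `[a (lift ord0 i), b (lift ord0 i)]%classic)).
      apply: fin_bigcap_measurable => [|i _]; first exact: finite_finset.
      rewrite -[X in measurable X]setTI; exact: measurable_rV_coords.
    apply/seteqP; split => x /= H i; first by move=> _ /=; rewrite in_itv/= H.
    by have := H i I; rewrite /= in_itv.
  rewrite IH => [|i]; last exact: ab.
  rewrite [X in (X * _)%E](_ : _ = lebesgue_measure `[a ord0, b ord0]%classic)//.
  rewrite lebesgue_measure_itv/= lte_fin.
  have := ab ord0; rewrite le_eqVlt => /predU1P[->|->]; last by rewrite -EFinB.
  by rewrite ltxx subrr mul0e mul0r.
apply/seteqP; split => z /=.
  move=> H; split; first by have := H ord0; rewrite cons_rV0 in_itv.
  by move=> i; have := H (lift ord0 i); rewrite cons_rVS.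
move=> [H0 HS] i; have [j ->|->] := unliftP ord0 i; first by rewrite cons_rVS.
by move: H0; rewrite cons_rV0 in_itv.
Qed.
End lebesgue_rV.

(* [A]_a for 0 <= a <= 1 (the value for a < 0 is irrelevant). *)
Definition level (R : realType) (A : R -> R) (a : R) : set R :=
  if 0 < a then [set x | a <= A x] else closure [set x | 0 < A x].

Record fuzzy_number (R : realType) := FuzzyNumber {
  fuzzy_fun :> R -> R;
  fuzzy_bounds : forall x, 0 <= fuzzy_fun x <= 1;
  fuzzy_level : forall a : R, 0 <= a <= 1 ->
    exists l r, l <= r /\ level fuzzy_fun a = `[l, r]%classic }.

Section fuzzy_arithmetic.
Context (R : realType).
Implicit Types (A C D E : fuzzy_number R) (L U : R -> R).

(* L and U are the endpoint functions of the levels of a fuzzy number. *)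
Definition fuzzy_ends L U :=
  [/\ forall a : R, 0 <= a <= 1 -> L a <= U a,
      forall a b : R, 0 <= a -> a <= b -> b <= 1 -> L a <= L b /\ U b <= U a,
      forall a x : R, 0 < a <= 1 ->
        (forall b : R, 0 < b < a -> L b <= x) -> L a <= x,
      forall a x : R, 0 < a <= 1 ->
        (forall b : R, 0 < b < a -> x <= U b) -> x <= U a &
      (forall x : R, (forall b : R, 0 < b <= 1 -> x <= L b) -> x <= L 0) /\
      (forall x : R, (forall b : R, 0 < b <= 1 -> U b <= x) -> U 0 <= x)].

Lemma fuzzy_endsP A : exists L U, fuzzy_ends L U /\
  forall a : R, 0 <= a <= 1 -> level A a = `[L a, U a]%classic.
Proof.
have /choice[L /choice[U LU]] : forall a, exists l r, 0 <= a <= 1 ->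
    l <= r /\ level A a = `[l, r]%classic.
  move=> a; have [|a01] := boolP (0 <= a <= 1).
    by move=> /(fuzzy_level A)[l [r lr]]; exists l, r.
  by exists 0, 0.
have LUi a : 0 <= a <= 1 -> L a <= U a by move=> /LU[].
have LUe a : 0 <= a <= 1 -> level A a = `[L a, U a]%classic by move=> /LU[].
exists L, U; split => //.
have inI a x : 0 < a <= 1 -> (a <= A x) = (L a <= x <= U a).
  move=> a01; have a01' : 0 <= a <= 1 by case/andP: a01 => /ltW-> ->.
  have := LUe _ a01'; rewrite /level; case/andP: a01 => -> _ /seteqP[H1 H2].
  apply/idP/idP => [/H1/=|xI]; first by rewrite in_itv.
  by apply: H2; rewrite /= in_itv.
have in0 x : closure [set y | 0 < A y] x <-> L 0 <= x <= U 0.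
  have : (0 : R) <= (0 : R) <= (1 : R) by lra.
  move/LUe; rewrite /level ltxx => ->; rewrite /= in_itv/=; tauto.
have sub0 a : 0 < a <= 1 -> L 0 <= L a /\ U a <= U 0.
  move=> a01; have a01' : 0 <= a <= 1 by case/andP: a01 => /ltW-> ->.
  have H x : L a <= x <= U a -> L 0 <= x <= U 0.
    rewrite -inI// => ax; apply/in0; apply: subset_closure => /=.
    by rewrite (lt_le_trans _ ax)//; case/andP: a01.
  have := H (L a); have := H (U a); rewrite !lexx !LUi//.
  by move=> /(_ erefl)/andP[_ ->] /(_ erefl)/andP[-> _].
have mono (a b : R) : 0 <= a -> a <= b -> b <= 1 -> L a <= L b /\ U b <= U a.
  case: (ltgtP 0 a) => // [a0|<-] _ ab b1; last first.
    by move: ab; case: (ltgtP 0 b) => // [b0|<-//] _; apply: sub0; rewrite b0.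
  have b01 : 0 < b <= 1 by rewrite (lt_le_trans a0).
  have a01 : 0 < a <= 1 by rewrite a0 (le_trans ab).
  have lub : L b <= U b by apply: LUi; case/andP: b01 => /ltW->.
  have H x : L b <= x <= U b -> L a <= x <= U a.
    by rewrite -!inI//; exact: le_trans.
  have := H (L b); have := H (U b); rewrite !lexx lub.
  by move=> /(_ erefl)/andP[_ ->] /(_ erefl)/andP[-> _].
split => //.
- move=> a x a01 H; rewrite leNgt; apply/negP => xLa.
  suff : L a <= x <= U a by rewrite leNgt xLa.
  rewrite -inI// leNgt; apply/negP => Axa.
  have /andP[Ax0 _] := fuzzy_bounds A x.
  pose b := (A x + a) / 2; have [Axb ba] : A x < b /\ b < a by rewrite /b; lra.
  have b01 : 0 < b <= 1 by lra.
  suff : b <= A x by lra.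
  rewrite inI// H ?ba ?andbT; last by lra.
  have [_ Uab] := mono b a ltac:(lra) ltac:(lra) ltac:(lra).
  by have := LUi a ltac:(lra); lra.
- move=> a x a01 H; rewrite leNgt; apply/negP => xUa.
  suff : L a <= x <= U a by rewrite [x <= _]leNgt xUa andbF.
  rewrite -inI// leNgt; apply/negP => Axa.
  have /andP[Ax0 _] := fuzzy_bounds A x.
  pose b := (A x + a) / 2; have [Axb ba] : A x < b /\ b < a by rewrite /b; lra.
  have b01 : 0 < b <= 1 by lra.
  suff : b <= A x by lra.
  rewrite inI// H ?ba ?andbT; last by lra.
  have [Lab _] := mono b a ltac:(lra) ltac:(lra) ltac:(lra).
  by have := LUi a ltac:(lra); lra.
- have LU0 : L 0 <= U 0 by apply: LUi; lra.
  have pos y : 0 < A y -> 0 < A y <= 1 /\ L (A y) <= y <= U (A y).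
    move=> Ay0; have Ay : 0 < A y <= 1.
      by rewrite Ay0; case/andP: (fuzzy_bounds A y).
    by rewrite -inI.
  split=> x H.
    have /in0 : L 0 <= L 0 <= U 0 by rewrite lexx.
    rewrite closureE => /(_ [set y | x <= y]); apply; split.
      exact: closed_ge.
    by move=> y /= /pos[/H]; lra.
  have /in0 : L 0 <= U 0 <= U 0 by rewrite lexx andbT.
  rewrite closureE => /(_ [set y | y <= x]); apply; split.
    exact: closed_le.
  by move=> y /= /pos[/H]; lra.
Qed.

Lemma fuzzy_of_ends L U : fuzzy_ends L U -> exists E,
  forall a : R, 0 <= a <= 1 -> level E a = `[L a, U a]%classic.
Proof.
move=> [LU mono contL contU [cont0L cont0U]].
pose S x := [set a | 0 < a <= 1 /\ L a <= x <= U a].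
pose E x := sup (S x).
have Sub x : ubound (S x) 1 by move=> a [/andP[]].
have E01 x : 0 <= E x <= 1.
  have [S0|/set0P[a Sa]] := eqVneq (S x) set0.
    by rewrite /E S0 sup0 lexx ler01.
  have hs : has_sup (S x) by split; [exists a|exists 1].
  apply/andP; split; last by apply: ge_sup => //; exists a.
  rewrite (@le_trans _ _ a)//; first by case: Sa; lra.
  exact: (ub_le_sup (proj2 hs)).
have leE a x : 0 < a <= 1 -> (a <= E x) = (L a <= x <= U a).
  move=> a01; apply/idP/idP => [aE|xI]; last first.
    by apply: ub_le_sup; [exists 1|split].
  have H b : 0 < b < a -> L b <= x <= U b.
    move=> b0a; have [S0|/set0P S0] := eqVneq (S x) set0.
      by move: aE; rewrite /E S0 sup0; lra.
    have hs : has_sup (S x) by split => //; exists 1.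
    have [c Sc bc] := @sup_adherent _ (S x) (E x - b) ltac:(lra) hs.
    have {}bc : b < c by move: bc; rewrite -/(E x); lra.
    case: Sc => c01 cI.
    by have [] := mono b c ltac:(lra) ltac:(lra) ltac:(lra); lra.
  apply/andP; split.
    by apply: contL => // b /H /andP[].
  by apply: contU => // b /H /andP[].
have lev a : 0 <= a <= 1 -> level E a = `[L a, U a]%classic.
  move=> a01; rewrite /level; case: ifPn => [a0|].
    by apply/seteqP; split => x /=; rewrite in_itv/= leE//; lra.
  rewrite -leNgt => a0; have {a0 a01} -> : a = 0 by lra.
  have LU0 : L 0 <= U 0 by apply: LU; lra.
  have posE x : 0 < E x -> L 0 <= x <= U 0.
    move=> Ex0; have Ex : 0 < E x <= 1 by have := E01 x; lra.
    have := lexx (E x); rewrite {1}leE// => xI.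
    by have [] := mono 0 (E x) ltac:(lra) ltac:(lra) ltac:(lra); lra.
  apply/seteqP; split.
    rewrite closureE => x; apply; split; first exact: interval_closed.
    by move=> y /= /posE; rewrite in_itv.
  move=> x /=; rewrite in_itv/= => xI.
  suff H e : 0 < e -> exists2 y, 0 < E y & `|x - y| < e.
    move=> B /nbhs_ballP[e /= e0 eB].
    by have [y Ey xy] := H _ e0; exists y; split => //; exact: eB.
  move=> e0.
  have EI y b : 0 < b <= 1 -> L b <= y <= U b -> 0 < E y.
    by move=> b01; rewrite -leE//; lra.
  have [b [b01 Lb]] : exists b, 0 < b <= 1 /\ L b < x + e.
    apply: contrapT => /forallNP Hb.
    suff : x + e <= L 0 by lra.
    apply: cont0L => b b01; rewrite leNgt; apply/negP => Lb.
    by apply: (Hb b).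
  have [c [c01 Uc]] : exists c, 0 < c <= 1 /\ x - e < U c.
    apply: contrapT => /forallNP Hb.
    suff : U 0 <= x - e by lra.
    apply: cont0U => c c01; rewrite leNgt; apply/negP => Uc.
    by apply: (Hb c).
  pose d := Num.min b c.
  have d01 : 0 < d <= 1 by rewrite /d; case: (leP b c); lra.
  have [db dc] : d <= b /\ d <= c by rewrite /d; case: (leP b c); lra.
  have [Ldb _] := mono d b ltac:(lra) ltac:(lra) ltac:(lra).
  have [_ Udc] := mono d c ltac:(lra) ltac:(lra) ltac:(lra).
  have LUd := LU d ltac:(lra).
  have [xL|Lx] := ltP x (L d).
    exists (L d); first by apply: (EI _ d) => //; lra.
    by rewrite ltr_norml; lra.
  have [Ux|xU] := ltP (U d) x.
    exists (U d); first by apply: (EI _ d) => //; lra.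
    by rewrite ltr_norml; lra.
  exists x; first by apply: (EI _ d) => //; lra.
  by rewrite subrr normr0.
have ex a : 0 <= a <= 1 -> exists l r, l <= r /\ level E a = `[l, r]%classic.
  by move=> a01; exists (L a), (U a); rewrite lev//; split => //; exact: LU.
by exists (FuzzyNumber E01 ex).
Qed.

Lemma fuzzy_crisp_ex (r : R) : exists E,
  forall a : R, 0 <= a <= 1 -> level E a = [set r].
Proof.
have [|E HE] := @fuzzy_of_ends (cst r) (cst r).
  split => //.
  - by move=> a x a01 /(_ (a / 2)); apply; lra.
  - by move=> a x a01 /(_ (a / 2)); apply; lra.
  - by split=> x /(_ 1); apply; lra.
by exists E => a /HE ->; rewrite set_itv1.
Qed.

Lemma fuzzy_add_ex C D : exists E, forall a : R, 0 <= a <= 1 ->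
  level E a = [set x + y | x in level C a & y in level D a].
Proof.
have [L1 [U1 [[LU1 mono1 cL1 cU1 [c0L1 c0U1]] E1]]] := fuzzy_endsP C.
have [L2 [U2 [[LU2 mono2 cL2 cU2 [c0L2 c0U2]] E2]]] := fuzzy_endsP D.
have [|E HE] := @fuzzy_of_ends (L1 \+ L2) (U1 \+ U2).
  split.
  - by move=> a a01; apply: lerD; [exact: LU1|exact: LU2].
  - move=> a b a0 ab b1 /=.
    by have := mono1 a b a0 ab b1; have := mono2 a b a0 ab b1; lra.
  - move=> a x a01 H /=; rewrite -lerBrDr; apply: cL1 => // b ba.
    rewrite lerBrDr addrC -lerBrDr; apply: cL2 => // c ca.
    pose m := Num.max b c; have ma : 0 < m < a by rewrite /m; case: (leP b c); lra.
    have [bm cm] : b <= m /\ c <= m by rewrite /m; case: (leP b c); lra.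
    have := H m ma; rewrite /=.
    have [? _] := mono1 b m ltac:(lra) ltac:(lra) ltac:(lra).
    by have [? _] := mono2 c m ltac:(lra) ltac:(lra) ltac:(lra); lra.
  - move=> a x a01 H /=; rewrite -lerBlDr; apply: cU1 => // b ba.
    rewrite lerBlDr addrC -lerBlDr; apply: cU2 => // c ca.
    pose m := Num.max b c; have ma : 0 < m < a by rewrite /m; case: (leP b c); lra.
    have [bm cm] : b <= m /\ c <= m by rewrite /m; case: (leP b c); lra.
    have := H m ma; rewrite /=.
    have [_ ?] := mono1 b m ltac:(lra) ltac:(lra) ltac:(lra).
    by have [_ ?] := mono2 c m ltac:(lra) ltac:(lra) ltac:(lra); lra.
  - split=> x H /=.
      rewrite -lerBlDr; apply: c0L1 => b ba.
      rewrite lerBlDr addrC -lerBlDr; apply: c0L2 => c ca.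
      pose m := Num.min b c; have ma : 0 < m <= 1 by rewrite /m; case: (leP b c); lra.
      have [bm cm] : m <= b /\ m <= c by rewrite /m; case: (leP b c); lra.
      have := H m ma; rewrite /=.
      have [? _] := mono1 m b ltac:(lra) ltac:(lra) ltac:(lra).
      by have [? _] := mono2 m c ltac:(lra) ltac:(lra) ltac:(lra); lra.
    rewrite -lerBrDr; apply: c0U1 => b ba.
    rewrite lerBrDr addrC -lerBrDr; apply: c0U2 => c ca.
    pose m := Num.min b c; have ma : 0 < m <= 1 by rewrite /m; case: (leP b c); lra.
    have [bm cm] : m <= b /\ m <= c by rewrite /m; case: (leP b c); lra.
    have := H m ma; rewrite /=.
    have [_ ?] := mono1 m b ltac:(lra) ltac:(lra) ltac:(lra).
    by have [_ ?] := mono2 m c ltac:(lra) ltac:(lra) ltac:(lra); lra.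
exists E => a a01; rewrite HE// E1// E2//.
have := LU1 a a01; have := LU2 a a01 => LUa2 LUa1.
apply/seteqP; split => [z|_ [x + [y + <-]]]; rewrite /= !in_itv/=; last first.
  by lra.
move=> zI; pose x := Num.min (U1 a) (z - L2 a).
exists x; first by rewrite in_itv/= /x; case: (leP (U1 a) (z - L2 a)); lra.
exists (z - x); last by lra.
by rewrite in_itv/= /x; case: (leP (U1 a) (z - L2 a)); lra.
Qed.

Lemma fuzzy_scale_ex (c : R) C : exists E, forall a : R, 0 <= a <= 1 ->
  level E a = [set c * x | x in level C a].
Proof.
have [L1 [U1 [[LU1 mono1 cL1 cU1 [c0L1 c0U1]] E1]]] := fuzzy_endsP C.
have [->|c_neq0] := eqVneq c 0.
  have [E HE] := fuzzy_crisp_ex 0; exists E => a a01; rewrite HE// E1//.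
  apply/seteqP; split => [_ ->|_ [x _ <-]] /=; last by rewrite mul0r.
  by exists (L1 a); rewrite ?mul0r//= in_itv/= lexx LU1.
have [c0|c0|/esym/eqP] := ltgtP 0 c; last by rewrite (negPf c_neq0).
- have [|E HE] := @fuzzy_of_ends (fun a => c * L1 a) (fun a => c * U1 a).
    split.
    + by move=> a a01; rewrite ler_pM2l// LU1.
    + by move=> a b a0 ab b1; rewrite !ler_pM2l//; exact: mono1.
    + move=> a x a01 H; rewrite mulrC -ler_pdivlMr//; apply: cL1 => // b ba.
      by rewrite ler_pdivlMr// mulrC H.
    + move=> a x a01 H; rewrite mulrC -ler_pdivrMr//; apply: cU1 => // b ba.
      by rewrite ler_pdivrMr// mulrC H.
    + split=> x H.
        rewrite mulrC -ler_pdivrMr//; apply: c0L1 => // b ba.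
        by rewrite ler_pdivrMr// mulrC H.
      rewrite mulrC -ler_pdivlMr//; apply: c0U1 => // b ba.
      by rewrite ler_pdivlMr// mulrC H.
  exists E => a a01; rewrite HE// E1//.
  apply/seteqP; split => [z|_ [x + <-]]; rewrite /= !in_itv/=; last first.
    by rewrite !ler_pM2l.
  exists (c^-1 * z); last by rewrite mulVKf.
  by rewrite in_itv/= ler_pdivlMl// ler_pdivrMl.
- have [|E HE] := @fuzzy_of_ends (fun a => c * U1 a) (fun a => c * L1 a).
    split.
    + by move=> a a01; rewrite ler_nM2l// LU1.
    + by move=> a b a0 ab b1; rewrite !ler_nM2l//; have [] := mono1 a b a0 ab b1.
    + move=> a x a01 H; rewrite mulrC -ler_ndivrMr//; apply: cU1 => // b ba.
      by rewrite ler_ndivrMr// mulrC H.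
    + move=> a x a01 H; rewrite mulrC -ler_ndivlMr//; apply: cL1 => // b ba.
      by rewrite ler_ndivlMr// mulrC H.
    + split=> x H.
        rewrite mulrC -ler_ndivlMr//; apply: c0U1 => // b ba.
        by rewrite ler_ndivlMr// mulrC H.
      rewrite mulrC -ler_ndivrMr//; apply: c0L1 => // b ba.
      by rewrite ler_ndivrMr// mulrC H.
  exists E => a a01; rewrite HE// E1//.
  apply/seteqP; split => [z|_ [x + <-]]; rewrite /= !in_itv/=; last first.
    by rewrite !ler_nM2l// andbC.
  exists (c^-1 * z); last by rewrite mulVKf.
  by rewrite in_itv/= ler_ndivlMl// ler_ndivrMl// andbC.
Qed.

Definition fuzzy_crisp (r : R) : fuzzy_number R := sval (cid (fuzzy_crisp_ex r)).
Definition fuzzy_add C D : fuzzy_number R := sval (cid (fuzzy_add_ex C D)).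
Definition fuzzy_scale (c : R) C : fuzzy_number R :=
  sval (cid (fuzzy_scale_ex c C)).

(* By fuzzy_eq below, these levels determine the three operations. *)
Lemma level_crisp (r a : R) : 0 <= a <= 1 -> level (fuzzy_crisp r) a = [set r].
Proof. by rewrite /fuzzy_crisp; case: cid => /= E; exact. Qed.

Lemma level_add C D (a : R) : 0 <= a <= 1 ->
  level (fuzzy_add C D) a = [set x + y | x in level C a & y in level D a].
Proof. by rewrite /fuzzy_add; case: cid => /= E; exact. Qed.

Lemma level_scale (c : R) C (a : R) : 0 <= a <= 1 ->
  level (fuzzy_scale c C) a = [set c * x | x in level C a].
Proof. by rewrite /fuzzy_scale; case: cid => /= E; exact. Qed.

Lemma fuzzy_eq C D : (forall a : R, 0 < a <= 1 -> level C a = level D a) -> C = D.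
Proof.
move=> CD; have le (C' D' : fuzzy_number R) x :
    (forall a : R, 0 < a <= 1 -> level C' a = level D' a) -> C' x <= D' x.
  move=> CD'; have /andP[+ C1] := fuzzy_bounds C' x.
  case: (ltgtP 0 (C' x)) => // [C0|<-] _; last by case/andP: (fuzzy_bounds D' x).
  have := CD' (C' x); rewrite C0 C1 => /(_ erefl); rewrite /level C0.
  by move=> /seteqP[+ _] => /(_ x) /=; apply.
have : C = D :> (R -> R).
  apply/funext => x; apply/eqP; rewrite eq_le !le// => a a01.
  by rewrite CD.
move: C D {CD} => [C C1 C2] [D D1 D2] /= CD; move: C1 C2; rewrite CD => C1 C2.
by congr FuzzyNumber; exact: Prop_irrelevance.
Qed.

Definition asymmetric A : Prop := forall y, exists x0, A (y - x0) <> A (y + x0).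

(* The pair (C, D) stands for C + iD. *)
Definition complex_fuzzy : Type := fuzzy_number R * fuzzy_number R.

(* u + vA, with real numbers identified with crisp fuzzy numbers. *)
Definition affine A (u v : R[i]) : complex_fuzzy :=
  (fuzzy_add (fuzzy_crisp (complex.Re u)) (fuzzy_scale (complex.Re v) A),
   fuzzy_add (fuzzy_crisp (complex.Im u)) (fuzzy_scale (complex.Im v) A)).

Lemma asymmetric_real_inj A (p q p' q' : R) : asymmetric A ->
  fuzzy_add (fuzzy_crisp p) (fuzzy_scale q A) =
  fuzzy_add (fuzzy_crisp p') (fuzzy_scale q' A) -> p = p' /\ q = q'.
Proof.
move=> asymA eqA.
have [L [U [[LU _ _ _ _] AE]]] := fuzzy_endsP A.
have lev (s t a : R) : 0 <= a <= 1 ->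
    level (fuzzy_add (fuzzy_crisp s) (fuzzy_scale t A)) a =
    [set s + t * x | x in `[L a, U a]%classic].
  move=> a01; rewrite level_add// level_crisp// level_scale// AE//.
  apply/seteqP; split => [_ [_ -> [_ [x xI <-] <-]]|_ [x xI <-]].
    by exists x.
  by exists s => //; exists (t * x) => //; exists x.
have sub (s t s' t' a : R) : 0 <= a <= 1 ->
    [set s + t * x | x in `[L a, U a]%classic] `<=`
    [set s' + t' * x | x in `[L a, U a]%classic] ->
    exists2 x, L a <= x <= U a & s + t * L a = s' + t' * x.
  move=> a01 /(_ (s + t * L a))[].
    by exists (L a) => //=; rewrite in_itv/= lexx LU.
  by move=> x; rewrite /= in_itv/= => xI <-; exists x.
have sub' (s t s' t' a : R) : 0 <= a <= 1 ->
    [set s + t * x | x in `[L a, U a]%classic] `<=`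
    [set s' + t' * x | x in `[L a, U a]%classic] ->
    exists2 x, L a <= x <= U a & s + t * U a = s' + t' * x.
  move=> a01 /(_ (s + t * U a))[].
    by exists (U a) => //=; rewrite in_itv/= lexx LU.
  by move=> x; rewrite /= in_itv/= => xI <-; exists x.
have sum (a : R) : 0 <= a <= 1 ->
    2 * p + q * (L a + U a) = 2 * p' + q' * (L a + U a).
  move=> a01; have LUa := LU _ a01.
  have : level (fuzzy_add (fuzzy_crisp p) (fuzzy_scale q A)) a =
         level (fuzzy_add (fuzzy_crisp p') (fuzzy_scale q' A)) a by rewrite eqA.
  rewrite !lev// => /seteqP[s1 s2].
  have [x1 x1I e1] := sub _ _ _ _ _ a01 s1.
  have [x2 x2I e2] := sub' _ _ _ _ _ a01 s1.
  have [x3 x3I e3] := sub _ _ _ _ _ a01 s2.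
  have [x4 x4I e4] := sub' _ _ _ _ _ a01 s2.
  case: (leP 0 q) => q0; case: (leP 0 q') => q'0; nra.
have [qq'|/eqP qq'] := eqVneq q q'.
  by split => //; have := sum 1; rewrite qq' => /(_ ltac:(lra)); lra.
pose y := (p' - p) / (q - q').
have q0 : q - q' != 0 by rewrite subr_eq0; exact/eqP.
have yE (a : R) : 0 <= a <= 1 -> L a + U a = 2 * y.
  move=> a01; apply: (mulfI q0); have := sum _ a01.
  have : (q - q') * y = p' - p by rewrite /y mulrCA divff// mulr1.
  by lra.
have [x0] := asymA y; case; apply/eqP; rewrite eq_le.
have refl x : A (y - x) <= A (y + x).
  have /andP[+ A1] := fuzzy_bounds A (y - x).
  case: (ltgtP 0 (A (y - x))) => // [A0|<-] _; last first.
    by case/andP: (fuzzy_bounds A (y + x)).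
  pose a := A (y - x); have a01 : 0 <= a <= 1 by rewrite /a ltW.
  have := AE _ a01; rewrite /level A0 => /seteqP[H1 H2].
  apply: H2; have := H1 (y - x) (lexx _); rewrite /= !in_itv/=.
  by have := yE _ a01; lra.
rewrite refl /=; have := refl (- x0); by rewrite opprK.
Qed.

Definition CF A : Type := {x : complex_fuzzy | exists u v, x = affine A u v}.

End fuzzy_arithmetic.

Section CF.
Context (R : realType) (A : fuzzy_number R).
Local Notation C := R[i].
Implicit Types (x y : CF A) (u v : C).

Definition psi (u v : C) : CF A :=
  exist _ (affine A u v) (ex_intro _ u (ex_intro _ v erefl)).

(* The u and v of x = u + vA; for asymmetric A they are unique (psi_inj). *)
Definition ucoord x : C := sval (cid (svalP x)).
Definition vcoord x : C := sval (cid (svalP (cid (svalP x)))).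

Lemma psi_coord x : psi (ucoord x) (vcoord x) = x.
Proof.
apply: eq_sig_hprop => [? ? ?|/=]; first exact: Prop_irrelevance.
exact/esym/(svalP (cid (svalP (cid (svalP x))))).
Qed.

Lemma psi_inj u v u' v' : asymmetric A -> psi u v = psi u' v' ->
  u = u' /\ v = v'.
Proof.
move=> asymA /(congr1 sval) /= [].
move=> /(asymmetric_real_inj asymA)[e1 e2] /(asymmetric_real_inj asymA)[e3 e4].
by case: u v u' v' e1 e2 e3 e4 => [a b] [c d] [a' b'] [c' d'] /= -> -> -> ->.
Qed.

Lemma psiK u v : asymmetric A -> ucoord (psi u v) = u /\ vcoord (psi u v) = v.
Proof. by move=> asymA; apply: psi_inj => //; exact: psi_coord. Qed.

Definition cf_zero : CF A := psi 0 0.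
Definition cf_add x y : CF A :=
  psi (ucoord x + ucoord y) (vcoord x + vcoord y).
Definition cf_scale (c : C) x : CF A := psi (c * ucoord x) (c * vcoord x).

(* m(A), the midpoint of [A]_1. *)
Definition core_mid : R := (inf (level A 1) + sup (level A 1)) / 2.
Local Notation m := (real_complex R core_mid).

(* The A-cross product. *)
Definition cf_mul x y : CF A :=
  psi (ucoord x * ucoord y - m ^+ 2 * (vcoord x * vcoord y))
      (ucoord x * vcoord y + ucoord y * vcoord x
       + 2 * m * (vcoord x * vcoord y)).

Definition cf_norm (p : R) x : R :=
  ((Normc.normc (ucoord x + m * vcoord x)) `^ p
   + (Normc.normc (vcoord x)) `^ p) `^ p^-1.

End CF.

Section derivatives.
Context (R : realType) (n : nat).
Implicit Types (f : 'rV[R]_n -> R) (u : 'rV[R]_n -> R[i]).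

Definition partial (i : 'I_n) f : 'rV[R]_n -> R :=
  fun x => 'D_(delta_mx ord0 i) f x.

Definition iter_partial (s : seq 'I_n) f : 'rV[R]_n -> R := foldr partial f s.

Definition smooth f : Prop :=
  forall (s : seq 'I_n) x, differentiable (iter_partial s f) x.

(* D^a f; the order of the partial derivatives is immaterial for smooth f. *)
Definition mderive (a : 'I_n -> nat) f : 'rV[R]_n -> R :=
  iter_partial (flatten [seq nseq (a i) i | i <- enum 'I_n]) f.

Definition csmooth u : Prop :=
  smooth (fun x => complex.Re (u x)) /\ smooth (fun x => complex.Im (u x)).

Definition cmderive (a : 'I_n -> nat) u : 'rV[R]_n -> R[i] :=
  fun x => Complex (mderive a (fun y => complex.Re (u y)) x)
                   (mderive a (fun y => complex.Im (u y)) x).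

Definition mlen (a : 'I_n -> nat) : nat := (\sum_(i < n) a i)%N.

End derivatives.

(* Functions are total on R^n; only their values on Om matter, except for test
   functions, which are extended by zero outside Om. *)
Section sobolev.
Context (R : realType) (A : fuzzy_number R) (n : nat) (Om : set 'rV[R]_n).
Local Notation T := 'rV[R]_n.
Local Notation mu := (lebesgue_rV R n).
Implicit Types (u : T -> R[i]) (F G Phi : T -> CF A) (p : R).

Definition cmeasurable (D : set T) u : Prop :=
  measurable_fun D (fun x => complex.Re (u x)) /\
  measurable_fun D (fun x => complex.Im (u x)).

Definition cintegrable (D : set T) u : Prop :=
  mu.-integrable D (fun x => (complex.Re (u x))%:E) /\
  mu.-integrable D (fun x => (complex.Im (u x))%:E).

Definition cintegral (D : set T) u : R[i] :=
  Complex (\int[mu]_(x in D) complex.Re (u x))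
          (\int[mu]_(x in D) complex.Im (u x)).

Definition cf_measurable (D : set T) F : Prop :=
  cmeasurable D (fun x => ucoord (F x)) /\
  cmeasurable D (fun x => vcoord (F x)).

Definition cf_integrable (D : set T) F : Prop :=
  cintegrable D (fun x => ucoord (F x)) /\
  cintegrable D (fun x => vcoord (F x)).

Definition cf_integral (D : set T) F : CF A :=
  psi A (cintegral D (fun x => ucoord (F x)))
        (cintegral D (fun x => vcoord (F x))).

Definition cf_smooth F : Prop :=
  csmooth (fun x => ucoord (F x)) /\ csmooth (fun x => vcoord (F x)).

Definition cf_mderive (a : 'I_n -> nat) F : T -> CF A :=
  fun x => psi A (cmderive a (fun y => ucoord (F y)) x)
                 (cmderive a (fun y => vcoord (F y)) x).

Definition Lp_norm p F : \bar R :=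
  ((\int[mu]_(x in Om) ((cf_norm p (F x)) `^ p)%:E) `^ p^-1)%E.

Definition Lp_space p F : Prop :=
  cf_measurable Om F /\ (Lp_norm p F < +oo)%E.

Definition L1loc F : Prop :=
  forall K, compact K -> K `<=` Om -> cf_integrable K F.

Definition test_function Phi : Prop :=
  let supp := closure [set x | Phi x <> cf_zero A] in
  [/\ cf_smooth Phi, compact supp & supp `<=` Om].

Definition weak_derivative (a : 'I_n -> nat) F G : Prop :=
  [/\ L1loc F, L1loc G & forall Phi, test_function Phi ->
    cf_integral Om (fun x => cf_mul (F x) (cf_mderive a Phi x)) =
    cf_scale ((-1) ^+ mlen a)
      (cf_integral Om (fun x => cf_mul (G x) (Phi x)))].

Definition sobolev (k : nat) p F : Prop :=
  Lp_space p F /\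
  forall a : 'I_n -> nat, (mlen a <= k)%N ->
    exists2 G, weak_derivative a F G & Lp_space p G.

(* D^a F: a weak derivative is unique almost everywhere, so any choice will do *)
Definition weakD (a : 'I_n -> nat) F : T -> CF A :=
  if pselect (exists G, weak_derivative a F G) is left e then sval (cid e)
  else fun=> cf_zero A.

(* A multi-index of length at most k has all its entries at most k. *)
Definition sobolev_norm (k : nat) p F : \bar R :=
  (\sum_(a : {ffun 'I_n -> 'I_k.+1} | (mlen (fun i => a i) <= k)%N)
     Lp_norm p (weakD (fun i => a i) F))%E.

Definition ae_eq_on F G : Prop := {ae mu, forall x, Om x -> F x = G x}.

Definition fun_add F G : T -> CF A := fun x => cf_add (F x) (G x).
Definition fun_scale (c : R[i]) F : T -> CF A := fun x => cf_scale c (F x).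

End sobolev.

(* The set W of representatives, with the given operations and norm, becomes a
   complex Banach space V after identification of equivalent elements; q is the
   quotient map, of which only the restriction to W matters. *)
Definition banach_modulo (R : realType) (X : Type) (W : X -> Prop)
    (eqv : X -> X -> Prop) (add : X -> X -> X) (scale : R[i] -> X -> X)
    (norm : X -> \bar R) : Prop :=
  exists (V : completeNormedModType R[i]) (q : X -> V),
    [/\ forall v : V, exists2 F, W F & q F = v,
        forall F G, W F -> W G -> (q F = q G <-> eqv F G),
        forall F G, W F -> W G -> W (add F G) /\ q (add F G) = q F + q G,
        forall c F, W F -> W (scale c F) /\ q (scale c F) = c *: q F &
        forall F, W F -> norm F = (complex.Re `|q F|)%:E].

(* Main.v *)
From HB Require Import structures.
Require Import Defs.
From mathcomp Require Import all_boot all_order all_algebra.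
From mathcomp Require Import all_classical all_reals all_analysis.
From mathcomp Require Import measurable_realfun complex ring lra.

Set Implicit Arguments.
Unset Strict Implicit.
Unset Printing Implicit Defensive.
Import Order.TTheory GRing.Theory Num.Theory.
Import numFieldNormedType.Exports.
Local Open Scope classical_set_scope.
Local Open Scope ring_scope.

(** The argument is the classical one for W^(k,p).  If F_i is Cauchy for the
    Sobolev norm, then every sequence D^a F_i is Cauchy in L^p, and so is F_i
    itself; L^p is complete, which gives limits F and G_a.  Convergence in L^p
    implies convergence in L^1 of every compact subset of Om, and test functions
    are bounded with compact support, so both sides of the identity that defines
    weak derivatives pass to the limit and G_a is a weak derivative of F.  Hence
    F lies in the Sobolev space and F_i tends to F ([sobolev_complete]).

    Four points need work.

    Reduction to real functions.  By asymmetry an element u + vA is determined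
    by the four real numbers Re u, Im u, Re v, Im v ([cfc]).  The A-cross
    product is bilinear, and multiplying by a real test function acts on the
    four coordinates separately, so G is a weak derivative of F exactly when
    this holds coordinate by coordinate for real-valued functions and real test
    functions ([weak_derivativeP]).

    Uniqueness of weak derivatives.  The norm uses an arbitrary choice of weak
    derivatives, so it is a seminorm only because two choices agree almost
    everywhere.  This is the fundamental lemma of the calculus of variations
    ([null_pairing_ae0]): the functions exp (- 1 / (k t)), extended by zero to
    t <= 0, are smooth and increase to the indicator of t > 0, so products of
    them converge to the indicator of a box; a function that is orthogonal to
    all test functions thus has integral zero on every box, and, boxes being a
    pi-system that generates the Borel sets, on every measurable set.

    The L^p theory.  With m = m(A), the pth power of the pointwise norm is
    |u + m v|^p + |v|^p ([cf_mod]).  It is convex and homogeneous of degree p,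
    which gives the triangle inequality for the L^p norm ([Lp_normD]), and it is
    comparable with the sum of the |c|^p over the four real coordinates c, so
    completeness follows from that of the real L^p space
    ([Lp_modular_complete]): a fast Cauchy subsequence converges almost
    everywhere, and Fatou's lemma identifies its pointwise limit as the limit in
    L^p.

    Passage to the quotient.  A complete seminorm on a subspace of a complex
    vector space becomes a complete norm when vectors at distance zero are
    identified ([seminorm_banach]). *)

(** * Boxes and measurability in R^n *)

Section euclidean_boxes.
Context (R : realType) (n : nat).
Local Notation T := 'rV[R]_n.
Local Notation mu := (lebesgue_rV R n).
Implicit Types (a b : 'I_n -> R) (K Om : set T).

Definition obox a b : set T := [set x | forall i, a i < x ord0 i < b i].
(** For n = 0 every box is the whole one-point space, so boxes cannot be made
    empty by a choice of endpoints; the covers below therefore select their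
    boxes by a set of indices. *)
Definition cbox a b : set T := [set x | forall i, a i <= x ord0 i <= b i].

Lemma obox_cbox a b : obox a b `<=` cbox a b.
Proof. by move=> x xab i; have /andP[/ltW-> /ltW->] := xab i. Qed.

Lemma compact_cbox a b : compact (cbox a b).
Proof.
rewrite (_ : cbox a b = [set v | forall i, `[a i, b i]%classic (v ord0 i)]).
  apply: (@rV_compact R n (fun i => `[a i, b i]%classic)) => i.
  exact: segment_compact.
by apply/seteqP; split => x + i => /(_ i); rewrite /= in_itv.
Qed.

Lemma measurable_coord_box (Y : 'I_n -> set R) :
  (forall i, measurable (Y i)) ->
  measurable ([set x | forall i, Y i (x ord0 i)] : set T).
Proof.
move=> mY; rewrite [X in measurable X](_ : _ = \bigcap_(i in [set: 'I_n])
  (@rV_coords R n i @^-1` Y i)).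
  apply: fin_bigcap_measurable => [|i _]; first exact: finite_finset.
  by rewrite -[X in measurable X]setTI; exact: measurable_rV_coords.
by apply/seteqP; split => [x xY i _|x xY i]; [exact: xY|exact: xY].
Qed.

Lemma measurable_obox a b : measurable (obox a b).
Proof.
rewrite (_ : obox a b = [set v | forall i, `]a i, b i[%classic (v ord0 i)]).
  by apply: (@measurable_coord_box (fun i => `]a i, b i[%classic)).
by apply/seteqP; split => x + i => /(_ i); rewrite /= in_itv.
Qed.

Lemma measurable_cbox a b : measurable (cbox a b).
Proof.
rewrite (_ : cbox a b = [set v | forall i, `[a i, b i]%classic (v ord0 i)]).
  by apply: (@measurable_coord_box (fun i => `[a i, b i]%classic)).
by apply/seteqP; split => x + i => /(_ i); rewrite /= in_itv.
Qed.

Lemma lebesgue_cbox_lty a b : (mu (cbox a b) < +oo)%E.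
Proof.
have [ab|] := pselect (forall i, a i <= b i).
  by rewrite /cbox lebesgue_rV_box// ltry.
move=> /existsNP[i /negP]; rewrite -ltNge => ba.
rewrite (_ : cbox a b = set0) ?measure0 ?ltry//.
by rewrite -subset0 => x /(_ i) /andP[ax /(le_trans ax)]; rewrite leNgt ba.
Qed.

(** The kth box with rational endpoints; the default value is attained when k
    is not a code. *)
Definition rat_box (k : nat) : {ffun 'I_n -> rat * rat} :=
  odflt [ffun=> (0, 0)] (unpickle k).
Definition rat_lo k i : R := ratr (rat_box k i).1.
Definition rat_hi k i : R := ratr (rat_box k i).2.

(** Around a point of Om there is room for a rational box whose closure stays in
    Om.  The cover is countable, which gives measurability of open sets, and its
    closed boxes are compact, which lets local statements be globalised. *)
Lemma open_rat_box Om : open Om -> Om =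
  \bigcup_(k in [set k | cbox (rat_lo k) (rat_hi k) `<=` Om])
    obox (rat_lo k) (rat_hi k).
Proof.
move=> oOm; apply/seteqP; split => [x Omx|x [k kOm]]; last first.
  by move=> /obox_cbox; exact: kOm.
have /nbhs_ballP[e /= e0 eOm] : nbhs x Om by exact: open_nbhs_nbhs.
have /choice[q qP] : forall i, exists q : rat * rat,
    [/\ x ord0 i - e < ratr q.1 :> R, ratr q.1 < x ord0 i :> R,
        x ord0 i < ratr q.2 :> R & ratr q.2 < x ord0 i + e :> R].
  move=> i; have /rat_in_itvoo[q1] : x ord0 i - e < x ord0 i by rewrite gtrBl.
  have /rat_in_itvoo[q2] : x ord0 i < x ord0 i + e by rewrite ltrDl.
  rewrite !in_itv/= => /andP[q21 q22] /andP[q11 q12].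
  by exists (q1, q2).
have boxE : rat_box (pickle [ffun i => q i]) = [ffun i => q i].
  by rewrite /rat_box pickleK.
exists (pickle [ffun i => q i]) => [y /= yq|i]; last first.
  by rewrite /rat_lo /rat_hi boxE ffunE; case: (qP i) => _ -> ->.
apply: eOm; split=> // i j; rewrite (ord1 i).
have := yq j; rewrite /rat_lo /rat_hi boxE ffunE.
have := qP j => -[? ? ? ?] ?.
by rewrite /ball /= ltr_distlC; lra.
Qed.

Lemma open_measurable_rV Om : open Om -> measurable Om.
Proof.
move=> /open_rat_box ->; apply: bigcup_measurable => k _.
exact: measurable_obox.
Qed.

Lemma closed_measurable_rV K : closed K -> measurable K.
Proof.
by move=> cK; rewrite -[K]setCK; apply: measurableC; apply: open_measurable_rV;
  rewrite openC.
Qed.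

Lemma compact_closed_rV K : compact K -> closed K.
Proof. apply: compact_closed; exact: norm_hausdorff. Qed.

Lemma compact_measurable_rV K : compact K -> measurable K.
Proof. by move=> /compact_closed_rV; exact: closed_measurable_rV. Qed.

Lemma coord_le_norm (x : T) i : `|x ord0 i| <= `|x|.
Proof.
rewrite [leRHS]/Num.norm /= mx_normrE.
exact: (le_bigmax _ (fun j => `|x j.1 j.2|) (ord0, i)).
Qed.

Lemma lebesgue_compact_lty K : compact K -> (mu K < +oo)%E.
Proof.
move=> cK; have [M [_ KM]] := compact_bounded cK.
have K_box : K `<=` cbox (fun=> - (M + 1)) (fun=> M + 1).
  move=> x Kx i; rewrite -ler_norml (le_trans (coord_le_norm _ _))//.
  by apply: KM => //; rewrite ltrDl.
apply: (@le_lt_trans _ _ (mu (cbox (fun=> - (M + 1)) (fun=> M + 1)))).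
  by apply: le_measure; rewrite ?inE//;
    [exact: compact_measurable_rV|exact: measurable_cbox].
exact: lebesgue_cbox_lty.
Qed.

Lemma continuous_measurable_rV (f : T -> R) :
  continuous f -> measurable_fun setT f.
Proof.
move=> cf; apply: (measurability _ (measurable_realfun.RGenOInfty.measurableE R)).
move=> _ [_ [a ->] <-]; rewrite setTI; apply: open_measurable_rV.
by apply: open_comp => // x _; exact: cf.
Qed.

(** Local integrability speaks of compact sets only; Om is a countable union of
    compact boxes, so measurability on these is enough. *)
Lemma measurable_fun_compacts Om (f : T -> R) : open Om ->
  (forall K, compact K -> K `<=` Om -> measurable_fun K f) ->
  measurable_fun Om f.
Proof.
move=> oOm mf; have OmE : Om =
    \bigcup_(k in [set k | cbox (rat_lo k) (rat_hi k) `<=` Om])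
      cbox (rat_lo k) (rat_hi k).
  apply/seteqP; split => [|x [k kOm]]; last exact: kOm.
  rewrite {1}(open_rat_box oOm); apply: subset_bigcup => k _.
  exact: obox_cbox.
rewrite OmE => _ Y mY.
rewrite setI_bigcupl; apply: bigcup_measurable => k kOm.
by apply: mf => //; [exact: compact_cbox|exact: measurable_cbox].
Qed.

Definition oboxes : set (set T) := [set B | exists a b, B = obox a b].

Lemma setI_closed_oboxes : setI_closed oboxes.
Proof.
move=> _ _ [a [b ->]] [c [d ->]].
exists (fun i => Num.max (a i) (c i)), (fun i => Num.min (b i) (d i)).
apply/seteqP; split => x /= => [[xab xcd] i|xI].
  have := xab i; have := xcd i => /andP[? ?] /andP[? ?].
  by rewrite gt_max lt_min; apply/andP; split; apply/andP.
split => i; have := xI i; rewrite gt_max lt_min;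
  by move=> /andP[/andP[? ?] /andP[? ?]]; apply/andP.
Qed.

(** A half-space {c < x_i} is the union of the boxes whose other sides grow to
    the whole line, so open boxes generate the preimages of half-lines under the
    coordinates, hence all of them. *)
Lemma g_sigma_oboxes : @measurable _ T = <<s oboxes >>.
Proof.
apply/seteqP; split; last first.
  apply: smallest_sub; first exact: sigma_algebra_measurable.
  by move=> _ [a [b ->]]; exact: measurable_obox.
apply: smallest_sub; first exact: smallest_sigma_algebra.
move=> B; rewrite -bigcup_seq /= => -[i _].
suff : preimage_set_system setT (@rV_coords R n i) measurable
    `<=` <<s oboxes >> by exact.
rewrite [X in preimage_set_system _ _ X](measurable_realfun.RGenOInfty.measurableE R).
rewrite -g_sigma_preimageE; apply: smallest_sub.
  exact: smallest_sigma_algebra.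
move=> _ [_ [c ->] <-]; rewrite setTI.
rewrite (_ : _ @^-1` _ = \bigcup_k obox (fun j => if j == i then c else - k%:R)
    (fun j => k%:R)).
  apply: sigma_algebra_bigcup => k; apply: sub_sigma_algebra.
  by eexists; eexists; reflexivity.
apply/seteqP; split => [x /=|x [k _ /(_ i)]]; last first.
  by rewrite eqxx /= in_itv/= andbT => /andP[].
rewrite in_itv/= andbT => cx.
have [k kx] : exists k : nat, `|x| < k%:R.
  by exists (Num.truncn `|x|).+1; exact: truncnS_gt.
exists k => // j.
have := le_lt_trans (coord_le_norm x j) kx; rewrite ltr_norml.
by case: eqP => [->|_] // /andP[_ ->]; rewrite andbT.
Qed.

End euclidean_boxes.

(** * Smooth functions and bumps supported in a box *)

Section flat_functions.
Context (R : realType).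

(** The functions t^(-m) exp (-1/t), extended by zero, rather than the single
    function exp (-1/t): the linear span of this family is stable under
    differentiation. *)
Definition flat m (t : R) : R :=
  if 0 < t then (t^-1) ^+ m * expR (- t^-1) else 0.

(** With s = 1/t, exponentials beat powers: s^(m+2) <= (m+2)! exp s.  The
    quadratic bound gives the zero derivative at the origin. *)
Lemma flat_le m t : 0 <= t -> flat m t <= m.+2`!%:R * t ^+ 2.
Proof.
rewrite le_eqVlt => /predU1P[<-|t0]; rewrite /flat ?ltxx ?t0.
  by rewrite expr0n mulr0.
have s0 : 0 < t^-1 by rewrite invr_gt0.
have := expR_ge1Dxn m.+1 (ltW s0); set s := t^-1 in s0 *.
have e0 := expR_gt0 s.
move=> H; have {H}: s ^+ m.+2 / m.+2`!%:R <= expR s by lra.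
rewrite ler_pdivrMr ?ltr0n ?fact_gt0// => H.
have -> : t = s^-1 by rewrite /s invrK.
clearbody s; rewrite expRN ler_pdivrMr// exprVn mulrAC ler_pdivlMr ?exprn_gt0//.
by rewrite -exprD addn2 mulrC.
Qed.

Lemma flat_ge0 m t : 0 <= flat m t.
Proof.
rewrite /flat; case: ifP => // t0.
by rewrite mulr_ge0 ?expR_ge0// exprn_ge0// invr_ge0 ltW.
Qed.

Lemma is_derive_flat_pos m (t : R) : 0 < t ->
  is_derive t 1 (fun x : R => (x^-1) ^+ m * expR (- x^-1))
   ((t^-1) ^+ m.+2 * expR (- t^-1) - m%:R * ((t^-1) ^+ m.+1 * expR (- t^-1))).
Proof.
move=> t0.
have t_neq0 : t != 0 by rewrite gt_eqF.
have dV : is_derive t 1 (fun x : R => x^-1) (- t ^- 2).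
  by apply: is_derive_eq (is_deriveV t_neq0 (is_derive_id t 1)) _;
    rewrite [LHS]mulr1.
have dE : is_derive t 1 (fun x : R => expR (- x^-1)) (t ^- 2 * expR (- t^-1)).
  apply: is_derive_eq (is_derive1_comp (is_derive_expR _) (is_deriveN dV)) _.
  by rewrite opprK mulrC.
have dX := @is_deriveX _ _ (fun x : R => x^-1) m t 1 _ dV.
have := @is_deriveM _ _ _ _ t 1 _ _ dX dE.
rewrite (_ : _ * _ = (fun x : R => x^-1 ^+ m * expR (- x^-1)))//; last first.
  by apply/funext => x /=; rewrite [LHS]/GRing.mul /= exprfctE.
move=> d; apply: is_derive_eq.
rewrite /GRing.scale/= exprfctE.
case: m d {dX} => [|m] d.
  by rewrite !mul0r mulr0 addr0 subr0 expr0 mul1r exprVn.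
by rewrite -exprVn !exprS /=; ring.
Qed.

Lemma is_derive_flat m (t : R) :
  is_derive t 1 (flat m) (flat m.+2 t - m%:R * flat m.+1 t).
Proof.
have [t0|t0|<-] := ltgtP 0 t.
- rewrite /flat t0; apply: near_eq_is_derive (is_derive_flat_pos m t0).
  by near=> x; rewrite /flat ifT//; near: x; exact: lt_nbhsr.
- rewrite /flat ltNge (ltW t0)/= mulr0 subr0.
  apply: near_eq_is_derive (is_derive_cst (0 : R) t 1).
  near=> x; rewrite /flat ifF//; apply/negbTE; rewrite -leNgt ltW//.
  by near: x; exact: lt_nbhsl.
rewrite {2 3}/flat ltxx mulr0 subr0.
have H : (fun h : R => h^-1 *: ((flat m \o shift 0) (h *: 1) - flat m 0)) @ 0^' --> (0:R).
  apply/cvgrPdist_le => e e0.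
  pose C : R := m.+2`!%:R.
  have C0 : 0 < C by rewrite ltr0n fact_gt0.
  near=> h.
  rewrite sub0r normrN /= addr0 {2}/flat ltxx subr0 /GRing.scale /= mulr1.
  have h0 : h != 0 by near: h; exact: nbhs_dnbhs_neq.
  have he : `|h| <= e / C.
    near: h; apply: dnbhs0_le; exact: divr_gt0.
  rewrite normrM normfV ler_pdivrMl ?normr_gt0//.
  have [h1|h1] := ltP 0 h; last by rewrite /flat ltNge h1 normr0 mulr_ge0// ltW.
  rewrite (ger0_norm (flat_ge0 _ _)) (le_trans (flat_le _ (ltW h1)))//.
  rewrite (gtr0_norm h1) -/C expr2 mulrCA ler_pM2l//.
  by move: he; rewrite (gtr0_norm h1) ler_pdivlMr// mulrC.
apply: DeriveDef; first by apply/cvg_ex; exists 0.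
exact: cvg_lim H.
Unshelve. all: by end_near. Qed.

Lemma flat_le1 t : flat 0 t <= 1.
Proof.
rewrite /flat; case: ifP => // t0.
by rewrite expr0 mul1r expR_le1 oppr_le0 invr_ge0 ltW.
Qed.

(** For t > 0 the value is exp (-1/((k+1) t)). *)
Lemma cvg_flat_scaled t :
  (fun k : nat => flat 0 (k.+1%:R * t)) @ \oo --> (if 0 < t then 1 : R else 0).
Proof.
case: ifPn => [t0|]; last first.
  rewrite -leNgt => t0; rewrite (_ : (fun _ => _) = cst 0); first exact: cvg_cst.
  by apply/funext => k; rewrite /flat ltNge mulr_ge0_le0.
rewrite (_ : (fun _ => _) = (fun k : nat => expR (- (t^-1 * k.+1%:R^-1)))).
  rewrite -[X in _ --> X](@expR0 R); apply: continuous_cvg.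
    exact: continuous_expR.
  rewrite -oppr0; apply: cvgN; rewrite -[X in _ --> X](mulr0 t^-1).
  by apply: cvgM; [exact: cvg_cst|exact: cvg_harmonic].
apply/funext => k; rewrite /flat pmulr_rgt0 ?ltr0n// t0 expr0 mul1r.
by rewrite invfM mulrC.
Qed.

End flat_functions.

Section smooth_functions.
Context (R : realType) (n : nat).
Local Notation T := 'rV[R]_n.
Implicit Types (f g : T -> R) (a b : 'I_n -> R).

Lemma smooth_iter_partial s f : smooth f -> smooth (iter_partial s f).
Proof.
by move=> sf s' x; rewrite /iter_partial -foldr_cat; exact: sf.
Qed.

(** The complement of a closed set is open, so a function that vanishes there
    vanishes near each of its points, and so do its derivatives. *)
Lemma iter_partial_out s f (K : set T) : closed K ->
  (forall x, ~ K x -> f x = 0) -> forall x, ~ K x -> iter_partial s f x = 0.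
Proof.
move=> cK f0; elim: s => [//|i s IH] x Kx /=.
rewrite /partial (@near_eq_derive _ _ _ _ (cst 0)) ?derive_cst//.
have : nbhs x (~` K) by apply: open_nbhs_nbhs; split => //; rewrite openC.
by apply: filterS => y /IH.
Qed.

Lemma smooth_continuous f : smooth f -> continuous f.
Proof. by move=> sf x; apply: differentiable_continuous; exact: (sf [::]). Qed.

Lemma smooth_bounded f K : smooth f -> compact K ->
  (forall x, ~ K x -> f x = 0) -> exists M, forall x, `|f x| <= M.
Proof.
move=> sf cK f0.
have cfK : compact (f @` K).
  apply: continuous_compact => //; apply: continuous_subspaceT.
  exact: smooth_continuous.
have [M [_ fM]] := compact_bounded cfK.
exists (`|M| + 1) => x; have [Kx|/f0->] := pselect (K x); last first.
  by rewrite normr0.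
by apply: fM; [rewrite (le_lt_trans (ler_norm _))// ltrDl|exists x].
Qed.

(** An algebra of functions that contains the bumps and is visibly stable under
    partial derivatives; by induction on the order all its members are
    smooth. *)
Inductive flat_poly : (T -> R) -> Prop :=
| FlatCst c : flat_poly (fun=> c)
| FlatAdd f g : flat_poly f -> flat_poly g -> flat_poly (fun x => f x + g x)
| FlatMul f g : flat_poly f -> flat_poly g -> flat_poly (fun x => f x * g x)
| FlatGen m i c d : flat_poly (fun x => flat m (c * x ord0 i + d)).

Lemma is_derive_coord (i j : 'I_n) (x : T) :
  is_derive x (delta_mx ord0 j) (fun y : T => y ord0 i) (i == j)%:R.
Proof.
apply: DeriveDef.
  by apply: diff_derivable; exact: differentiable_coord.
have @l : {linear T -> R}.
  by exists (fun N : T => N ord0 i); do 2![eexists]; do ?[constructor];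
     rewrite ?mxE// => ? *; rewrite ?mxE//; move=> ?; rewrite !mxE.
rewrite deriveE; last exact: differentiable_coord.
rewrite (_ : (fun y : T => y ord0 i) = l)// diff_lin.
  by rewrite /= mxE eqxx.
exact: coord_continuous.
Qed.

Lemma flat_poly_partial f : flat_poly f ->
  (forall x, differentiable f x) /\ forall i, flat_poly (partial i f).
Proof.
elim=> {f} [c|f g _ [df pf] _ [dg pg]|f g Ff [df pf] Fg [dg pg]|m i c d].
- split=> [x|i]; first exact: differentiable_cst.
  rewrite (_ : partial _ _ = fun=> 0); first exact: FlatCst.
  by apply/funext => x; rewrite /partial derive_cst.
- split=> [x|i]; first exact: differentiableD.
  rewrite (_ : partial _ _ = fun x => partial i f x + partial i g x).
    exact: FlatAdd.
  by apply/funext => x; rewrite /partial deriveD//; exact: diff_derivable.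
- split=> [x|i]; first exact: differentiableM.
  rewrite (_ : partial _ _ =
      fun x => f x * partial i g x + g x * partial i f x).
    by apply: FlatAdd; exact: FlatMul.
  by apply/funext => x; rewrite /partial deriveM//; exact: diff_derivable.
pose h (x : T) : R := c * x ord0 i + d.
have dh x : differentiable h x.
  apply: differentiableD; last exact: differentiable_cst.
  apply: differentiableM; first exact: differentiable_cst.
  exact: differentiable_coord.
have dfl m' x : differentiable (flat m' : R -> R) x.
  by apply/derivable1_diffP; apply: ex_derive; exact: is_derive_flat.
split=> [x|j]; first exact: (@differentiable_comp _ _ _ _ h (flat m)).
rewrite (_ : partial _ _ = fun x => (c * (i == j)%:R) *
    (flat m.+2 (c * x ord0 i + d) + - m%:R * flat m.+1 (c * x ord0 i + d))).
  apply: FlatMul; first exact: FlatCst.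
  apply: FlatAdd; first exact: FlatGen.
  by apply: FlatMul; [exact: FlatCst|exact: FlatGen].
apply/funext => x; rewrite /partial -[fun x => _]/(flat m \o h).
rewrite deriveE; last exact: differentiable_comp.
rewrite diff_comp//= diff1E// derive1E.
rewrite (@derive_val _ _ _ _ _ _ _ (is_derive_flat m (h x))).
rewrite -deriveE//.
have Dh : is_derive x (delta_mx ord0 j) h (c * (i == j)%:R).
  have D1 := @is_deriveZ _ _ _ _ c _ _ _ (is_derive_coord i j x).
  have := @is_deriveD _ _ _ _ _ _ _ _ _ D1 (is_derive_cst d x (delta_mx ord0 j)).
  by rewrite addr0.
rewrite (@derive_val _ _ _ _ _ _ _ Dh).
by rewrite mulNr.
Qed.

Lemma flat_poly_smooth f : flat_poly f -> smooth f.
Proof.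
move=> Ff s; suff /flat_poly_partial[] : flat_poly (iter_partial s f) by [].
by elim: s => //= i s /flat_poly_partial[_]; exact.
Qed.

Definition box_bump a b (k : nat) (x : T) : R :=
  \prod_(i < n) (flat 0 (k.+1%:R * (x ord0 i - a i)) *
                 flat 0 (k.+1%:R * (b i - x ord0 i))).

Lemma smooth_box_bump a b k : smooth (box_bump a b k).
Proof.
apply: flat_poly_smooth; rewrite /box_bump.
elim: (index_enum _) => [|i s IH].
  rewrite (_ : (fun _ => _) = fun=> 1); first exact: FlatCst.
  by apply/funext => x; rewrite big_nil.
rewrite (_ : (fun _ => _) = fun x : T => (
    flat 0 (k.+1%:R * x ord0 i + (- (k.+1%:R * a i))) *
    flat 0 (- k.+1%:R * x ord0 i + (k.+1%:R * b i))) *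
  \prod_(i <- s) (flat 0 (k.+1%:R * (x ord0 i - a i)) *
                 flat 0 (k.+1%:R * (b i - x ord0 i)))).
  by apply: FlatMul => //; apply: FlatMul; exact: FlatGen.
apply/funext => x; rewrite big_cons mulrBr mulrBr; congr (_ * flat _ _ * _).
by rewrite mulNr addrC.
Qed.

Lemma box_bump_bounds a b k x : 0 <= box_bump a b k x <= 1.
Proof.
rewrite /box_bump; elim/big_ind: _ => [|y z /andP[y0 y1] /andP[z0 z1]|i _].
- by rewrite ler01 lexx.
- by rewrite mulr_ge0//= mulr_ile1.
- by rewrite mulr_ge0 ?flat_ge0//= mulr_ile1 ?flat_ge0 ?flat_le1.
Qed.

Lemma box_bump_out a b k x : ~ obox a b x -> box_bump a b k x = 0.
Proof.
move=> /existsNP[i xi]; rewrite /box_bump (bigD1 i)//=.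
move: xi => /negP; rewrite negb_and -!leNgt => /orP[] xi.
  by rewrite /flat ltNge mulr_ge0_le0 ?subr_le0//= !mul0r.
rewrite [X in _ * X * _](_ : _ = 0) ?mulr0 ?mul0r//.
by rewrite /flat ltNge mulr_ge0_le0 ?subr_le0.
Qed.

(** Together with [box_bump_bounds] this makes dominated convergence applicable. *)
Lemma cvg_box_bump a b x :
  (fun k => box_bump a b k x) @ \oo --> (\1_(obox a b) x : R).
Proof.
have [xab|xab] := pselect (obox a b x); last first.
  rewrite (_ : (fun _ => _) = cst 0); last first.
    by apply/funext => k; rewrite box_bump_out.
  by rewrite indicE memNset//; exact: cvg_cst.
rewrite indicE mem_set//= [X in _ --> X](_ : _ = \prod_(i < n) (1 : R)); last first.
  by rewrite big1_eq.
rewrite /box_bump; elim: (index_enum _) => [|i s IH].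
  under eq_fun do rewrite big_nil.
  by rewrite big_nil; exact: cvg_cst.
under eq_fun do rewrite big_cons.
rewrite big_cons; apply: cvgM => //; rewrite -[X in _ --> X]mulr1.
have /andP[ai bi] := xab i.
apply: cvgM.
  by have := @cvg_flat_scaled R (x ord0 i - a i); rewrite subr_gt0 ai.
by have := @cvg_flat_scaled R (b i - x ord0 i); rewrite subr_gt0 bi.
Qed.

End smooth_functions.

(** * The fundamental lemma of the calculus of variations *)

Section weak_pairing.
Context (R : realType) (n : nat) (Om : set 'rV[R]_n).
Hypothesis openOm : open Om.
Local Notation T := 'rV[R]_n.
Local Notation mu := (lebesgue_rV R n).
Implicit Types (f g phi : T -> R).

Let mOm : measurable Om. Proof. exact: open_measurable_rV. Qed.

Definition locint f : Prop := forall K, compact K -> K `<=` Om ->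
  mu.-integrable K (fun x => (f x)%:E).

(** Support condition stated through a compact set outside of which the function
    vanishes; it is inherited by all partial derivatives. *)
Definition real_test phi : Prop := smooth phi /\
  exists K, [/\ compact K, K `<=` Om & forall x, ~ K x -> phi x = 0].

Lemma real_test_iter_partial s phi : real_test phi -> real_test (iter_partial s phi).
Proof.
move=> [sphi [K [cK KOm phi0]]]; split; first exact: smooth_iter_partial.
exists K; split => //; apply: iter_partial_out => //.
exact: compact_closed_rV.
Qed.

Lemma real_test_measurable phi D : real_test phi -> measurable_fun D phi.
Proof.
move=> [sphi _]; apply: (measurable_funS measurableT) => //.
by apply: continuous_measurable_rV; exact: smooth_continuous.
Qed.

Lemma real_test_bounded phi : real_test phi -> exists M, forall x, `|phi x| <= M.
Proof. by move=> [sphi [K [cK _ phi0]]]; exact: smooth_bounded phi0. Qed.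

Lemma bounded_on D (h : T -> R) M : (forall x, `|h x| <= M) ->
  [bounded h x | x in D].
Proof.
move=> hM; exists M; split; first exact: num_real.
by move=> y My x _ /=; rewrite (le_trans (hM x))// ltW.
Qed.

Lemma locint_test_integrable_compact f phi K : locint f -> real_test phi ->
  compact K -> K `<=` Om -> mu.-integrable K (fun x => (f x * phi x)%:E).
Proof.
move=> lf tphi cK KOm.
have [M phiM] := real_test_bounded tphi.
have mK := compact_measurable_rV cK.
have := @integrableMl _ _ _ mu K mK (EFin \o f) phi (lf K cK KOm)
  (real_test_measurable tphi) (bounded_on K phiM).
by apply: eq_integrable => // x _; rewrite /= EFinM.
Qed.

(** The integrand vanishes off the support K of phi, so integrals over Om reduce
    to integrals over the compact set K. *)
Lemma patch_support f phi K : K `<=` Om -> (forall x, ~ K x -> phi x = 0) ->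
  (fun x => (f x * phi x)%:E) \_ Om = (fun x => (f x * phi x)%:E) \_ K.
Proof.
move=> KOm phi0; apply/funext => x; rewrite !patchE.
case: ifPn => xOm; case: ifPn => // xK.
  by rewrite phi0 ?mulr0//; move: xK; rewrite notin_setE.
by move: xOm; rewrite (mem_set (KOm _ (set_mem xK))).
Qed.

Lemma locint_test_integrable f phi : locint f -> real_test phi ->
  mu.-integrable Om (fun x => (f x * phi x)%:E).
Proof.
move=> lf /[dup] tphi [_ [K [cK KOm phi0]]].
apply: (integrable_mkcond _ mOm).2; rewrite (patch_support _ KOm)//.
have mK := compact_measurable_rV cK.
by apply: (integrable_mkcond _ mK).1; exact: locint_test_integrable_compact.
Qed.

Lemma locint_test_integralE f phi K : K `<=` Om ->
  (forall x, ~ K x -> phi x = 0) ->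
  (\int[mu]_(x in Om) (f x * phi x)%:E = \int[mu]_(x in K) (f x * phi x)%:E)%E.
Proof.
move=> KOm phi0; rewrite integral_mkcond [RHS]integral_mkcond.
by rewrite (patch_support _ KOm).
Qed.

Lemma box_bump_real_test (a b c d : 'I_n -> R) k : cbox c d `<=` Om ->
  obox a b `<=` cbox c d -> real_test (box_bump a b k).
Proof.
move=> cdOm abcd; split; first exact: smooth_box_bump.
exists (cbox c d); split => //; first exact: compact_cbox.
by move=> x xcd; apply: box_bump_out => /abcd.
Qed.

Section null_pairing.
Variable f : T -> R.
Hypotheses (lf : locint f) (f0 : forall phi, real_test phi ->
  \int[mu]_(x in Om) (f x * phi x) = 0).

(** The bumps of the open box are test functions bounded by one that converge to
    its indicator; dominated convergence on the compact box turns the vanishing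
    of the pairings into the vanishing of the integral of f. *)
Lemma null_pairing_box (a b c d : 'I_n -> R) : cbox c d `<=` Om ->
  obox a b `<=` cbox c d -> (\int[mu]_(x in obox a b) (f x)%:E = 0)%E.
Proof.
move=> cdOm abcd; pose K := cbox c d.
have cK : compact K by exact: compact_cbox.
have mK := compact_measurable_rV cK.
have tb k := box_bump_real_test k cdOm abcd.
pose F k x := (f x * box_bump a b k x)%:E.
pose G x := (f x * \1_(obox a b) x)%:E.
have mf : measurable_fun K f.
  by apply/measurable_EFinP; exact: measurable_int (lf cK cdOm).
have [||||| _ _] := @dominated_convergence _ _ _ mu K mK F G
  (fun x => `|(f x)%:E|%E).
- move=> k; apply/measurable_EFinP; apply: measurable_funM => //.
  exact: real_test_measurable (tb k).
- apply/measurable_EFinP; apply: measurable_funM => //.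
  by apply: measurable_indic; exact: measurable_obox.
- apply: aeW => x _; apply: cvg_EFin; first exact: nearW.
  by apply: cvgM; [exact: cvg_cst|exact: cvg_box_bump].
- exact: integrable_abse (lf cK cdOm).
- apply: aeW => x k _; rewrite /F /= lee_fin normrM ler_piMr//.
  by have /andP[b0 b1] := box_bump_bounds a b k x; rewrite ger0_norm.
rewrite (_ : (fun _ => _) = cst 0%E); last first.
  apply/funext => k; rewrite /F -locint_test_integralE//; last first.
    by move=> x xcd; apply: box_bump_out => /abcd.
  rewrite -[LHS]fineK; first by congr EFin; exact: f0 (tb k).
  by apply: integrable_fin_num => //; exact: locint_test_integrable.
move=> DC; have <- : (\int[mu]_(x in K) G x = 0)%E.
  by rewrite -(cvg_lim _ DC)// lim_cst.
rewrite /G integral_mkcond [RHS]integral_mkcond; apply: eq_integral => x _.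
rewrite !patchE indicE; have [xab|xab] := boolP (x \in obox a b).
  by rewrite ifT ?mulr1// inE; apply: abcd; exact: set_mem.
by rewrite mulr0; case: ifP.
Qed.

(** Dynkin's argument: boxes are stable under intersection, and the sets S for
    which the integral vanishes are stable under complements and countable
    disjoint unions, because f is integrable on the bounded box. *)
Lemma null_pairing_measurable (a b : 'I_n -> R) S : cbox a b `<=` Om ->
  measurable S -> (\int[mu]_(x in S `&` obox a b) (f x)%:E = 0)%E.
Proof.
move=> abOm; set Q := obox a b.
have mQ : measurable Q by exact: measurable_obox.
have fQ : mu.-integrable Q (fun x => (f x)%:E).
  apply: (@integrableS _ _ _ _ (cbox a b)) => //.
  - exact: measurable_cbox.
  - exact: obox_cbox.
  - by apply: lf => //; exact: compact_cbox.
have mfQ := measurable_int _ fQ.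
rewrite g_sigma_oboxes.
apply: (dynkin_induction (P := fun S : set T =>
  (\int[mu]_(x in S `&` Q) (f x)%:E = 0)%E) (g_sigma_oboxes R n)
  (@setI_closed_oboxes R n)).
- by rewrite setTI; apply: null_pairing_box abOm _; exact: obox_cbox.
- move=> _ [c [d ->]].
  have [c' [d' E]] : oboxes (obox c d `&` Q).
    by apply: setI_closed_oboxes; [exists c, d|exists a, b].
  rewrite E; apply: null_pairing_box abOm _; rewrite -E => x [_].
  exact: obox_cbox.
- move=> B mB B0.
  have : (\int[mu]_(x in (B `&` Q) `|` (~` B `&` Q)) (f x)%:E = 0)%E.
    rewrite -setIUl setUv setTI.
    by apply: null_pairing_box abOm _; exact: obox_cbox.
  rewrite integral_setU ?B0 ?add0e//.
  + exact: measurableI.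
  + by apply: measurableI => //; exact: measurableC.
  + by rewrite -setIUl setUv setTI.
  + by rewrite disj_set2E; apply/eqP; rewrite setIACA setICr set0I.
move=> F mF tF F0; rewrite setI_bigcupl integral_bigcup.
- by rewrite eseries0.
- by apply: trivIset_setIr.
- by move=> k; exact: measurableI.
- apply: integrableS fQ => //.
  by apply: bigcupT_measurable => k; exact: measurableI.
  by apply: bigcup_sub => k _; exact: subIsetr.
Qed.

(** The fundamental lemma of the calculus of variations.  A function with zero
    integral on all measurable subsets of a box vanishes almost everywhere
    there, and countably many boxes cover Om. *)
Lemma null_pairing_ae0 : {ae mu, forall x, Om x -> f x = 0}.
Proof.
have box0 (a b : 'I_n -> R) : cbox a b `<=` Om ->
    mu.-negligible [set x | obox a b x /\ f x <> 0].
  move=> abOm.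
  have fQ : mu.-integrable (obox a b) (fun x => (f x)%:E).
    apply: (@integrableS _ _ _ _ (cbox a b)) => //.
    - exact: measurable_cbox.
    - exact: measurable_obox.
    - exact: obox_cbox.
    - by apply: lf => //; exact: compact_cbox.
  have : ae_eq mu (obox a b) (fun x => (f x)%:E) (cst 0%E).
    apply: integral_ae_eq => //; first exact: measurable_obox.
    move=> E EQ mE; rewrite integral_cst// mul0e.
    by rewrite -(setIidl EQ) null_pairing_measurable.
  apply: negligibleS => x [xab fx0] /=.
  by move=> /(_ xab) [].
have negl := @negligible_bigcup _ _ _ mu (fun k =>
  [set x | cbox (rat_lo R k) (rat_hi R k) `<=` Om /\
           obox (rat_lo R k) (rat_hi R k) x /\ f x <> 0]).
have [|A [mA A0 NA]] := negl.
  move=> k; have [kOm|kOm] := pselect (cbox (rat_lo R k) (rat_hi R k) `<=` Om).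
    by apply: negligibleS (box0 _ _ kOm) => x [].
  by apply: negligibleS (negligible_set0 _) => x [].
exists A; split => // x /= /not_implyP[+ fx0].
by rewrite {1}(open_rat_box openOm) => -[k kOm xk]; apply: NA; exists k.
Qed.

End null_pairing.
End weak_pairing.

(** * Completeness of the real L^p spaces *)

Section power_estimates.
Context (R : realType).
Implicit Types (p e t : R).

(** If t > e, then t^(p-1) >= e^(p-1).  This bounds L^1 norms on sets of finite
    measure by integrals of pth powers. *)
Lemma le_eps_powR p e t : 1 <= p -> 0 < e -> 0 <= t ->
  t <= e + e `^ (1 - p) * t `^ p.
Proof.
move=> p1 e0 t0; have [te|et] := leP t e.
  by rewrite (le_trans te)// lerDl mulr_ge0// powR_ge0.
have t0' : 0 < t by exact: lt_trans et.
rewrite -[leLHS]add0r lerD ?(ltW e0)//.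
rewrite -(mulr_powRB1 t0); last by rewrite (lt_le_trans ltr01).
rewrite mulrCA ler_peMr// -opprB powRN.
rewrite mulrC ler_pdivlMr ?powR_gt0// mul1r.
by rewrite ge0_ler_powR ?subr_ge0// ?nnegrE ltW.
Qed.

(** Away from zero the power function is differentiable; at zero it is compared
    with e through the inverse power. *)
Lemma cvg_powR (u : nat -> R) t p : 0 < p -> (forall j, 0 <= u j) ->
  u @ \oo --> t -> (fun j => u j `^ p) @ \oo --> t `^ p.
Proof.
move=> p0 u0 ut; have t0 : 0 <= t.
  by rewrite -(cvg_lim _ ut)//; apply: limr_ge; [exact: cvgP ut|exact: nearW].
move: t0; rewrite le_eqVlt => /predU1P[t0|t0]; last first.
  apply: (@continuous_cvg _ _ _ _ _ u (fun x : R => x `^ p) t) => //.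
  apply: differentiable_continuous; apply/derivable1_diffP.
  by apply: derivable_powR; rewrite in_itv/= t0.
rewrite -{}t0 in ut *; rewrite powR0 ?gt_eqF//.
apply/cvgrPdist_le => e e0.
have e1 : 0 < e `^ p^-1 by exact: powR_gt0.
move/cvgrPdist_le : ut => /(_ _ e1); apply: filterS => j.
rewrite !sub0r !normrN (ger0_norm (u0 j)) (ger0_norm (powR_ge0 _ _)) => uj.
have := ge0_ler_powR (ltW p0) _ _ uj; rewrite -powRrM mulVf ?gt_eqF//.
by rewrite powRr1 ?(ltW e0)//; apply; rewrite nnegrE ?powR_ge0.
Qed.

End power_estimates.

Section Lp_completeness.
Context d (T : measurableType d) (R : realType).
Context (mu : {measure set T -> \bar R}) (D : set T) (mD : measurable D).
Context (p : R) (p1 : 1 <= p).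
Implicit Types (f g : T -> R).

(** The pth power of the L^p norm. *)
Definition Lp_modular f : \bar R := (\int[mu]_(x in D) (`|f x| `^ p)%:E)%E.

Let p0 : 0 < p. Proof. exact: lt_le_trans ltr01 p1. Qed.

Lemma measurable_abs_powR f : measurable_fun D f ->
  measurable_fun D (fun x => `|f x| `^ p).
Proof.
move=> mf; apply: (measurableT_comp (measurable_powR p)).
exact: measurableT_comp.
Qed.

(** By [le_eps_powR] with e = 2^(-j), the increment of index j is at most
    2^(-j) plus the jth term of the assumed series, so the increments are
    summable. *)
Lemma cvgn_of_summable_powR (h : nat -> R) (S : \bar R) : (S < +oo)%E ->
  (\sum_(j <oo) (((2^-1) ^+ j) `^ (1 - p) * `|h j.+1 - h j| `^ p)%:E <= S)%E ->
  cvgn h.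
Proof.
move=> Soo hS.
pose w j := ((2^-1 : R) ^+ j) `^ (1 - p) * `|h j.+1 - h j| `^ p.
have w0 j : 0 <= w j by rewrite mulr_ge0 ?powR_ge0.
have S0 : (0 <= S)%E.
  by apply: le_trans hS; apply: nneseries_ge0 => j _ _; rewrite lee_fin w0.
have cw : cvgn (series w).
  apply: nondecreasing_is_cvgn; first exact: nondecreasing_series.
  exists (fine S) => _ [k _ <-].
  rewrite -lee_fin fineK ?ge0_fin_numE//; apply: le_trans hS.
  rewrite /series /= -sumEFin; apply: nneseries_lim_ge => j _ _.
  by rewrite lee_fin w0.
have cg : cvgn (series (geometric 1 (2^-1 : R))).
  by apply: is_cvg_geometric_series; rewrite ger0_norm ?invf_lt1 ?ltr1n ?ltr0n.
have cs : cvgn (series (telescope h)).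
  apply: normed_cvg; apply: (@series_le_cvg _ _ (fun j => (geometric 1 2^-1 j + w j))).
  - by move=> j; exact: normr_ge0.
  - by move=> j; rewrite addr_ge0//= mul1r exprn_ge0// invr_ge0.
  - move=> j; rewrite /= mul1r; apply: le_eps_powR => //.
  - rewrite (_ : series _ = series (geometric 1 2^-1) + series w).
      exact: is_cvgD.
    by apply/funext => k; rewrite addrfctE /series /= big_split.
rewrite (_ : h = (fun j => h 0%N + series (telescope h) j)); last first.
  by apply/funext => j; exact: eq_sum_telescope.
by apply: is_cvgD => //; exact: is_cvg_cst.
Qed.

(** Fatou's lemma applied to |f - h_j|^p. *)
Lemma Lp_modular_fatou (h : nat -> T -> R) f g (e : R) :
  (forall j, measurable_fun D (h j)) -> measurable_fun D f ->
  measurable_fun D g -> {ae mu, forall x, D x -> h ^~ x @ \oo --> g x} ->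
  (\forall j \near \oo, (Lp_modular (fun x => f x - h j x)%R <= e%:E)%E) ->
  (Lp_modular (fun x => f x - g x)%R <= e%:E)%E.
Proof.
move=> mh mf mg hg he.
pose F j x := (`|f x - h j x| `^ p)%:E.
have mF j : measurable_fun D (F j).
  apply/measurable_EFinP; apply: measurable_abs_powR.
  exact: measurable_funB.
have F0 j x : D x -> (0 <= F j x)%E by move=> _; rewrite lee_fin powR_ge0.
apply: (@le_trans _ _ (\int[mu]_(x in D) limn_einf (F^~ x))%E).
  apply: ae_ge0_le_integral => //.
  - apply/measurable_EFinP; apply: measurable_abs_powR.
    exact: measurable_funB.
  - move=> x Dx; rewrite limn_einf_lim; apply: lime_ge; first exact: is_cvg_einfs.
    by apply: nearW => j; apply: le_ereal_inf_tmp => _ [k _ <-]; exact: F0.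
  - rewrite /limn_einf; apply: measurableT_comp => //.
    by apply: measurable_fun_limn_esup => j; exact: measurableT_comp.
  apply: filterS hg => x /[apply] hx.
  suff /cvg_limn_einf_sup[-> _] : F^~ x @ \oo --> (`|f x - g x| `^ p)%:E by [].
  apply: cvg_EFin; first exact: nearW.
  apply: cvg_powR => //; apply: cvg_norm; apply: cvgB => //; exact: cvg_cst.
apply: (le_trans (fatou mu mD mF F0)).
rewrite limn_einf_lim; apply: lime_le; first exact: is_cvg_einfs.
apply: filterS he => j; apply: le_trans.
by apply: ereal_inf_lbound; exists j => /=.
Qed.

(** The Riesz-Fischer theorem.  Along a subsequence with |h_(j+1) - h_j|^p of
    integral at most 2^(-j p), the series of [cvgn_of_summable_powR] has an
    integral bounded by the sum of the 2^(-j), hence is finite almost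
    everywhere. *)
Lemma Lp_modular_complete (f : nat -> T -> R) :
  (forall i, measurable_fun D (f i)) ->
  (forall e : R, 0 < e -> exists N, forall i j, (N <= i)%N -> (N <= j)%N ->
    (Lp_modular (fun x => f i x - f j x)%R <= e%:E)%E) ->
  exists2 g : T -> R, measurable_fun D g & forall e : R, 0 < e ->
    exists N, forall i, (N <= i)%N ->
      (Lp_modular (fun x => f i x - g x)%R <= e%:E)%E.
Proof.
move=> mf fC; pose r (j : nat) : R := 2^-1 ^+ j.
have r0 j : 0 < r j by rewrite exprn_gt0// invr_gt0.
have /choice[N NP] : forall j, exists N, forall i k, (N <= i)%N -> (N <= k)%N ->
    (Lp_modular (fun x => f i x - f k x)%R <= (r j `^ p)%:E)%E.
  by move=> j; apply: fC; exact: powR_gt0.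
(* Above every N i with i <= j, and at least j so that h is cofinal in f. *)
pose phi j := (\max_(i < j.+1) N i + j)%N.
have Nphi i j : (i <= j)%N -> (N i <= phi j)%N.
  move=> ij; rewrite (leq_trans _ (leq_addr _ _))//.
  exact: (@leq_bigmax _ (fun i : 'I_j.+1 => N i) (Ordinal (ij : (i < j.+1)%N))).
pose h j := f (phi j).
have mh j : measurable_fun D (h j) by exact: mf.
pose w j x := (r j `^ (1 - p) * `|h j.+1 x - h j x| `^ p)%:E.
have w0 j x : D x -> (0 <= w j x)%E.
  by move=> _; rewrite lee_fin mulr_ge0 ?powR_ge0.
have mw j : measurable_fun D (w j).
  apply/measurable_EFinP; apply: measurable_funM; first exact: measurable_cst.
  by apply: measurable_abs_powR; exact: measurable_funB.
pose S x := (\sum_(j <oo) w j x)%E.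
have iS : mu.-integrable D S.
  apply/integrableP; split.
    by apply: ge0_emeasurable_sum => [j x Dx _|j _]; [exact: w0|exact: mw].
  rewrite (eq_integral S); last first.
    by move=> x /set_mem Dx; rewrite gee0_abs//; apply: nneseries_ge0 => j _ _; exact: w0.
  rewrite /S integral_nneseries//.
  apply: (@le_lt_trans _ _ (\sum_(j <oo) (r j)%:E)%E).
    apply: lee_nneseries => [j _ _|j _].
      by apply: integral_ge0 => x; exact: w0.
    rewrite /w; under eq_integral do rewrite EFinM.
    rewrite ge0_integralZl//; last first.
    - by rewrite lee_fin powR_ge0.
    - apply/measurable_EFinP; apply: measurable_abs_powR.
      exact: measurable_funB.
    apply: (@le_trans _ _ ((r j `^ (1 - p))%:E * (r j `^ p)%:E)%E).
      apply: lee_wpmul2l; first by rewrite lee_fin powR_ge0.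
      by apply: NP; apply: Nphi.
    rewrite -EFinM -powRD; last by rewrite (gt_eqF (r0 j)) implybT.
    by rewrite subrK powRr1// ltW.
  rewrite [X in (limn X < _)%E](_ : _ = EFin \o series (geometric 1 2^-1)).
    rewrite EFin_lim ?ltry//.
    by apply: is_cvg_geometric_series; rewrite ger0_norm ?invf_lt1 ?ltr1n ?ltr0n.
  apply/funext => k; rewrite /series /= -sumEFin; apply: eq_bigr => j _.
  by rewrite /r mul1r.
(* The upper limit is measurable; it is the limit wherever h converges. *)
pose g x := fine (limn_esup (fun j => (h j x)%:E)).
have mg : measurable_fun D g.
  apply: measurableT_comp => //; apply: measurable_fun_limn_esup => j.
  exact/measurable_EFinP.
have hg : {ae mu, forall x, D x -> h ^~ x @ \oo --> g x}.
  have := integrable_ae mD iS; apply: filterS => x /[apply] Sx.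
  have /cvg_ex[l hl] : cvgn (h^~ x).
    apply: (@cvgn_of_summable_powR _ (S x)); last exact: lexx.
    by move: Sx; rewrite fin_numElt => /andP[].
  rewrite /g (_ : limn_esup _ = l%:E)//.
  suff /cvg_limn_einf_sup[_ ->] : (fun j => (h j x)%:E) @ \oo --> l%:E by [].
  by apply: cvg_EFin => //; exact: nearW.
exists g => // e e0; have [M MP] := fC e e0; exists M => i Mi.
apply: Lp_modular_fatou hg _ => //.
exists M => // j Mj; apply: MP => //.
by rewrite (leq_trans Mj)// leq_addl.
Qed.

End Lp_completeness.

(** * Weak derivatives of real functions *)

Section real_weak_derivative.
Context (R : realType) (n : nat) (Om : set 'rV[R]_n).
Hypothesis openOm : open Om.
Local Notation T := 'rV[R]_n.
Local Notation mu := (lebesgue_rV R n).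
Implicit Types (f g phi : T -> R) (a : 'I_n -> nat).

Let mOm : measurable Om. Proof. exact: open_measurable_rV. Qed.

Definition real_weakD a f g : Prop := forall phi, real_test Om phi ->
  \int[mu]_(x in Om) (f x * mderive a phi x) =
  (-1) ^+ mlen a * \int[mu]_(x in Om) (g x * phi x).

Lemma real_test_mderive a phi : real_test Om phi -> real_test Om (mderive a phi).
Proof. exact: real_test_iter_partial. Qed.

Lemma locintD f g : locint Om f -> locint Om g ->
  locint Om (fun x => f x + g x).
Proof.
move=> lf lg K cK KOm; have mK := compact_measurable_rV cK.
exact: integrableD (lf K cK KOm) (lg K cK KOm).
Qed.

Lemma locintZ (c : R) f : locint Om f -> locint Om (fun x => c * f x).
Proof.
move=> lf K cK KOm; have mK := compact_measurable_rV cK.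
exact: integrableZl (lf K cK KOm).
Qed.

Lemma locintB f g : locint Om f -> locint Om g ->
  locint Om (fun x => f x - g x).
Proof.
move=> lf lg K cK KOm; have mK := compact_measurable_rV cK.
exact: integrableB (lf K cK KOm) (lg K cK KOm).
Qed.

Lemma locint_measurable f : locint Om f -> measurable_fun Om f.
Proof.
move=> lf; apply: measurable_fun_compacts => // K cK KOm.
by apply/measurable_EFinP; exact: measurable_int (lf K cK KOm).
Qed.

Lemma real_weakD_add a f f' g g' : locint Om f -> locint Om f' -> locint Om g ->
  locint Om g' -> real_weakD a f g -> real_weakD a f' g' ->
  real_weakD a (fun x => f x + f' x) (fun x => g x + g' x).
Proof.
move=> lf lf' lg lg' fg fg' phi tphi; have tD := real_test_mderive a tphi.
under eq_Rintegral do rewrite mulrDl.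
under [in RHS]eq_Rintegral do rewrite mulrDl.
rewrite !RintegralD//; try exact: locint_test_integrable.
by rewrite fg// fg'// mulrDr.
Qed.

Lemma real_weakD_scale a c f g : locint Om f -> locint Om g -> real_weakD a f g ->
  real_weakD a (fun x => c * f x) (fun x => c * g x).
Proof.
move=> lf lg fg phi tphi; have tD := real_test_mderive a tphi.
under eq_Rintegral do rewrite -mulrA.
under [in RHS]eq_Rintegral do rewrite -mulrA.
rewrite !RintegralZl//; try exact: locint_test_integrable.
by rewrite fg// mulrCA.
Qed.

(** The difference of two weak derivatives is orthogonal to all test functions. *)
Lemma real_weakD_unique a f g g' : locint Om g -> locint Om g' ->
  real_weakD a f g -> real_weakD a f g' -> {ae mu, forall x, Om x -> g x = g' x}.
Proof.
move=> lg lg' fg fg'.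
have := @null_pairing_ae0 _ _ _ openOm _ (locintB lg lg').
move=> /(_ _)/wrap[phi tphi|].
  under eq_Rintegral do rewrite mulrBl.
  rewrite RintegralB//; try exact: locint_test_integrable.
  have := fg phi tphi; rewrite fg'// => /(mulfI _) ->; first by rewrite subrr.
  by rewrite signr_eq0.
by apply: filterS => x /[apply] /eqP; rewrite subr_eq0 => /eqP.
Qed.

Lemma mderive0 (a : 'I_n -> nat) phi : (forall i, a i = 0%N) ->
  mderive a phi = phi.
Proof.
move=> a0; rewrite /mderive (_ : flatten _ = [::])//.
by elim: (enum _) => //= i s ->; rewrite a0.
Qed.

Lemma mlen0 (a : 'I_n -> nat) : (forall i, a i = 0%N) -> mlen a = 0%N.
Proof. by move=> a0; rewrite /mlen big1. Qed.

Lemma real_weakD_id (a : 'I_n -> nat) f : (forall i, a i = 0%N) -> real_weakD a f f.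
Proof.
by move=> a0 phi tphi; rewrite mderive0// mlen0// expr0 mul1r.
Qed.

Lemma real_weakD_null a f : locint Om f -> {ae mu, forall x, Om x -> f x = 0} ->
  real_weakD a f (fun=> 0).
Proof.
move=> lf f0 phi tphi.
under [in RHS]eq_Rintegral do rewrite mul0r.
rewrite Rintegral_cst// mul0r mulr0 /Rintegral.
rewrite (_ : (\int[mu]_(x in Om) _)%E = (\int[mu]_(x in Om) cst 0 x)%E).
  by rewrite integral0.
have tD := real_test_mderive a tphi.
apply: ae_eq_integral => //.
  exact: measurable_int (locint_test_integrable openOm lf tD).
by apply: filterS f0 => x /[apply] ->; rewrite mul0r.
Qed.

Definition L1loc_cvg (f : nat -> T -> R) g : Prop :=
  forall K, compact K -> K `<=` Om -> forall e : R, 0 < e ->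
  exists N, forall j, (N <= j)%N ->
    (\int[mu]_(x in K) (`|f j x - g x|)%:E <= e%:E)%E.

(** On the compact support of phi the error is at most a bound of |phi| times
    the L^1 distance. *)
Lemma pairing_cvg (f : nat -> T -> R) g phi : (forall j, locint Om (f j)) ->
  locint Om g -> L1loc_cvg f g -> real_test Om phi ->
  (fun j => \int[mu]_(x in Om) (f j x * phi x)) @ \oo -->
  \int[mu]_(x in Om) (g x * phi x).
Proof.
move=> lf lg fg tphi; have [_ [K [cK KOm phi0]]] := tphi.
have [M phiM] := real_test_bounded tphi.
have mK := compact_measurable_rV cK.
apply/cvgrPdist_le => e e0.
have M0 : 0 < `|M| + 1 by rewrite ltr_wpDl.
have [N NP] := fg K cK KOm _ (divr_gt0 e0 M0).
exists N => // j /NP {}NP /=.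
rewrite distrC -RintegralB//; try exact: locint_test_integrable.
rewrite (_ : (fun x => f j x * phi x - g x * phi x) =
             (fun x => (f j x - g x) * phi x)); last first.
  by apply/funext => x; rewrite mulrBl.
have lB := locintB (lf j) lg.
rewrite -lee_fin EFin_normr_Rintegral//; last exact: locint_test_integrable.
rewrite (locint_test_integralE _ KOm)//.
have iK := locint_test_integrable_compact lB tphi cK KOm.
apply: (le_trans (le_abse_integral _ mK (measurable_int _ iK))).
apply: (@le_trans _ _ (\int[mu]_(x in K) ((`|M| + 1)%:E * `|f j x - g x|%:E))%E).
  apply: ge0_le_integral => //.
  - by apply: measurableT_comp => //; exact: measurable_int iK.
  - apply: measurable_funeM; apply/measurable_EFinP.
    apply: measurableT_comp => //; apply/measurable_EFinP.
    exact: measurable_int (lB K cK KOm).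
  - move=> x _; rewrite /= -EFinM lee_fin normrM mulrC ler_wpM2r//.
    by rewrite (le_trans (phiM x))// (le_trans (ler_norm _))// lerDl.
have mBK : measurable_fun K (fun x => `|f j x - g x|%:E).
  apply/measurable_EFinP; apply: measurableT_comp => //; apply/measurable_EFinP.
  exact: measurable_int (lB K cK KOm).
rewrite ge0_integralZl ?lee_fin ?(ltW M0)//.
apply: (@le_trans _ _ ((`|M| + 1)%:E * (e / (`|M| + 1))%:E)%E).
  by apply: lee_wpmul2l => //; rewrite lee_fin ltW.
by rewrite -EFinM lee_fin mulrC divfK// gt_eqF.
Qed.

(** Weak derivatives are a closed relation for L^1 convergence on compact sets:
    both sides of the defining identity are continuous in f and g. *)
Lemma real_weakD_cvg a (f g : nat -> T -> R) f' g' : (forall j, locint Om (f j)) ->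
  (forall j, locint Om (g j)) -> locint Om f' -> locint Om g' ->
  L1loc_cvg f f' -> L1loc_cvg g g' -> (forall j, real_weakD a (f j) (g j)) ->
  real_weakD a f' g'.
Proof.
move=> lf lg lf' lg' ff' gg' fg phi tphi.
have tD := real_test_mderive a tphi.
have c1 := pairing_cvg lf lf' ff' tD.
have c2 := pairing_cvg lg lg' gg' tphi.
have c3 : (fun j => \int[mu]_(x in Om) (f j x * mderive a phi x)) @ \oo -->
    (-1) ^+ mlen a * \int[mu]_(x in Om) (g' x * phi x).
  rewrite (_ : (fun j => _) = fun j => (-1) ^+ mlen a *
    \int[mu]_(x in Om) (g j x * phi x)); last by apply/funext => j; rewrite fg.
  by apply: cvgM => //; exact: cvg_cst.
exact: cvg_unique c1 c3.
Qed.

Section modular.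
Context (p : R) (p1 : 1 <= p).

(** Integrating [le_eps_powR] over a compact set, which has finite measure. *)
Lemma integral_compact_le f K (e : R) : measurable_fun Om f -> compact K ->
  K `<=` Om -> 0 < e ->
  (\int[mu]_(x in K) (`|f x|)%:E <=
   e%:E * mu K + (e `^ (1 - p))%:E * Lp_modular mu Om p f)%E.
Proof.
move=> mf cK KOm e0; have mK := compact_measurable_rV cK.
have mfK : measurable_fun K f by exact: measurable_funS mf.
have mpK : measurable_fun K (fun x => (`|f x| `^ p)%:E).
  by apply/measurable_EFinP; exact: measurable_abs_powR.
apply: (@le_trans _ _ (\int[mu]_(x in K)
    (e%:E + (e `^ (1 - p))%:E * (`|f x| `^ p)%:E))%E).
  apply: ge0_le_integral => //.
  - by apply/measurable_EFinP; exact: measurableT_comp.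
  - by apply: emeasurable_funD => //; exact: measurable_funeM.
  - by move=> x _; rewrite -EFinM -EFinD lee_fin; exact: le_eps_powR.
have e0' (x : T) : K x -> (0 <= e%:E)%E by move=> _; rewrite lee_fin ltW.
have w0 (x : T) : K x -> (0 <= (e `^ (1 - p))%:E * (`|f x| `^ p)%:E)%E.
  by move=> _; rewrite mule_ge0// lee_fin powR_ge0.
have mw : measurable_fun K (fun x => (e `^ (1 - p))%:E * (`|f x| `^ p)%:E)%E.
  exact: measurable_funeM.
rewrite ge0_integralD//.
rewrite integral_cst// leeD2l// ge0_integralZl ?lee_fin ?powR_ge0//.
apply: lee_wpmul2l; first by rewrite lee_fin powR_ge0.
apply: ge0_subset_integral => //.
by apply/measurable_EFinP; exact: measurable_abs_powR.
Qed.

Lemma Lp_modular_locint f : measurable_fun Om f ->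
  (Lp_modular mu Om p f < +oo)%E -> locint Om f.
Proof.
move=> mf foo K cK KOm; have mK := compact_measurable_rV cK.
apply/integrableP; split.
  by apply/measurable_EFinP; exact: measurable_funS mf.
apply: (le_lt_trans (integral_compact_le mf cK KOm ltr01)).
rewrite mul1e powR1 mul1e lte_add_pinfty//; exact: lebesgue_compact_lty.
Qed.

(** In [integral_compact_le] the parameter is first chosen small enough for the
    measure of K, then the modular is made small. *)
Lemma Lp_modular_L1loc (f : nat -> T -> R) g :
  (forall j, measurable_fun Om (f j)) -> measurable_fun Om g ->
  (forall e : R, 0 < e -> exists N, forall j, (N <= j)%N ->
    (Lp_modular mu Om p (fun x => f j x - g x)%R <= e%:E)%E) ->
  L1loc_cvg f g.
Proof.
move=> mf mg fg K cK KOm e e0.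
have muK : mu K \is a fin_num.
  by rewrite ge0_fin_numE// lebesgue_compact_lty.
pose m := fine (mu K); have m0 : 0 <= m by exact: fine_ge0.
(* This makes the first summand of the bound at most e / 2, even if m = 0. *)
pose d := e / 2 / (m + 1).
have d0 : 0 < d by rewrite !divr_gt0// ltr_wpDl.
have w0 : 0 < d `^ (1 - p) by exact: powR_gt0.
have [N NP] := fg _ (divr_gt0 (divr_gt0 e0 (ltr0n R 2)) w0).
exists N => j Nj.
have mB : measurable_fun Om (fun x => f j x - g x) by exact: measurable_funB.
apply: (le_trans (integral_compact_le mB cK KOm d0)).
apply: (@le_trans _ _ (d%:E * mu K + (d `^ (1 - p))%:E *
  (e / 2 / d `^ (1 - p))%:E)%E).
  by apply: leeD2l; apply: lee_wpmul2l; [rewrite lee_fin ltW|exact: NP].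
rewrite -(fineK muK) -EFinM -EFinM -EFinD lee_fin -/m.
rewrite mulrCA divff ?gt_eqF// mulr1 [leRHS]splitr lerD2r.
by rewrite /d mulrAC ler_pdivrMr ?ltr_wpDl// ler_wpM2l ?divr_ge0 ?(ltW e0)// lerDl.
Qed.

End modular.
End real_weak_derivative.

(** * Real coordinates of u + vA and weak derivatives *)

Section cf_coordinates.
Context (R : realType) (A : fuzzy_number R).
Hypothesis asymA : asymmetric A.
Implicit Types (x y : CF A) (j : bool * bool).

Definition ccoord (b : bool) (z : R[i]) : R :=
  if b then complex.Im z else complex.Re z.

(** The four real coordinates of u + vA, indexed by pairs of booleans so that
    statements about all of them are stated once. *)
Definition cfc j x : R :=
  ccoord j.1 (if j.2 then vcoord x else ucoord x).

Definition cf_of (c : bool * bool -> R) : CF A :=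
  psi A (Complex (c (false, false)) (c (true, false)))
        (Complex (c (false, true)) (c (true, true))).

Lemma ucoord_psi u v : ucoord (psi A u v) = u.
Proof. by have [] := psiK u v asymA. Qed.

Lemma vcoord_psi u v : vcoord (psi A u v) = v.
Proof. by have [] := psiK u v asymA. Qed.

Lemma cfc_of c j : cfc j (cf_of c) = c j.
Proof. by case: j => -[] []; rewrite /cfc/= ?ucoord_psi ?vcoord_psi. Qed.

Lemma cfc_inj x y : (forall j, cfc j x = cfc j y) -> x = y.
Proof.
move=> xy; rewrite -(psi_coord x) -(psi_coord y).
have := xy (false, false); have := xy (true, false).
have := xy (false, true); have := xy (true, true).
rewrite /cfc /=; case: (ucoord x) (vcoord x) (ucoord y) (vcoord y).
by move=> a b [c d] [a' b'] [c' d'] /= -> -> -> ->.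
Qed.

Lemma cfcD j x y : cfc j (cf_add x y) = cfc j x + cfc j y.
Proof.
rewrite /cfc /cf_add ucoord_psi vcoord_psi.
case: (ucoord x) (vcoord x) (ucoord y) (vcoord y) => a b [c d] [a' b'] [c' d'].
by case: j => -[] [].
Qed.

Lemma cfcZ j (c : R[i]) x : cfc j (cf_scale c x) =
  complex.Re c * cfc j x +
  (if j.1 then complex.Im c else - complex.Im c) * cfc (~~ j.1, j.2) x.
Proof.
rewrite /cfc /cf_scale ucoord_psi vcoord_psi.
case: (ucoord x) (vcoord x) c => a b [a' b'] [c d].
by case: j => -[] [] /=; rewrite ?mulNr// addrC.
Qed.

Lemma cfcZr j (c : R) x : cfc j (cf_scale c%:C%C x) = c * cfc j x.
Proof.
by rewrite cfcZ; case: j => -[] b /=; rewrite ?oppr0 mul0r addr0.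
Qed.

Lemma cfc0 j : cfc j (cf_zero A) = 0.
Proof.
by rewrite /cfc /cf_zero ucoord_psi vcoord_psi; case: j => -[] [].
Qed.

Lemma cf_addA : associative (@cf_add R A).
Proof. by move=> x y z; apply: cfc_inj => j; rewrite !cfcD addrA. Qed.

Lemma cf_addC : commutative (@cf_add R A).
Proof. by move=> x y; apply: cfc_inj => j; rewrite !cfcD addrC. Qed.

Lemma cf_add0 : left_id (cf_zero A) (@cf_add R A).
Proof. by move=> x; apply: cfc_inj => j; rewrite cfcD cfc0 add0r. Qed.

Lemma cf_addN : left_inverse (cf_zero A) (cf_scale (-1)) (@cf_add R A).
Proof.
move=> x; rewrite /cf_add /cf_scale ucoord_psi vcoord_psi.
by rewrite !mulN1r !addNr.
Qed.

Lemma cf_scaleA (a b : R[i]) x : cf_scale a (cf_scale b x) = cf_scale (a * b) x.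
Proof. by rewrite /cf_scale ucoord_psi vcoord_psi !mulrA. Qed.

Lemma cf_scale1 : left_id 1 (@cf_scale R A).
Proof. by move=> x; rewrite /cf_scale !mul1r psi_coord. Qed.

Lemma cf_scaleDr : right_distributive (@cf_scale R A) (@cf_add R A).
Proof.
move=> c x y; rewrite /cf_scale /cf_add !ucoord_psi !vcoord_psi.
by rewrite !mulrDr.
Qed.

Lemma cf_scaleDl x : {morph (@cf_scale R A)^~ x : a b / a + b >-> cf_add a b}.
Proof.
move=> a b; rewrite /cf_scale /cf_add !ucoord_psi !vcoord_psi.
by rewrite !mulrDl.
Qed.

End cf_coordinates.

(** An alias of the type of all u + vA that records asymmetry, on which the
    operations depend to be a vector space. *)
Definition cf_space (R : realType) (A : fuzzy_number R) (asymA : asymmetric A)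
  : Type := CF A.

Section cf_space_lmodule.
Context (R : realType) (A : fuzzy_number R) (asymA : asymmetric A).

HB.instance Definition _ := gen_eqMixin (cf_space asymA).
HB.instance Definition _ := gen_choiceMixin (cf_space asymA).
HB.instance Definition _ := GRing.isZmodule.Build (cf_space asymA)
  (cf_addA asymA) (@cf_addC R A asymA) (cf_add0 asymA) (cf_addN asymA).
HB.instance Definition _ := GRing.Zmodule_isLmodule.Build R[i]
  (cf_space asymA) (cf_scaleA asymA) (@cf_scale1 R A) (cf_scaleDr asymA)
  (cf_scaleDl asymA).

End cf_space_lmodule.

Section complex_pairing.
Context (R : realType) (n : nat) (Om : set 'rV[R]_n).
Hypothesis openOm : open Om.
Local Notation T := 'rV[R]_n.
Local Notation mu := (lebesgue_rV R n).
Context (c : R).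

Let mOm : measurable Om. Proof. exact: open_measurable_rV. Qed.

(** The integral of h is c times that of k.  With c = (-1)^|a| the identity that
    defines a weak derivative has this form, and so has each summand of its
    real coordinates; the stability properties below reassemble them. *)
Definition int_prop (h k : T -> R) : Prop :=
  [/\ mu.-integrable Om (EFin \o h), mu.-integrable Om (EFin \o k) &
      \int[mu]_(x in Om) h x = c * \int[mu]_(x in Om) k x].

Lemma int_propD h k h' k' : int_prop h k -> int_prop h' k' ->
  int_prop (fun x => h x + h' x) (fun x => k x + k' x).
Proof.
move=> [ih ik hk] [ih' ik' hk']; split;
  [exact: integrableD ih ih'|exact: integrableD ik ik'|].
by rewrite !RintegralD// hk hk' mulrDr.
Qed.

Lemma int_propB h k h' k' : int_prop h k -> int_prop h' k' ->
  int_prop (fun x => h x - h' x) (fun x => k x - k' x).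
Proof.
move=> [ih ik hk] [ih' ik' hk']; split;
  [exact: integrableB ih ih'|exact: integrableB ik ik'|].
by rewrite !RintegralB// hk hk' mulrBr.
Qed.

Lemma int_propZ (r : R) h k : int_prop h k ->
  int_prop (fun x => r * h x) (fun x => r * k x).
Proof.
move=> [ih ik hk]; split;
  [exact: integrableZl ih|exact: integrableZl ik|].
by rewrite !RintegralZl// hk mulrCA.
Qed.

Definition cint_prop (h k : T -> R[i]) : Prop :=
  forall b, int_prop (fun x => ccoord b (h x)) (fun x => ccoord b (k x)).

Lemma cint_propD h k h' k' : cint_prop h k -> cint_prop h' k' ->
  cint_prop (fun x => h x + h' x) (fun x => k x + k' x).
Proof.
move=> hk hk' b; have cE y z : ccoord b (y + z) = ccoord b y + ccoord b z.
  by case: y z b => [? ?] [? ?] [].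
under eq_fun do rewrite cE.
under [X in int_prop _ X]eq_fun do rewrite cE.
exact: int_propD.
Qed.

Lemma cint_propB h k h' k' : cint_prop h k -> cint_prop h' k' ->
  cint_prop (fun x => h x - h' x) (fun x => k x - k' x).
Proof.
move=> hk hk' b; have cE y z : ccoord b (y - z) = ccoord b y - ccoord b z.
  by case: y z b => [? ?] [? ?] [].
under eq_fun do rewrite cE.
under [X in int_prop _ X]eq_fun do rewrite cE.
exact: int_propB.
Qed.

Lemma cint_propZ (r : R[i]) h k : cint_prop h k ->
  cint_prop (fun x => r * h x) (fun x => r * k x).
Proof.
move=> hk b; have cE z : ccoord b (r * z) = ccoord false r * ccoord b z +
    (if b then ccoord true r else - ccoord true r) * ccoord (~~ b) z.
  by case: z b r => [? ?] [] [? ?] /=; rewrite ?mulNr// addrC.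
under eq_fun do rewrite cE.
under [X in int_prop _ X]eq_fun do rewrite cE.
by apply: int_propD; apply: int_propZ; exact: hk.
Qed.

Lemma cint_prop_mul (u z u' z' : T -> R[i]) :
  (forall b b', int_prop (fun x => ccoord b (u x) * ccoord b' (z x))
                      (fun x => ccoord b (u' x) * ccoord b' (z' x))) ->
  cint_prop (fun x => u x * z x) (fun x => u' x * z' x).
Proof.
move=> H b; have [->|->] : b = true \/ b = false by case: b; [left|right].
  have cE y w : ccoord true (y * w) = ccoord false y * ccoord true w +
      ccoord true y * ccoord false w by case: y w => [? ?] [? ?].
  under eq_fun do rewrite cE.
  under [X in int_prop _ X]eq_fun do rewrite cE.
  exact: int_propD.
have cE y w : ccoord false (y * w) = ccoord false y * ccoord false w -
    ccoord true y * ccoord true w by case: y w => [? ?] [? ?].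
under eq_fun do rewrite cE.
under [X in int_prop _ X]eq_fun do rewrite cE.
exact: int_propB.
Qed.

Lemma cint_prop_cintegral h k : cint_prop h k ->
  cintegral Om h = c%:C%C * cintegral Om k.
Proof.
move=> hk; have [_ _ h0] := hk false; have [_ _ h1] := hk true.
rewrite /cintegral h0 h1; apply/eqP; rewrite eq_complex /=.
by rewrite !mul0r subr0 addr0 !eqxx.
Qed.

End complex_pairing.

Section cf_weak_derivative.
Context (R : realType) (A : fuzzy_number R).
Hypothesis asymA : asymmetric A.
Context (n : nat) (Om : set 'rV[R]_n).
Hypothesis openOm : open Om.
Local Notation T := 'rV[R]_n.
Local Notation mu := (lebesgue_rV R n).
Implicit Types (F G Phi : T -> CF A).

Lemma cf_measurableP (D : set T) F : cf_measurable D F <->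
  forall j, measurable_fun D (fun x => cfc j (F x)).
Proof.
split=> [[[m1 m2] [m3 m4]] [[] []]//|mF].
split; split; [exact: (mF (false, false))|exact: (mF (true, false))|
  exact: (mF (false, true))|exact: (mF (true, true))].
Qed.

Lemma L1locP F : L1loc Om F <-> forall j, locint Om (fun x => cfc j (F x)).
Proof.
split=> [lF j K cK KOm|lF K cK KOm].
  by have [[i1 i2] [i3 i4]] := lF K cK KOm; case: j => -[] [].
split; split; [exact: (lF (false, false))|exact: (lF (true, false))|
  exact: (lF (false, true))|exact: (lF (true, true))].
Qed.

Lemma test_function_real_test Phi j : test_function Om Phi ->
  real_test Om (fun x => cfc j (Phi x)).
Proof.
move=> [[[s1 s2] [s3 s4]] cS SOm]; split; first by case: j => -[] [].
exists (closure [set x | Phi x <> cf_zero A]); split => // x Sx.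
rewrite (_ : Phi x = cf_zero A) ?cfc0//; apply: contrapT => Px; apply: Sx.
exact: subset_closure.
Qed.

Lemma smooth0 : smooth (fun _ : T => 0 : R).
Proof. by apply: flat_poly_smooth; exact: FlatCst. Qed.

(** Testing against phi + 0 A isolates the coordinates, since multiplication by a
    real scalar acts on each of them. *)
Lemma real_test_test_function phi : real_test Om phi ->
  test_function Om (fun x => psi A (phi x)%:C%C 0).
Proof.
move=> [sphi [K [cK KOm phi0]]].
have SK : closure [set x | psi A (phi x)%:C%C 0 <> cf_zero A] `<=` K.
  rewrite closureE => x; apply; split; first exact: compact_closed_rV.
  move=> y /= Py; apply: contrapT => /phi0 y0; apply: Py.
  by rewrite y0.
split.
- by do 2!split; rewrite ?ucoord_psi ?vcoord_psi//;
    under eq_fun do rewrite ?ucoord_psi ?vcoord_psi//=; try exact: smooth0.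
- by apply: subclosed_compact SK => //; exact: closed_closure.
- by apply: subset_trans SK _.
Qed.

Lemma iter_partial_cst0 (s : seq 'I_n) :
  iter_partial s (fun _ : T => 0 : R) = fun=> 0.
Proof.
elim: s => //= i s ->; apply/funext => x.
by rewrite /partial derive_cst.
Qed.

Lemma cfc_integral j F (D : set T) :
  cfc j (cf_integral D F) = \int[mu]_(x in D) cfc j (F x).
Proof.
by case: j => -[] []; rewrite /cfc/= ?ucoord_psi ?vcoord_psi.
Qed.

(** From left to right, the test functions phi + 0 A with phi real suffice.
    From right to left, the cross product is bilinear in (u, v) with constant
    complex coefficients, so the identity for a general test function is a
    linear combination of identities for its real coordinates. *)
Lemma weak_derivativeP (a : 'I_n -> nat) F G : weak_derivative Om a F G <->
  [/\ forall j, locint Om (fun x => cfc j (F x)),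
      forall j, locint Om (fun x => cfc j (G x)) &
      forall j, real_weakD Om a (fun x => cfc j (F x)) (fun x => cfc j (G x))].
Proof.
have signE (N : nat) : ((-1) ^+ N : R[i]) = ((-1) ^+ N)%:C%C.
  by rewrite rmorphXn /= rmorphN1.
split=> [[/L1locP lF /L1locP lG FG]|[lF lG FG]]; split.
- exact: lF.
- exact: lG.
- move=> j phi tphi.
  have DE x : cf_mderive a (fun x => psi A (phi x)%:C%C 0) x =
      psi A (mderive a phi x)%:C%C 0.
    rewrite /cf_mderive.
    rewrite (_ : (fun y => ucoord _) = fun y => (phi y)%:C%C); last first.
      by apply/funext => y; rewrite ucoord_psi.
    rewrite (_ : (fun y => vcoord _) = fun=> 0); last first.
      by apply/funext => y; rewrite vcoord_psi.
    by rewrite /cmderive /mderive /= iter_partial_cst0.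
  have mulE y (r : R) : cfc j (cf_mul y (psi A r%:C%C 0)) = cfc j y * r.
    rewrite mulrC -cfcZr// /cf_mul /cf_scale ucoord_psi// vcoord_psi//.
    by rewrite !mulr0 subr0 !addr0 add0r [_ * r%:C%C]mulrC.
  have := congr1 (cfc j) (FG _ (real_test_test_function tphi)).
  rewrite signE.
  rewrite [LHS]cfc_integral.
  rewrite [RHS](cfcZr asymA).
  rewrite [X in _ = _ * X]cfc_integral.
  move=> H; transitivity (\int[mu]_(x in Om) cfc j
      (cf_mul (F x) (cf_mderive a (fun x => psi A (phi x)%:C%C 0) x))).
    by apply: eq_Rintegral => x _; rewrite DE; apply/esym; exact: mulE.
  apply: (etrans H); congr (_ * _).
  by apply: eq_Rintegral => x _; exact: mulE.
- exact/L1locP.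
- exact/L1locP.
move=> Phi tPhi.
pose z x := ucoord (Phi x); pose w x := vcoord (Phi x).
have tj j := test_function_real_test j tPhi.
have base (u u' : T -> R[i]) i j :
    (forall b, locint Om (fun x => ccoord b (u x))) ->
    (forall b, locint Om (fun x => ccoord b (u' x))) ->
    (forall b, real_weakD Om a (fun x => ccoord b (u x)) (fun x => ccoord b (u' x))) ->
  int_prop Om ((-1) ^+ mlen a)
    (fun x => ccoord i (u x) * mderive a (fun x => cfc j (Phi x)) x)
    (fun x => ccoord i (u' x) * cfc j (Phi x)).
  move=> lu lu' uu'; split.
  - by apply: locint_test_integrable => //; exact: real_test_mderive.
  - exact: locint_test_integrable.
  - exact: uu'.
have cuz (u u' : T -> R[i]) k :
    (forall b, locint Om (fun x => ccoord b (u x))) ->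
    (forall b, locint Om (fun x => ccoord b (u' x))) ->
    (forall b, real_weakD Om a (fun x => ccoord b (u x)) (fun x => ccoord b (u' x))) ->
  cint_prop Om ((-1) ^+ mlen a)
    (fun x => u x * cmderive a (fun x => if k then w x else z x) x)
    (fun x => u' x * (if k then w x else z x)).
  move=> lu lu' uu'; apply: (cint_prop_mul openOm) => b b'.
  have := base u u' b (b', k) lu lu' uu'.
  by case: b'; case: k.
have luF b := lF (b, false); have lvF b := lF (b, true).
have luG b := lG (b, false); have lvG b := lG (b, true).
have wu b := FG (b, false); have wv b := FG (b, true).
rewrite /cf_integral /cf_scale signE ucoord_psi// vcoord_psi//.
pose m := real_complex R (core_mid A).
have E F1 P1 (z1 w1 : T -> R[i]) : (forall x, ucoord (P1 x) = z1 x) ->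
    (forall x, vcoord (P1 x) = w1 x) ->
    (fun x => ucoord (cf_mul (F1 x) (P1 x))) =
    (fun x => ucoord (F1 x) * z1 x - m ^+ 2 * (vcoord (F1 x) * w1 x)).
  by move=> zE wE; apply/funext => x; rewrite ucoord_psi// zE wE.
have E' F1 P1 (z1 w1 : T -> R[i]) : (forall x, ucoord (P1 x) = z1 x) ->
    (forall x, vcoord (P1 x) = w1 x) ->
    (fun x => vcoord (cf_mul (F1 x) (P1 x))) =
    (fun x => ucoord (F1 x) * w1 x + vcoord (F1 x) * z1 x +
      2 * m * (vcoord (F1 x) * w1 x)).
  move=> zE wE; apply/funext => x.
  by rewrite vcoord_psi// zE wE [z1 x * _]mulrC.
have Dz x : ucoord (cf_mderive a Phi x) = cmderive a z x.
  by rewrite ucoord_psi.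
have Dw x : vcoord (cf_mderive a Phi x) = cmderive a w x.
  by rewrite vcoord_psi.
congr psi.
  rewrite [X in cintegral _ X = _](E F _ _ _ Dz Dw).
  rewrite [X in _ = _ * cintegral _ X](E G Phi z w)//.
  apply: cint_prop_cintegral.
  apply: (cint_propB openOm); first exact: (cuz _ _ false luF luG wu).
  by apply: (cint_propZ openOm); exact: (cuz _ _ true lvF lvG wv).
rewrite [X in cintegral _ X = _](E' F _ _ _ Dz Dw).
rewrite [X in _ = _ * cintegral _ X](E' G Phi z w)//.
apply: cint_prop_cintegral.
apply: (cint_propD openOm); first apply: (cint_propD openOm).
- exact: (cuz _ _ true luF luG wu).
- exact: (cuz _ _ false lvF lvG wv).
by apply: (cint_propZ openOm); exact: (cuz _ _ true lvF lvG wv).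
Qed.

End cf_weak_derivative.

(** * The pointwise norm of u + vA *)

Section power_sums.
Context (R : realType) (p : R) (p1 : 1 <= p).

Let p0 : 0 < p. Proof. exact: lt_le_trans ltr01 p1. Qed.

Lemma powR_sum_le (I : finType) (s : I -> R) : (forall i, 0 <= s i) ->
  (\sum_i s i) `^ p <= #|I|%:R `^ p * \sum_i s i `^ p.
Proof.
move=> s0; have [i0 _|I0] := pickP (xpredT : pred I); last first.
  by rewrite !big_pred0// powR0 ?gt_eqF// mulr0.
have [k _ sk] := @arg_maxP _ R I i0 xpredT s erefl.
apply: (@le_trans _ _ ((#|I|%:R * s k) `^ p)).
  apply: ge0_ler_powR; rewrite ?nnegrE ?(ltW p0) ?sumr_ge0 ?mulr_ge0//.
  by rewrite mulr_natl -sumr_const; apply: ler_sum => i _; exact: sk.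
rewrite powRM// ler_wpM2l ?powR_ge0// (bigD1 k)//= lerDl.
by apply: sumr_ge0 => i _; exact: powR_ge0.
Qed.

Lemma powRD_le (a b : R) : 0 <= a -> 0 <= b ->
  (a + b) `^ p <= 2 `^ p * (a `^ p + b `^ p).
Proof.
move=> a0 b0; have := @powR_sum_le _ (fun c : bool => if c then a else b).
by rewrite card_bool !big_bool; apply => -[].
Qed.

(** Convexity of the pth power at the points a/s and b/t with weights s/(s+t) and
    t/(s+t).  When a^p, b^p stand for energies at most s^p, t^p, integration
    gives (s+t)^p: this is Minkowski's inequality. *)
Lemma powRD_convex (a b s t : R) : 0 <= a -> 0 <= b -> 0 < s -> 0 < t ->
  (a + b) `^ p <= (s + t) `^ p *
    (s / (s + t) * (a `^ p / s `^ p) + t / (s + t) * (b `^ p / t `^ p)).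
Proof.
move=> a0 b0 s0 t0; have st0 : 0 < s + t by exact: addr_gt0.
have l0 : 0 <= s / (s + t) by rewrite divr_ge0 ?ltW.
have l1 : s / (s + t) <= 1 by rewrite ler_pdivrMr// mul1r lerDl ltW.
have tE : 1 - s / (s + t) = t / (s + t).
  by field; rewrite gt_eqF.
have as0 : 0 <= a / s by rewrite divr_ge0// ltW.
have bt0 : 0 <= b / t by rewrite divr_ge0// ltW.
have mem_nneg (c : R) : 0 <= c -> c \in (`[0, +oo[%classic : set R).
  by move=> c0; rewrite inE /= in_itv/= c0.
have H : (s / (s + t) * (a / s) + (1 - s / (s + t)) * (b / t)) `^ p <=
    s / (s + t) * (a / s) `^ p + (1 - s / (s + t)) * (b / t) `^ p.
  exact: (convex_powR p1 (Itv01 l0 l1) (mem_nneg _ as0) (mem_nneg _ bt0)).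
rewrite tE in H.
have -> : a + b = (s + t) * (s / (s + t) * (a / s) + t / (s + t) * (b / t)).
  by field; rewrite !gt_eqF.
rewrite powRM ?(ltW st0)//; last first.
  by rewrite addr_ge0// mulr_ge0// divr_ge0 ?ltW.
rewrite ler_wpM2l ?powR_ge0// (le_trans H)//.
have VX (c : R) : 0 < c -> c^-1 `^ p = (c `^ p)^-1.
  by move=> c0; rewrite -powR_inv1 ?ltW// -powRrM mulN1r powRN.
by rewrite !powRM ?invr_ge0 ?(ltW s0) ?(ltW t0)// !VX.
Qed.

End power_sums.

Section cf_modulus.
Context (R : realType) (A : fuzzy_number R).
Hypothesis asymA : asymmetric A.
Context (p : R) (p1 : 1 <= p).
Implicit Types (x y : CF A).
Local Notation nc := (@Normc.normc R).
Local Notation m := (real_complex R (core_mid A)).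

Let p0 : 0 < p. Proof. exact: lt_le_trans ltr01 p1. Qed.

(** The pth power of [cf_norm]; it is p-homogeneous and convex in (u, v). *)
Definition cf_mod x : R :=
  nc (ucoord x + m * vcoord x) `^ p + nc (vcoord x) `^ p.

Lemma normc_ge0 z : 0 <= nc z.
Proof. by case: z => a b; exact: sqrtr_ge0. Qed.
Hint Resolve normc_ge0 : core.

Lemma cf_mod_ge0 x : 0 <= cf_mod x.
Proof. by rewrite addr_ge0// powR_ge0. Qed.

Lemma cf_normX x : cf_norm p x `^ p = cf_mod x.
Proof.
by rewrite /cf_norm -powRrM mulVf ?gt_eqF// powRr1// cf_mod_ge0.
Qed.

Lemma cf_mod_eq0 x : cf_mod x = 0 -> x = cf_zero A.
Proof.
move=> /eqP; rewrite paddr_eq0 ?powR_ge0// !powR_eq0 (gt_eqF p0) !andbT.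
move=> /andP[/eqP/Normc.eq0_normc + /eqP/Normc.eq0_normc v0].
by rewrite v0 mulr0 addr0 => u0; rewrite -(psi_coord x) u0 v0.
Qed.

Lemma cf_mod0 : cf_mod (cf_zero A) = 0.
Proof.
rewrite /cf_mod ucoord_psi// vcoord_psi// mulr0 addr0 Normc.normc0.
by rewrite powR0 ?gt_eqF// addr0.
Qed.

Lemma cf_modZ c x : cf_mod (cf_scale c x) = nc c `^ p * cf_mod x.
Proof.
rewrite /cf_mod ucoord_psi// vcoord_psi// mulrCA -mulrDr !Normc.normcM.
by rewrite !powRM// mulrDr.
Qed.

Lemma cf_modD x y s t : 0 < s -> 0 < t -> cf_mod (cf_add x y) <=
  (s + t) `^ p * (s / (s + t) * (cf_mod x / s `^ p) +
                  t / (s + t) * (cf_mod y / t `^ p)).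
Proof.
move=> s0 t0; rewrite /cf_mod ucoord_psi// vcoord_psi//.
have D z w : nc (z + w) `^ p <= (s + t) `^ p *
    (s / (s + t) * (nc z `^ p / s `^ p) + t / (s + t) * (nc w `^ p / t `^ p)).
  apply: le_trans (powRD_convex p1 (normc_ge0 z) (normc_ge0 w) s0 t0).
  apply: ge0_ler_powR; rewrite ?nnegrE ?(ltW p0) ?addr_ge0//.
  exact: le_normcD.
rewrite mulrDr addrACA (le_trans (lerD (D _ _) (D _ _)))//.
have E (P a b a' b' S U c d : R) :
    P * (c * (a / S) + d * (b / U)) + P * (c * (a' / S) + d * (b' / U)) =
    P * (c * ((a + a') / S) + d * ((b + b') / U)) by ring.
by rewrite E.
Qed.

Lemma normc_ccoord b (z : R[i]) : `|ccoord b z| <= nc z.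
Proof.
case: z => u v /=; rewrite -sqrtr_sqr ler_wsqrtr//.
by case: b => /=; [rewrite lerDr sqr_ge0|rewrite lerDl sqr_ge0].
Qed.

Lemma normc_le_ccoord (z : R[i]) :
  nc z <= `|ccoord false z| + `|ccoord true z|.
Proof.
case: z => u v; have uv : 0 <= `|u| + `|v| by rewrite addr_ge0.
rewrite /= -(ger0_norm uv) -sqrtr_sqr ler_wsqrtr//.
rewrite sqrrD !real_normK ?num_real// addrAC lerDl.
by rewrite mulrn_wge0// mulr_ge0.
Qed.

Lemma normc_real (r : R) : nc r%:C%C = `|r|.
Proof. by rewrite /= expr0n/= addr0 sqrtr_sqr. Qed.

(** The map from (u, v) to (u + m v, v) and its inverse have norm at most 1 + |m|,
    and each side is a sum of at most four terms. *)
Definition cf_mod_cst : R := (1 + `|core_mid A|) `^ p * 4 `^ p.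

Lemma cf_mod_cst_gt0 : 0 < cf_mod_cst.
Proof. by rewrite mulr_gt0// powR_gt0// ltr_pwDl. Qed.

Lemma cfc_le_cf_mod j x : `|cfc j x| `^ p <= cf_mod_cst * cf_mod x.
Proof.
set u := ucoord x; set v := vcoord x; set M := 1 + `|core_mid A|.
have M0 : 0 <= M by rewrite addr_ge0.
have M1 : 1 <= M by rewrite lerDl.
have ule : nc u <= nc (u + m * v) + `|core_mid A| * nc v.
  rewrite -normc_real -Normc.normcM -(normcN (m * v)).
  by rewrite (le_trans _ (le_normcD _ _))// addrK.
have cle : `|cfc j x| <= M * (nc (u + m * v) + nc v).
  rewrite /cfc (le_trans (normc_ccoord _ _))//; case: j.2; rewrite -/u -/v.
    rewrite mulrDr -[leLHS]add0r lerD ?mulr_ge0//.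
    by rewrite ler_peMl.
  rewrite (le_trans ule)// mulrDr lerD//; first by rewrite ler_peMl.
  by rewrite ler_wpM2r// lerDr.
apply: (@le_trans _ _ ((M * (nc (u + m * v) + nc v)) `^ p)).
  by apply: ge0_ler_powR; rewrite ?nnegrE ?(ltW p0) ?mulr_ge0 ?addr_ge0.
rewrite powRM ?addr_ge0// /cf_mod_cst -mulrA ler_wpM2l ?powR_ge0//.
rewrite (le_trans (powRD_le p1 _ _))// ler_wpM2r ?cf_mod_ge0//.
by apply: ge0_ler_powR; rewrite ?nnegrE ?(ltW p0)// ler_nat.
Qed.

Lemma cf_mod_le_cfc x :
  cf_mod x <= 2 * cf_mod_cst * \sum_j `|cfc j x| `^ p.
Proof.
set u := ucoord x; set v := vcoord x; set M := 1 + `|core_mid A|.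
set S := \sum_j `|cfc j x|.
have S0 : 0 <= S by apply: sumr_ge0.
have M0 : 0 <= M by rewrite addr_ge0.
have M1 : 1 <= M by rewrite lerDl.
have uvS : nc u + nc v <= S.
  rewrite /S -(pair_bigA _ (fun a b => `|cfc (a, b) x|)) /= !big_bool /=.
  rewrite /cfc /= -/u -/v.
  have := normc_le_ccoord u; have := normc_le_ccoord v; rewrite /ccoord; lra.
have SX : S `^ p <= 4 `^ p * \sum_j `|cfc j x| `^ p.
  have := powR_sum_le p1 (fun j : bool * bool => normr_ge0 (cfc j x)).
  by rewrite card_prod card_bool.
have le1 w : 0 <= w -> w <= M * S -> w `^ p <=
    cf_mod_cst * \sum_j `|cfc j x| `^ p.
  move=> w0 wMS; apply: (@le_trans _ _ ((M * S) `^ p)).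
    by apply: ge0_ler_powR; rewrite ?nnegrE ?(ltW p0) ?mulr_ge0.
  by rewrite powRM// /cf_mod_cst -mulrA ler_wpM2l ?powR_ge0.
rewrite -mulrA mulr_natl mulr2n /cf_mod lerD// le1//.
  rewrite (le_trans (le_normcD _ _))// Normc.normcM normc_real -/u -/v.
  apply: (@le_trans _ _ (M * (nc u + nc v))); last by rewrite ler_wpM2l.
  rewrite mulrDr lerD//; first by rewrite ler_peMl.
  by rewrite ler_wpM2r// lerDr.
rewrite (@le_trans _ _ S)//; last by rewrite ler_peMl.
by rewrite (le_trans _ uvS)// lerDr.
Qed.

End cf_modulus.

(** * The L^p norm of functions with values u + vA *)

(** Separates real upper bounds from the infinite values and the vanishing
    norms, for which the convexity argument does not apply directly. *)
Lemma lee_add_bounds (R : realType) (x y z : \bar R) : (0 <= x)%E -> (0 <= y)%E ->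
  (forall s t : R, 0 < s -> 0 < t -> (x <= s%:E)%E -> (y <= t%:E)%E ->
    (z <= (s + t)%:E)%E) ->
  (z <= x + y)%E.
Proof.
move=> x0 y0 H; case: x y x0 y0 H => [x| |] [y| |] //= x0 y0 H;
  rewrite ?addye ?addey ?leey//.
apply/lee_addgt0Pr => e e0; have e2 : 0 < e / 2 by rewrite divr_gt0.
have := H (x + e / 2) (y + e / 2); rewrite !lee_fin !lerDl (ltW e2).
rewrite -!EFinD addrACA -splitr; apply => //.
  by rewrite ltr_wpDl.
by rewrite ltr_wpDl.
Qed.

Lemma integral_le_comb d (T : measurableType d) (R : realType)
    (mu : {measure set T -> \bar R}) (D : set T) (f g h : T -> R)
    (b c s t : R) : measurable D -> measurable_fun D f -> measurable_fun D g ->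
  measurable_fun D h -> (forall x, D x -> 0 <= f x) ->
  (forall x, D x -> 0 <= g x) -> (forall x, D x -> 0 <= h x) ->
  0 <= b -> 0 <= c -> (forall x, D x -> h x <= b * f x + c * g x) ->
  (\int[mu]_(x in D) (f x)%:E <= s%:E)%E ->
  (\int[mu]_(x in D) (g x)%:E <= t%:E)%E ->
  (\int[mu]_(x in D) (h x)%:E <= (b * s + c * t)%:E)%E.
Proof.
move=> mD mf mg mh f0 g0 h0 b0 c0 hfg fs gt.
have Ef x : D x -> (0 <= (f x)%:E)%E by rewrite lee_fin; exact: f0.
have Eg x : D x -> (0 <= (g x)%:E)%E by rewrite lee_fin; exact: g0.
have mf' : measurable_fun D (EFin \o f) by exact/measurable_EFinP.
have mg' : measurable_fun D (EFin \o g) by exact/measurable_EFinP.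
apply: (@le_trans _ _ (\int[mu]_(x in D)
    (b%:E * (f x)%:E + c%:E * (g x)%:E))%E).
  apply: ge0_le_integral => //.
  - exact/measurable_EFinP.
  - by apply: emeasurable_funD; exact: measurable_funeM.
have Ef' x : D x -> (0 <= b%:E * (f x)%:E)%E by move=> Dx; rewrite mule_ge0// Ef.
have Eg' x : D x -> (0 <= c%:E * (g x)%:E)%E by move=> Dx; rewrite mule_ge0// Eg.
rewrite ge0_integralD//; try exact: measurable_funeM.
rewrite !ge0_integralZl// EFinD !EFinM.
by apply: leeD; apply: lee_wpmul2l.
Qed.

Section cf_Lp_norm.
Local Opaque cf_mod cf_add cf_scale psi.
Context (R : realType) (A : fuzzy_number R).
Hypothesis asymA : asymmetric A.
Context (n : nat) (Om : set 'rV[R]_n).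
Hypothesis openOm : open Om.
Context (p : R) (p1 : 1 <= p).
Local Notation T := 'rV[R]_n.
Local Notation mu := (lebesgue_rV R n).
Local Notation nrm := (Lp_norm Om p).
Implicit Types (F G : T -> CF A).

Let p0 : 0 < p. Proof. exact: lt_le_trans ltr01 p1. Qed.
Let mOm : measurable Om. Proof. exact: open_measurable_rV. Qed.

(** The pth power of the L^p norm. *)
Definition cf_energy F : \bar R := (\int[mu]_(x in Om) (cf_mod p (F x))%:E)%E.

Lemma measurable_normc (u : T -> R[i]) : cmeasurable Om u ->
  measurable_fun Om (fun x => Normc.normc (u x)).
Proof.
move=> [mr mi]; rewrite (_ : (fun x => _) = (fun x =>
    (complex.Re (u x) ^+ 2 + complex.Im (u x) ^+ 2) `^ 2^-1)).
  apply: (measurableT_comp (measurable_powR _)).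
  by apply: measurable_funD; exact: measurable_funX.
apply/funext => x; rewrite powR12_sqrt ?addr_ge0 ?sqr_ge0//.
by case: (u x).
Qed.

Lemma measurable_cf_mod F : cf_measurable Om F ->
  measurable_fun Om (fun x => cf_mod p (F x)).
Proof.
move=> [[m1 m2] [m3 m4]]; apply: measurable_funD;
  apply: (measurableT_comp (measurable_powR p)); apply: measurable_normc => //.
pose m := core_mid A.
split.
  rewrite (_ : (fun x => _) = (fun x => complex.Re (ucoord (F x)) +
      m * complex.Re (vcoord (F x)))).
    by apply: measurable_funD => //; apply: measurable_funM.
  apply/funext => x; case: (ucoord (F x)) (vcoord (F x)) => a b [c d] /=.
  by rewrite mul0r subr0.
rewrite (_ : (fun x => _) = (fun x => complex.Im (ucoord (F x)) +
    m * complex.Im (vcoord (F x)))).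
  by apply: measurable_funD => //; apply: measurable_funM.
apply/funext => x; case: (ucoord (F x)) (vcoord (F x)) => a b [c d] /=.
by rewrite mul0r addr0.
Qed.

Lemma measurable_energy_density F : cf_measurable Om F ->
  measurable_fun Om (fun x => (cf_mod p (F x))%:E).
Proof.
by move=> mF; apply: measurableT_comp => //; exact: measurable_cf_mod.
Qed.

Lemma cf_measurable_add F G : cf_measurable Om F -> cf_measurable Om G ->
  cf_measurable Om (fun_add F G).
Proof.
move=> /cf_measurableP mF /cf_measurableP mG; apply/cf_measurableP => j.
rewrite (_ : (fun x => _) = (fun x => cfc j (F x) + cfc j (G x))).
  exact: measurable_funD.
by apply/funext => x; exact: cfcD.
Qed.

Lemma cf_energy_ge0 F : (0 <= cf_energy F)%E.
Proof. by apply: integral_ge0 => x _; rewrite lee_fin cf_mod_ge0. Qed.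

Lemma Lp_normE F : nrm F = (cf_energy F `^ p^-1)%E.
Proof.
by rewrite /Lp_norm; congr (_ `^ _)%E; apply: eq_integral => x _; rewrite cf_normX.
Qed.

Lemma Lp_norm_ge0 F : (0 <= nrm F)%E.
Proof. exact: poweR_ge0. Qed.

Lemma cf_energyE F : cf_energy F = (nrm F `^ p)%E.
Proof.
by rewrite Lp_normE -poweRrM mulVf ?gt_eqF// poweRe1// cf_energy_ge0.
Qed.

Lemma Lp_norm_leP F (s : R) : 0 <= s ->
  (nrm F <= s%:E)%E <-> (cf_energy F <= (s `^ p)%:E)%E.
Proof.
move=> s0; have mono (r : R) (x y : \bar R) : (0 < r)%R -> (0 <= x)%E ->
    (x <= y)%E -> (x `^ r <= y `^ r)%E.
  move=> r0 x0 xy; apply: gt0_ler_poweR; rewrite ?(ltW r0)// in_itv/= leey andbT//.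
  exact: le_trans xy.
split=> H.
  by rewrite cf_energyE -poweR_EFin mono// Lp_norm_ge0.
rewrite Lp_normE (le_trans (mono _ _ _ _ _ H)) ?invr_gt0 ?cf_energy_ge0//.
by rewrite poweR_EFin -powRrM divff ?gt_eqF// powRr1.
Qed.

(** [cf_modD] integrated: the two energies are at most s^p and t^p, and the weights
    add up to one. *)
Lemma Lp_normD_le F G (s t : R) : cf_measurable Om F -> cf_measurable Om G ->
  0 < s -> 0 < t -> (nrm F <= s%:E)%E -> (nrm G <= t%:E)%E ->
  (nrm (fun_add F G) <= (s + t)%:E)%E.
Proof.
move=> mF mG s0 t0 /(Lp_norm_leP _ (ltW s0)) sP /(Lp_norm_leP _ (ltW t0)) tP.
have st0 : 0 < s + t by exact: addr_gt0.
apply/(Lp_norm_leP _ (ltW st0)).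
pose cF := (s + t) `^ p * (s / (s + t) / s `^ p).
pose cG := (s + t) `^ p * (t / (s + t) / t `^ p).
have cF0 : 0 <= cF by rewrite mulr_ge0 ?powR_ge0// !divr_ge0 ?powR_ge0 ?ltW.
have cG0 : 0 <= cG by rewrite mulr_ge0 ?powR_ge0// !divr_ge0 ?powR_ge0 ?ltW.
have cFG : cF * s `^ p + cG * t `^ p = (s + t) `^ p.
  have sp0 : s `^ p != 0 by rewrite gt_eqF// powR_gt0.
  have tp0 : t `^ p != 0 by rewrite gt_eqF// powR_gt0.
  rewrite /cF /cG -!mulrA mulVf// mulVf// !mulr1 -mulrDr -mulrDl.
  by rewrite divff ?gt_eqF// mulr1.
have cFGD x : cf_mod p (fun_add F G x) <=
    cF * cf_mod p (F x) + cG * cf_mod p (G x).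
  apply: (le_trans (cf_modD asymA p1 (F x) (G x) s0 t0)).
  have E (P a b S U c d : R) : P * (c * (a / S) + d * (b / U)) =
    P * (c / S) * a + P * (d / U) * b by ring.
  by rewrite E.
clearbody cF cG; rewrite -cFG.
have nn (H : T -> CF A) x : Om x -> 0 <= cf_mod p (H x) by move=> _; exact: cf_mod_ge0.
exact: (integral_le_comb mOm (measurable_cf_mod mF) (measurable_cf_mod mG)
  (measurable_cf_mod (cf_measurable_add mF mG)) (@nn F) (@nn G)
  (@nn (fun_add F G)) cF0 cG0 (fun x _ => cFGD x) sP tP).
Qed.

Lemma Lp_normD F G : cf_measurable Om F -> cf_measurable Om G ->
  (nrm (fun_add F G) <= nrm F + nrm G)%E.
Proof.
move=> mF mG; apply: lee_add_bounds (Lp_norm_ge0 F) (Lp_norm_ge0 G) _ => s t.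
exact: Lp_normD_le.
Qed.

Lemma Lp_normZ c F : cf_measurable Om F ->
  nrm (fun_scale c F) = ((Normc.normc c)%:E * nrm F)%E.
Proof.
move=> mF; have nc0 := normc_ge0 c.
have E : cf_energy (fun_scale c F) =
    ((Normc.normc c `^ p)%:E * cf_energy F)%E.
  rewrite /cf_energy -ge0_integralZl//.
  - by apply: eq_integral => x _; rewrite cf_modZ// EFinM.
  - exact: measurable_energy_density.
  - by move=> x _; rewrite lee_fin cf_mod_ge0.
  - by rewrite lee_fin powR_ge0.
rewrite !Lp_normE E poweRM ?lee_fin ?powR_ge0 ?cf_energy_ge0//.
by rewrite poweR_EFin -powRrM divff ?gt_eqF// powRr1.
Qed.

Lemma Lp_norm_ae F G : cf_measurable Om F -> cf_measurable Om G ->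
  ae_eq_on Om F G -> nrm F = nrm G.
Proof.
move=> mF mG FG; suff E : cf_energy F = cf_energy G.
  by rewrite (Lp_normE F) E (Lp_normE G).
apply: ge0_ae_eq_integral; first exact: mOm.
- exact: measurable_energy_density.
- exact: measurable_energy_density.
- by move=> x _; rewrite lee_fin cf_mod_ge0.
- by move=> x _; rewrite lee_fin cf_mod_ge0.
by apply: filterS FG => x /[apply] ->.
Qed.

Lemma Lp_norm0 : nrm (fun=> cf_zero A) = 0%E.
Proof.
rewrite Lp_normE /cf_energy.
under eq_integral do rewrite cf_mod0//.
by rewrite integral0 poweR0r// invr_eq0 gt_eqF.
Qed.

Lemma Lp_norm_eq0 F : cf_measurable Om F -> nrm F = 0%E ->
  ae_eq_on Om F (fun=> cf_zero A).
Proof.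
move=> mF F0; have : cf_energy F = 0%E by rewrite cf_energyE F0 poweR0r// gt_eqF.
have mm := measurable_cf_mod mF.
rewrite /cf_energy => E0.
have : ae_eq mu Om (fun x => (cf_mod p (F x))%:E) (cst 0%E).
  apply/(ae_eq_integral_abs mu mOm); first exact: measurable_energy_density.
  rewrite -[RHS]E0; apply: eq_integral => x _.
  by rewrite gee0_abs// lee_fin cf_mod_ge0.
by apply: filterS => x /[apply] -[] /(cf_mod_eq0 p1).
Qed.

Lemma Lp_modular_cfc j F : cf_measurable Om F ->
  (Lp_modular mu Om p (fun x => cfc j (F x)) <=
   (cf_mod_cst A p)%:E * cf_energy F)%E.
Proof.
move=> mF; have C0 := ltW (cf_mod_cst_gt0 A p).
rewrite /cf_energy -ge0_integralZl//.
- apply: ge0_le_integral => //.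
  + apply/measurable_EFinP; apply: measurable_abs_powR.
    by move/cf_measurableP : mF.
  + by apply: measurable_funeM; exact: measurable_energy_density.
  + by move=> x _; rewrite -EFinM lee_fin; exact: cfc_le_cf_mod.
- exact: measurable_energy_density.
- by move=> x _; rewrite lee_fin cf_mod_ge0.
Qed.

Lemma cf_energy_le F : cf_measurable Om F ->
  (cf_energy F <= (2 * cf_mod_cst A p)%:E *
    \sum_j Lp_modular mu Om p (fun x => cfc j (F x)))%E.
Proof.
move=> mF; have C0 : 0 <= 2 * cf_mod_cst A p.
  by rewrite mulr_ge0// ltW// cf_mod_cst_gt0.
have mj j : measurable_fun Om (fun x => (`|cfc j (F x)| `^ p)%:E).
  apply/measurable_EFinP; apply: measurable_abs_powR.
  by move/cf_measurableP : mF.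
have wj j x : Om x -> (0 <= (`|cfc j (F x)| `^ p)%:E)%E.
  by move=> _; rewrite lee_fin powR_ge0.
have ms : measurable_fun Om (fun x => \sum_j (`|cfc j (F x)| `^ p)%:E)%E.
  exact: emeasurable_sum.
have ws x : Om x -> (0 <= \sum_j (`|cfc j (F x)| `^ p)%:E)%E.
  by move=> Ox; apply: sume_ge0 => j _; exact: wj.
rewrite /Lp_modular -ge0_integral_sum// -ge0_integralZl//.
apply: ge0_le_integral => //.
- by move=> x _; rewrite lee_fin cf_mod_ge0.
- exact: measurable_energy_density.
- exact: measurable_funeM.
- by move=> x _; rewrite sumEFin -EFinM lee_fin; exact: cf_mod_le_cfc.
Qed.

Lemma Lp_space_locint F : Lp_space Om p F ->
  forall j, locint Om (fun x => cfc j (F x)).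
Proof.
move=> [mF Foo] j; apply: (Lp_modular_locint openOm p1).
  by move/cf_measurableP : mF.
apply: (le_lt_trans (Lp_modular_cfc j mF)).
rewrite cf_energyE lte_mul_pinfty ?lee_fin ?(ltW (cf_mod_cst_gt0 A p))//.
exact: poweR_lty.
Qed.

End cf_Lp_norm.

(** * Completeness of L^p for functions with values u + vA *)

Section cf_Lp_complete.
Local Opaque Lp_norm cf_mod cf_add cf_scale psi.
Context (R : realType) (A : fuzzy_number R).
Hypothesis asymA : asymmetric A.
Context (n : nat) (Om : set 'rV[R]_n).
Hypothesis openOm : open Om.
Context (p : R) (p1 : 1 <= p).
Local Notation T := 'rV[R]_n.
Local Notation mu := (lebesgue_rV R n).
Local Notation nrm := (Lp_norm Om p).
Implicit Types (F G : T -> CF A).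

Let p0 : 0 < p. Proof. exact: lt_le_trans ltr01 p1. Qed.
Let mOm : measurable Om. Proof. exact: open_measurable_rV. Qed.

Definition fun_sub F G : T -> CF A := fun_add F (fun_scale (-1) G).

Lemma cfc_fun_add j F G x : cfc j (fun_add F G x) = cfc j (F x) + cfc j (G x).
Proof. exact: cfcD. Qed.

Lemma cfc_fun_sub j F G x : cfc j (fun_sub F G x) = cfc j (F x) - cfc j (G x).
Proof.
rewrite cfc_fun_add; congr (_ + _); rewrite /fun_scale.
have -> : -1 = (-1 : R)%:C%C by rewrite rmorphN1.
by rewrite cfcZr// mulN1r.
Qed.

Lemma cf_measurable_scale c F : cf_measurable Om F ->
  cf_measurable Om (fun_scale c F).
Proof.
move=> /cf_measurableP mF; apply/cf_measurableP => j.
rewrite (_ : (fun x => _) = (fun x => complex.Re c * cfc j (F x) +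
    (if j.1 then complex.Im c else - complex.Im c) * cfc (~~ j.1, j.2) (F x))).
  by apply: measurable_funD; apply: measurable_funM => //; exact: mF.
by apply/funext => x; exact: cfcZ.
Qed.

Lemma Lp_space_add F G : Lp_space Om p F -> Lp_space Om p G ->
  Lp_space Om p (fun_add F G).
Proof.
move=> [mF Foo] [mG Goo]; split; first exact: cf_measurable_add.
apply: (le_lt_trans (Lp_normD asymA openOm p1 mF mG)).
exact: (lte_add_pinfty Foo Goo).
Qed.

Lemma Lp_space_scale c F : Lp_space Om p F -> Lp_space Om p (fun_scale c F).
Proof.
move=> [mF Foo]; split; first exact: cf_measurable_scale.
rewrite (Lp_normZ asymA openOm p1 c mF) (lte_mul_pinfty _ _ Foo)//.
by rewrite lee_fin; exact: normc_ge0.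
Qed.

Lemma Lp_space_sub F G : Lp_space Om p F -> Lp_space Om p G ->
  Lp_space Om p (fun_sub F G).
Proof. by move=> LF LG; exact: Lp_space_add LF (Lp_space_scale _ LG). Qed.

Lemma Lp_modular_le_norm j F (e : R) : cf_measurable Om F -> 0 <= e ->
  (nrm F <= e%:E)%E ->
  (Lp_modular mu Om p (fun x => cfc j (F x)) <=
   (cf_mod_cst A p * e `^ p)%:E)%E.
Proof.
move=> mF e0 /(Lp_norm_leP Om p1 F e0) Fe.
apply: (le_trans (Lp_modular_cfc openOm p1 j mF)).
rewrite (EFinM (cf_mod_cst A p)); apply: lee_wpmul2l Fe.
by rewrite lee_fin; exact: ltW (cf_mod_cst_gt0 A p).
Qed.

Lemma cfc_fun_subE j F G : (fun x => cfc j (fun_sub F G x)) =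
  (fun x => cfc j (F x) - cfc j (G x)).
Proof. by apply/funext => x; exact: cfc_fun_sub. Qed.

Lemma fun_subKC F G : fun_sub F (fun_sub F G) = G.
Proof.
apply/funext => x; apply: (cfc_inj (A := A)) => j.
by rewrite cfc_fun_sub cfc_fun_sub opprB addrCA subrr addr0.
Qed.

(** A bound by this radius in L^p norm makes the modulars of all coordinates at
    most e. *)
Definition Lp_radius (e : R) : R := (e / cf_mod_cst A p) `^ p^-1.

Lemma Lp_radius_gt0 e : 0 < e -> 0 < Lp_radius e.
Proof. by move=> e0; rewrite powR_gt0// divr_gt0// cf_mod_cst_gt0. Qed.

Lemma Lp_modular_fun_sub j F G (e : R) : Lp_space Om p F -> Lp_space Om p G ->
  0 < e -> (nrm (fun_sub F G) <= (Lp_radius e)%:E)%E ->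
  (Lp_modular mu Om p (fun x => cfc j (F x) - cfc j (G x))%R <= e%:E)%E.
Proof.
move=> LF LG e0 FG; have [mS _] := Lp_space_sub LF LG.
have r0 := ltW (Lp_radius_gt0 e0).
have := Lp_modular_le_norm j mS r0 FG; rewrite cfc_fun_subE.
have C0 := cf_mod_cst_gt0 A p.
have -> : cf_mod_cst A p * Lp_radius e `^ p = e; last exact.
rewrite /Lp_radius -powRrM mulVf ?gt_eqF// powRr1; last first.
  by rewrite divr_ge0// ltW.
by rewrite mulrC divfK// gt_eqF.
Qed.

Lemma Lp_norm_modular_le F (e : R) : cf_measurable Om F -> 0 < e ->
  (forall j, (Lp_modular mu Om p (fun x => cfc j (F x)) <=
    (e `^ p / (8 * cf_mod_cst A p))%:E)%E) ->
  (nrm F <= e%:E)%E.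
Proof.
move=> mF e0 Fe; apply/(Lp_norm_leP Om p1 F (ltW e0)).
have C0 := cf_mod_cst_gt0 A p.
apply: (le_trans (cf_energy_le openOm p1 mF)).
apply: (@le_trans _ _ ((2 * cf_mod_cst A p)%:E *
   \sum_(j : bool * bool) (e `^ p / (8 * cf_mod_cst A p))%:E)%E).
  apply: lee_wpmul2l; first by rewrite lee_fin mulr_ge0// ltW.
  by apply: lee_sum => j _; exact: Fe.
rewrite sumEFin -EFinM lee_fin sumr_const card_prod card_bool.
rewrite le_eqVlt; apply/orP; left; apply/eqP.
by rewrite -mulr_natl; field; rewrite gt_eqF.
Qed.

Lemma Lp_cvg_L1loc (D : nat -> T -> CF A) G :
  (forall i, Lp_space Om p (D i)) -> Lp_space Om p G ->
  (forall e : R, 0 < e -> exists N, forall i, (N <= i)%N ->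
    (nrm (fun_sub (D i) G) <= e%:E)%E) ->
  forall j, L1loc_cvg Om (fun i x => cfc j (D i x)) (fun x => cfc j (G x)).
Proof.
move=> LD LG DG j.
have mD i : measurable_fun Om (fun x => cfc j (D i x)).
  by have [/cf_measurableP + _] := LD i; exact.
have mG : measurable_fun Om (fun x => cfc j (G x)).
  by have [/cf_measurableP + _] := LG; exact.
apply: (Lp_modular_L1loc openOm p1 mD mG) => e e0.
have [N NP] := DG _ (Lp_radius_gt0 e0); exists N => i Ni.
exact: (Lp_modular_fun_sub j (LD i) LG e0 (NP i Ni)).
Qed.

(** Each coordinate sequence is Cauchy in the real L^p space, and the coordinates
    of the limit assemble to a limit because [cf_mod] is controlled by their pth
    powers. *)
Lemma cf_Lp_complete (D : nat -> T -> CF A) :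
  (forall i, Lp_space Om p (D i)) ->
  (forall e : R, 0 < e -> exists N, forall i k, (N <= i)%N -> (N <= k)%N ->
    (nrm (fun_sub (D i) (D k)) <= e%:E)%E) ->
  exists2 G, Lp_space Om p G & forall e : R, 0 < e -> exists N, forall i,
    (N <= i)%N -> (nrm (fun_sub (D i) G) <= e%:E)%E.
Proof.
move=> LD DC; have C0 := cf_mod_cst_gt0 A p.
have mD i j : measurable_fun Om (fun x => cfc j (D i x)).
  by have [/cf_measurableP + _] := LD i; exact.
have /choice[g gP] : forall j, exists g : T -> R, measurable_fun Om g /\
    forall e : R, 0 < e -> exists N, forall i, (N <= i)%N ->
    (Lp_modular mu Om p (fun x => cfc j (D i x) - g x)%R <= e%:E)%E.
  move=> j; have fC (e : R) : 0 < e -> exists N, forall i k,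
      (N <= i)%N -> (N <= k)%N ->
      (Lp_modular mu Om p (fun x => cfc j (D i x) - cfc j (D k x))%R <= e%:E)%E.
    move=> e0; have [N NP] := DC _ (Lp_radius_gt0 e0); exists N => i k Ni Nk.
    exact: (Lp_modular_fun_sub j (LD i) (LD k) e0 (NP i k Ni Nk)).
  have [g mg gC] := Lp_modular_complete mOm p1 (fun i => mD i j) fC.
  by exists g.
pose G x := cf_of A (fun j => g j x).
have GE j x : cfc j (G x) = g j x by rewrite cfc_of.
have mG : cf_measurable Om G.
  apply/cf_measurableP => j; rewrite (_ : (fun x => _) = g j).
    by have [] := gP j.
  by apply/funext => x; rewrite GE.
have mS i : cf_measurable Om (fun_sub (D i) G).
  have [mDi _] := LD i.
  exact: cf_measurable_add mDi (cf_measurable_scale _ mG).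
have GC e : 0 < e -> exists N, forall i,
    (N <= i)%N -> (nrm (fun_sub (D i) G) <= e%:E)%E.
  move=> e0; pose e' := e `^ p / (8 * cf_mod_cst A p).
  have e'0 : 0 < e' by rewrite divr_gt0 ?powR_gt0// mulr_gt0.
  have /choice[N NP] : forall j, exists N, forall i, (N <= i)%N ->
      (Lp_modular mu Om p (fun x => cfc j (D i x) - g j x)%R <= e'%:E)%E.
    by move=> j; have [_] := gP j; exact.
  exists (\max_j N j)%N => i Ni.
  apply: (Lp_norm_modular_le (mS i) e0) => j.
  have Nij : (N j <= i)%N := leq_trans (leq_bigmax j) Ni.
  rewrite cfc_fun_subE (_ : (fun x => cfc j (D i x) - cfc j (G x)) =
    (fun x => cfc j (D i x) - g j x)); first exact: NP.
  by apply/funext => x; rewrite GE.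
have [N NP] := GC _ ltr01.
have LG : Lp_space Om p (fun_sub (D N) G).
  by split; [exact: mS|exact: le_lt_trans (NP N (leqnn N)) (ltry _)].
have {}LG : Lp_space Om p G.
  by rewrite -(fun_subKC (D N) G); exact: Lp_space_sub (LD N) LG.
by exists G; [exact: LG|exact: GC].
Qed.

End cf_Lp_complete.

(** * The Banach space of a complete seminorm *)

(** A seminorm on a subspace [sdom] of X for which Cauchy sequences converge.
    Completeness is part of the structure because the quotient is declared a
    complete space once and for all, for every structure of this kind. *)
Record complete_seminorm (R : realType) (X : lmodType R[i]) := CompleteSeminorm {
  sdom : set X;
  snorm : X -> R;
  sdomD : forall x y, sdom x -> sdom y -> sdom (x + y);
  sdomZ : forall (c : R[i]) x, sdom x -> sdom (c *: x);
  sdom0 : sdom 0;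
  snormD : forall x y, sdom x -> sdom y -> snorm (x + y) <= snorm x + snorm y;
  snormZ : forall (c : R[i]) x, sdom x ->
    snorm (c *: x) = Normc.normc c * snorm x;
  snorm_complete : forall f : nat -> X, (forall j, sdom (f j)) ->
    (forall e : R, 0 < e ->
      exists N, forall i j, (N <= i)%N -> (N <= j)%N -> snorm (f i - f j) < e) ->
    exists2 x, sdom x & forall e : R, 0 < e ->
      exists N, forall j, (N <= j)%N -> snorm (f j - x) < e }.

Section seminorm_quotient.
Context (R : realType) (X : lmodType R[i]) (S : complete_seminorm X).
Local Notation W := (sdom S).
Local Notation nu := (snorm S).

Lemma sdomN x : W x -> W (- x).
Proof. by move=> Wx; rewrite -scaleN1r; exact: sdomZ. Qed.

Lemma sdomB x y : W x -> W y -> W (x - y).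
Proof. by move=> Wx /sdomN; exact: sdomD. Qed.

Lemma snorm0 : nu 0 = 0.
Proof.
by have := snormZ 0 (sdom0 S); rewrite scale0r Normc.normc0 mul0r.
Qed.

Lemma snormN x : W x -> nu (- x) = nu x.
Proof.
by move=> Wx; rewrite -scaleN1r snormZ// normcN Normc.normc1 mul1r.
Qed.

Lemma snorm_ge0 x : W x -> 0 <= nu x.
Proof.
move=> Wx; have := snormD Wx (sdomN Wx).
by rewrite subrr snorm0 snormN//; lra.
Qed.

Lemma snorm_dist x y z : W x -> W y -> W z ->
  nu (x - z) <= nu (x - y) + nu (y - z).
Proof.
move=> Wx Wy Wz; rewrite -[x - z](subrKA y).
by apply: snormD; exact: sdomB.
Qed.

Lemma snorm_distC x y : W x -> W y -> nu (x - y) = nu (y - x).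
Proof. by move=> Wx Wy; rewrite -snormN ?opprB//; exact: sdomB. Qed.

Definition sclass x : set X := [set y | W y /\ nu (y - x) = 0].

(** A choice that depends only on the class of x, so the quotient can be realised
    by canonical representatives inside X, and its type of elements is a
    subtype of X. *)
Definition srep x : X := xget 0 (sclass x).

Lemma srepP x : W x -> W (srep x) /\ nu (srep x - x) = 0.
Proof.
move=> Wx; rewrite /srep; case: xgetP => [y _ //|/(_ x)]; case.
by split => //; rewrite subrr snorm0.
Qed.

Lemma sclass_eq x y : W x -> W y -> nu (x - y) = 0 -> sclass x = sclass y.
Proof.
move=> Wx Wy xy; apply/seteqP; split => z [Wz zx]; split => //.
  apply/eqP; rewrite eq_le snorm_ge0; last exact: sdomB.
  by rewrite andbT (le_trans (snorm_dist Wz Wx Wy))// xy zx addr0.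
apply/eqP; rewrite eq_le snorm_ge0; last exact: sdomB.
rewrite andbT (le_trans (snorm_dist Wz Wy Wx))//.
by rewrite (snorm_distC Wy Wx) xy zx addr0.
Qed.

Definition squot := {x : X | `[< W x /\ srep x = x >]}.

HB.instance Definition _ := [Choice of squot by <:].

Lemma srepK x : W x -> srep (srep x) = srep x.
Proof.
by move=> /[dup] Wx /srepP[Wr rx]; rewrite /srep (sclass_eq Wr Wx rx).
Qed.

(** Makes the quotient map total. *)
Definition sdflt x : X := if `[< W x >] then x else 0.

Lemma sdflt_dom x : W (sdflt x).
Proof. by rewrite /sdflt; case: asboolP => // _; exact: sdom0. Qed.

Lemma spi_subproof x : `[< W (srep (sdflt x)) /\
  srep (srep (sdflt x)) = srep (sdflt x) >].
Proof.
apply/asboolP; rewrite srepK; last exact: sdflt_dom.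
by split => //; have [] := srepP (sdflt_dom x).
Qed.

Definition spi x : squot :=
  exist (fun y => is_true `[< W y /\ srep y = y >]) _ (spi_subproof x).

Lemma val_spi x : W x -> val (spi x) = srep x.
Proof. by move=> Wx; rewrite /= /sdflt; case: asboolP. Qed.

Lemma squot_dom (v : squot) : W (val v).
Proof. by have /asboolP[] := valP v. Qed.
Hint Resolve squot_dom : core.

Lemma valK_spi (v : squot) : spi (val v) = v.
Proof.
by apply: val_inj; rewrite val_spi//; have /asboolP[] := valP v.
Qed.

Lemma spi_eq x y : W x -> W y -> spi x = spi y <-> nu (x - y) = 0.
Proof.
move=> Wx Wy; split => [/(congr1 val)|xy]; last first.
  by apply: val_inj; rewrite !val_spi// /srep (sclass_eq Wx Wy xy).
rewrite !val_spi// => rxy.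
have [Wrx rx] := srepP Wx; have [Wry ry] := srepP Wy.
apply/eqP; rewrite eq_le snorm_ge0; last exact: sdomB.
rewrite andbT (le_trans (snorm_dist Wx Wrx Wy))//.
by rewrite {2}rxy ry addr0 snorm_distC// rx.
Qed.

Lemma spiP (v : squot) : exists2 x, W x & v = spi x.
Proof. by exists (val v); rewrite ?valK_spi. Qed.

Lemma nu_val_spi x : W x -> nu (val (spi x) - x) = 0.
Proof. by move=> Wx; rewrite val_spi//; have [] := srepP Wx. Qed.

Definition sq_add (v w : squot) := spi (val v + val w).
Definition sq_opp (v : squot) := spi (- val v).
Definition sq_scale (c : R[i]) (v : squot) := spi (c *: val v).
Definition sq_norm (v : squot) : R[i] := (nu (val v))%:C%C.

Lemma snorm_eq x y : W x -> W y -> nu (x - y) = 0 -> nu x = nu y.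
Proof.
move=> Wx Wy xy; apply/eqP; rewrite eq_le; apply/andP; split.
  by have := snorm_dist Wx Wy (sdom0 S); rewrite !subr0 xy add0r.
by have := snorm_dist Wy Wx (sdom0 S); rewrite !subr0 snorm_distC// xy add0r.
Qed.

Lemma spiD x y : W x -> W y -> sq_add (spi x) (spi y) = spi (x + y).
Proof.
move=> Wx Wy; apply/spi_eq; [by apply: sdomD|exact: sdomD|].
apply/eqP; rewrite eq_le snorm_ge0 ?andbT; last first.
  by apply: sdomB; exact: sdomD.
rewrite opprD addrACA (le_trans (snormD _ _))//; try exact: sdomB.
by rewrite !nu_val_spi// addr0.
Qed.

Lemma spiZ c x : W x -> sq_scale c (spi x) = spi (c *: x).
Proof.
move=> Wx; apply/spi_eq; [by apply: sdomZ|exact: sdomZ|].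
by rewrite -scalerBr snormZ ?nu_val_spi ?mulr0//; exact: sdomB.
Qed.

Lemma spiN x : W x -> sq_opp (spi x) = spi (- x).
Proof.
move=> Wx; rewrite -scaleN1r -spiZ// /sq_scale scaleN1r //.
Qed.

Lemma sq_normE x : W x -> sq_norm (spi x) = (nu x)%:C%C.
Proof.
by move=> Wx; rewrite /sq_norm (snorm_eq _ Wx)// nu_val_spi.
Qed.

Lemma sq_addA : associative sq_add.
Proof.
move=> u v w; have [x Wx ->] := spiP u; have [y Wy ->] := spiP v.
have [z Wz ->] := spiP w.
by rewrite !spiD ?addrA//; exact: sdomD.
Qed.

Lemma sq_addC : commutative sq_add.
Proof. by move=> u v; rewrite /sq_add addrC. Qed.

Lemma sq_add0 : left_id (spi 0) sq_add.
Proof.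
move=> u; have [x Wx ->] := spiP u.
by rewrite spiD ?add0r//; exact: sdom0.
Qed.

Lemma sq_addN : left_inverse (spi 0) sq_opp sq_add.
Proof.
move=> u; have [x Wx ->] := spiP u.
by rewrite spiN// spiD ?addNr//; exact: sdomN.
Qed.

HB.instance Definition _ :=
  GRing.isZmodule.Build squot sq_addA sq_addC sq_add0 sq_addN.

Lemma sq_scaleA a b (v : squot) :
  sq_scale a (sq_scale b v) = sq_scale (a * b) v.
Proof.
have [x Wx ->] := spiP v.
by rewrite !spiZ ?scalerA//; exact: sdomZ.
Qed.

Lemma sq_scale1 : left_id 1 sq_scale.
Proof. by move=> v; have [x Wx ->] := spiP v; rewrite spiZ ?scale1r. Qed.

Lemma sq_scaleDr : right_distributive sq_scale +%R.
Proof.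
move=> c u v; have [x Wx ->] := spiP u; have [y Wy ->] := spiP v.
rewrite /GRing.add /= spiD// !spiZ//; last exact: sdomD.
by rewrite spiD ?scalerDr//; exact: sdomZ.
Qed.

Lemma sq_scaleDl v : {morph sq_scale^~ v : a b / a + b}.
Proof.
move=> a b; have [x Wx ->] := spiP v.
by rewrite /GRing.add /= !spiZ// spiD ?scalerDl//; exact: sdomZ.
Qed.

HB.instance Definition _ := GRing.Zmodule_isLmodule.Build R[i] squot
  sq_scaleA sq_scale1 sq_scaleDr sq_scaleDl.

Lemma sq_normD (u v : squot) : sq_norm (u + v) <= sq_norm u + sq_norm v.
Proof.
have [x Wx ->] := spiP u; have [y Wy ->] := spiP v.
rewrite [spi x + spi y]spiD// !sq_normE//; last exact: sdomD.
by rewrite -rmorphD /= lecR snormD.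
Qed.

Lemma sq_normZ c (v : squot) : sq_norm (c *: v) = `|c| * sq_norm v.
Proof.
have [x Wx ->] := spiP v; rewrite [c *: _]spiZ// !sq_normE//; last exact: sdomZ.
by rewrite snormZ// rmorphM.
Qed.

Lemma sq_norm_eq0 (v : squot) : sq_norm v = 0 -> v = 0.
Proof.
have [x Wx ->] := spiP v; rewrite sq_normE// => /complexI nx.
by apply/spi_eq; rewrite ?subr0//; exact: sdom0.
Qed.

HB.instance Definition _ := @Lmodule_isNormed.Build R[i] squot sq_norm
  sq_normD sq_normZ sq_norm_eq0.

Lemma spiB x y : W x -> W y -> spi x - spi y = spi (x - y).
Proof.
move=> Wx Wy; rewrite /GRing.opp /GRing.add /= spiN// spiD//; exact: sdomN.
Qed.

Lemma norm_spi x : W x -> `|spi x| = (nu x)%:C%C.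
Proof. exact: sq_normE. Qed.

(** In a Cauchy filter every radius 1/(j+1) has a ball that belongs to the filter;
    the centres form a Cauchy sequence, whose limit is the limit of the filter. *)
Lemma squot_complete (F : set_system squot) :
  ProperFilter F -> cauchy F -> cvg F.
Proof.
move=> FF /cauchyP Fc.
have tnV (j : nat) : 0 < (j.+1%:R^-1 : R)%:C%C :> R[i].
  by rewrite ltcR invr_gt0 ltr0n.
have /choice[v vP] : forall j : nat, exists v : squot,
    F (ball v (j.+1%:R^-1 : R)%:C%C).
  by move=> j; exact: Fc.
have dist j u : ball (v j) (j.+1%:R^-1 : R)%:C%C u ->
    nu (val (v j) - val u) < j.+1%:R^-1.
  rewrite -ball_normE /= -{1}(valK_spi (v j)) -{1}(valK_spi u) spiB//.
  by rewrite norm_spi ?ltcR//; exact: sdomB.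
have small (e : R) : 0 < e -> exists N : nat, forall j, (N <= j)%N ->
    j.+1%:R^-1 < e.
  move=> e0; have [N _ NP] := near_infty_natSinv_lt (PosNum e0).
  by exists N => j; exact: NP.
have [] := @snorm_complete _ _ S (fun j => val (v j)).
- by move=> j.
- move=> e e0; have [N NP] := small _ (divr_gt0 e0 (ltr0n R 2)).
  exists N => i j /NP Ni /NP Nj.
  have [u [/dist ui /dist uj]] := filter_ex (@filterI _ F _ _ _ (vP i) (vP j)).
  rewrite (le_lt_trans (snorm_dist _ (squot_dom u) _))//.
  rewrite [ltRHS]splitr ltrD// ?(lt_trans ui)// snorm_distC//.
  exact: lt_trans uj Nj.
move=> x Wx xP; apply/cvg_ex; exists (spi x).
apply/cvg_ballP => e e0.
have eE : e = (complex.Re e)%:C%C by move: e0 => /gtr0_real/RRe_real ->.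
move: e0; rewrite eE ltcR; move: (complex.Re e) => {eE} e' e0.
have [N1 N1P] := small _ (divr_gt0 e0 (ltr0n R 2)).
have [N2 N2P] := xP _ (divr_gt0 e0 (ltr0n R 2)).
pose N := maxn N1 N2.
have := N1P N (leq_maxl _ _); have := N2P N (leq_maxr _ _) => vx sN.
apply: filterS (vP N) => u /dist vu.
rewrite -ball_normE /= -{1}(valK_spi u) spiB//.
rewrite norm_spi ?ltcR; last exact: sdomB.
rewrite (le_lt_trans (snorm_dist _ (squot_dom (v N)) _))//.
rewrite [ltRHS]splitr ltrD//; first by rewrite snorm_distC.
exact: lt_trans vu sN.
Qed.

HB.instance Definition _ := Uniform_isComplete.Build squot squot_complete.

Lemma seminorm_banach (eqv : X -> X -> Prop) (norm : X -> \bar R) :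
  (forall x y, W x -> W y -> eqv x y <-> nu (x - y) = 0) ->
  (forall x, W x -> norm x = (nu x)%:E) ->
  banach_modulo W eqv +%R *:%R norm.
Proof.
move=> eqvE normE; exists squot, spi; split.
- by move=> v; have [x Wx ->] := spiP v; exists x.
- by move=> x y Wx Wy; rewrite eqvE//; exact: spi_eq.
- by move=> x y Wx Wy; split; [exact: sdomD|rewrite -spiD].
- by move=> c x Wx; split; [exact: sdomZ|rewrite -spiZ].
- by move=> x Wx; rewrite normE// norm_spi.
Qed.

End seminorm_quotient.

(** * The Sobolev space *)

Section sobolev_space.
Context (R : realType) (A : fuzzy_number R).
Hypothesis asymA : asymmetric A.
Context (n : nat) (Om : set 'rV[R]_n).
Hypothesis openOm : open Om.
Context (k : nat) (p : R) (p1 : 1 <= p).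
Local Notation T := 'rV[R]_n.
Local Notation mu := (lebesgue_rV R n).
Local Notation nrm := (Lp_norm Om p).
Local Notation W := (@sobolev R A n Om k p).
Local Opaque Lp_norm cf_mod cf_add cf_scale psi.
Implicit Types (F G H : T -> CF A) (a : 'I_n -> nat).

Lemma ae_eq_cfc F G : ae_eq_on Om F G <->
  forall j, {ae mu, forall x, Om x -> cfc j (F x) = cfc j (G x)}.
Proof.
split=> [FG j|FG]; first by apply: filterS FG => x /[apply] ->.
apply: filter_app (FG (false, false)); apply: filter_app (FG (true, false)).
apply: filter_app (FG (false, true)); apply: filterS (FG (true, true)).
move=> x h4 h3 h2 h1 Ox.
by apply: (cfc_inj (A := A)) => -[[] []];
  [exact: h4|exact: h2|exact: h3|exact: h1].
Qed.

Lemma weak_derivative_unique a F G G' : weak_derivative Om a F G ->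
  weak_derivative Om a F G' -> ae_eq_on Om G G'.
Proof.
move=> /(weak_derivativeP asymA openOm)[_ lG FG].
move=> /(weak_derivativeP asymA openOm)[_ lG' FG'].
apply/ae_eq_cfc => j.
exact: (real_weakD_unique openOm (lG j) (lG' j) (FG j) (FG' j)).
Qed.

Lemma weak_derivative_measurable a F G : weak_derivative Om a F G ->
  cf_measurable Om G.
Proof.
move=> /(weak_derivativeP asymA openOm)[_ lG _]; apply/cf_measurableP => j.
exact: (locint_measurable openOm (lG j)).
Qed.

Lemma weak_derivative_add a F F' G G' : weak_derivative Om a F G ->
  weak_derivative Om a F' G' ->
  weak_derivative Om a (fun_add F F') (fun_add G G').
Proof.
move=> /(weak_derivativeP asymA openOm)[lF lG FG].
move=> /(weak_derivativeP asymA openOm)[lF' lG' FG'].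
have E H H' j : (fun x => cfc j (fun_add H H' x)) =
    (fun x => cfc j (H x) + cfc j (H' x)).
  by apply/funext => x; exact: cfc_fun_add.
apply/(weak_derivativeP asymA openOm); split=> j; rewrite !E.
- exact: locintD (lF j) (lF' j).
- exact: locintD (lG j) (lG' j).
- exact: (real_weakD_add openOm (lF j) (lF' j) (lG j) (lG' j) (FG j) (FG' j)).
Qed.

Lemma weak_derivative_scale a c F G : weak_derivative Om a F G ->
  weak_derivative Om a (fun_scale c F) (fun_scale c G).
Proof.
move=> /(weak_derivativeP asymA openOm)[lF lG FG].
pose r j := if (j : bool * bool).1 then complex.Im c else - complex.Im c.
have E H j : (fun x => cfc j (fun_scale c H x)) =
    (fun x => complex.Re c * cfc j (H x) + r j * cfc (~~ j.1, j.2) (H x)).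
  by apply/funext => x; exact: cfcZ.
apply/(weak_derivativeP asymA openOm); split=> j; rewrite !E; set j' := (~~ _, _).
- exact: locintD (locintZ _ (lF j)) (locintZ _ (lF j')).
- exact: locintD (locintZ _ (lG j)) (locintZ _ (lG j')).
- exact: (real_weakD_add openOm (locintZ _ (lF j)) (locintZ _ (lF j'))
    (locintZ _ (lG j)) (locintZ _ (lG j'))
    (real_weakD_scale openOm _ (lF j) (lG j) (FG j))
    (real_weakD_scale openOm _ (lF j') (lG j') (FG j'))).
Qed.

Lemma weak_derivative_sub a F F' G G' : weak_derivative Om a F G ->
  weak_derivative Om a F' G' ->
  weak_derivative Om a (fun_sub F F') (fun_sub G G').
Proof.
by move=> FG FG'; exact: weak_derivative_add FG (weak_derivative_scale _ FG').
Qed.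

Lemma weak_derivative_id F : (forall j, locint Om (fun x => cfc j (F x))) ->
  weak_derivative Om (fun=> 0%N) F F.
Proof.
by move=> lF; apply/(weak_derivativeP asymA openOm); split=> // j; exact: real_weakD_id.
Qed.

Lemma locint0 : locint Om (fun _ : T => 0 : R).
Proof.
move=> K cK KOm; have mK := compact_measurable_rV cK; exact: integrable0.
Qed.

(** A function that vanishes almost everywhere has weak derivatives zero, so the
    seminorm is zero on it. *)
Lemma weak_derivative_null a F : (forall j, locint Om (fun x => cfc j (F x))) ->
  ae_eq_on Om F (fun=> cf_zero A) ->
  weak_derivative Om a F (fun=> cf_zero A).
Proof.
move=> lF /ae_eq_cfc F0; apply/(weak_derivativeP asymA openOm).
have E j : (fun _ : T => cfc j (cf_zero A)) = fun=> 0.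
  by apply/funext => x; exact: cfc0.
split=> // j; rewrite E; first exact: locint0.
by apply: (real_weakD_null openOm) => //; apply: filterS (F0 j) => x; rewrite cfc0.
Qed.

Lemma weakDP a F G : weak_derivative Om a F G ->
  weak_derivative Om a F (weakD Om a F).
Proof.
move=> FG; rewrite /weakD; case: pselect => [e|]; first exact: svalP (cid e).
by case; exists G.
Qed.

(** The norm of a weak derivative does not depend on the choice made in [weakD],
    by uniqueness almost everywhere. *)
Lemma Lp_norm_weakD a F G : weak_derivative Om a F G ->
  nrm (weakD Om a F) = nrm G.
Proof.
move=> FG; have FD := weakDP FG.
exact: (Lp_norm_ae openOm p1 (weak_derivative_measurable FD)
  (weak_derivative_measurable FG) (weak_derivative_unique FD FG)).
Qed.

Lemma sobolev_Lp F : W F -> Lp_space Om p F.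
Proof. by case. Qed.

Lemma sobolev_locint F : W F -> forall j, locint Om (fun x => cfc j (F x)).
Proof. by move=> /sobolev_Lp LF; exact: (Lp_space_locint openOm p1 LF). Qed.

Lemma sobolev_weakD a F : W F -> (mlen a <= k)%N ->
  weak_derivative Om a F (weakD Om a F) /\ Lp_space Om p (weakD Om a F).
Proof.
move=> [_ DF] ak; have [G FG [_ LG]] := DF a ak.
have FD := weakDP FG; split; first exact: FD.
split; first exact: weak_derivative_measurable FD.
by rewrite (Lp_norm_weakD FG).
Qed.

Lemma sobolev_add F G : W F -> W G -> W (fun_add F G).
Proof.
move=> WF WG; split.
  exact: (Lp_space_add asymA openOm p1 (sobolev_Lp WF) (sobolev_Lp WG)).
move=> a ak; have [FD LF] := sobolev_weakD WF ak.
have [GD LG] := sobolev_weakD WG ak.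
exists (fun_add (weakD Om a F) (weakD Om a G)).
  exact: weak_derivative_add FD GD.
exact: (Lp_space_add asymA openOm p1 LF LG).
Qed.

Lemma sobolev_scale c F : W F -> W (fun_scale c F).
Proof.
move=> WF; split.
  exact: (Lp_space_scale asymA openOm p1 c (sobolev_Lp WF)).
move=> a ak; have [FD LF] := sobolev_weakD WF ak.
exists (fun_scale c (weakD Om a F)).
  exact: weak_derivative_scale FD.
exact: (Lp_space_scale asymA openOm p1 c LF).
Qed.

Lemma sobolev_sub F G : W F -> W G -> W (fun_sub F G).
Proof. by move=> WF WG; exact: sobolev_add WF (sobolev_scale _ WG). Qed.

Lemma Lp_space0 : Lp_space Om p (fun=> cf_zero A).
Proof.
split; last by rewrite (Lp_norm0 asymA Om p1) ltry.
by apply/cf_measurableP => j; exact: measurable_cst.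
Qed.

Lemma sobolev0 : W (fun=> cf_zero A).
Proof.
split; first exact: Lp_space0.
move=> a _; exists (fun=> cf_zero A); last exact: Lp_space0.
apply: weak_derivative_null; first exact: (Lp_space_locint openOm p1 Lp_space0).
exact: aeW.
Qed.

Local Notation idx := {ffun 'I_n -> 'I_k.+1}.
Definition idx_nat (b : idx) : 'I_n -> nat := fun i => b i.

Definition weakD_norm a F : R := fine (nrm (weakD Om a F)).

Definition sobolev_seminorm F : R :=
  \sum_(b : idx | (mlen (idx_nat b) <= k)%N) weakD_norm (idx_nat b) F.

Lemma Lp_fin_num F : Lp_space Om p F -> nrm F \is a fin_num.
Proof.
move=> [_ Foo]; have fin (x : \bar R) : (0 <= x)%E -> (x < +oo)%E ->
    x \is a fin_num by move=> x0; rewrite ge0_fin_numE.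
exact: fin (Lp_norm_ge0 Om p F) Foo.
Qed.

Lemma weakD_normE a F G : weak_derivative Om a F G -> Lp_space Om p G ->
  (weakD_norm a F)%:E = nrm G.
Proof.
move=> FG LG; rewrite /weakD_norm (Lp_norm_weakD FG).
exact: fineK (Lp_fin_num LG).
Qed.

Lemma weakD_norm_ge0 a F : 0 <= weakD_norm a F.
Proof. exact: fine_ge0 (Lp_norm_ge0 Om p _). Qed.

Lemma sobolev_normE F : W F ->
  sobolev_norm Om k p F = (sobolev_seminorm F)%:E.
Proof.
move=> WF; rewrite /sobolev_norm /sobolev_seminorm -sumEFin.
apply: eq_bigr => b bk; have [FD LF] := sobolev_weakD WF bk.
by rewrite (weakD_normE FD LF).
Qed.

Lemma weakD_normD a F G : W F -> W G -> (mlen a <= k)%N ->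
  weakD_norm a (fun_add F G) <= weakD_norm a F + weakD_norm a G.
Proof.
move=> WF WG ak; have [FD LF] := sobolev_weakD WF ak.
have [GD LG] := sobolev_weakD WG ak.
have real_le (x y z : R) (X Y Z : \bar R) : x%:E = X -> y%:E = Y ->
    z%:E = Z -> (Z <= X + Y)%E -> z <= x + y.
  by move=> <- <- <-; rewrite -EFinD lee_fin.
exact: (real_le _ _ _ _ _ _ (weakD_normE FD LF) (weakD_normE GD LG)
  (weakD_normE (weak_derivative_add FD GD)
    (Lp_space_add asymA openOm p1 LF LG))
  (Lp_normD asymA openOm p1 LF.1 LG.1)).
Qed.

Lemma weakD_normZ a c F : W F -> (mlen a <= k)%N ->
  weakD_norm a (fun_scale c F) = Normc.normc c * weakD_norm a F.
Proof.
move=> WF ak; have [FD LF] := sobolev_weakD WF ak.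
have real_eq (x z r : R) (X Z : \bar R) : x%:E = X -> z%:E = Z ->
    (Z = r%:E * X)%E -> z = r * x.
  by move=> <- <-; rewrite -EFinM => -[].
exact: (real_eq _ _ _ _ _ (weakD_normE FD LF)
  (weakD_normE (weak_derivative_scale c FD)
    (Lp_space_scale asymA openOm p1 c LF))
  (Lp_normZ asymA openOm p1 c LF.1)).
Qed.

Lemma sobolev_seminormD F G : W F -> W G ->
  sobolev_seminorm (fun_add F G) <= sobolev_seminorm F + sobolev_seminorm G.
Proof.
move=> WF WG; rewrite /sobolev_seminorm -big_split.
by apply: ler_sum => b bk; exact: weakD_normD.
Qed.

Lemma sobolev_seminormZ c F : W F ->
  sobolev_seminorm (fun_scale c F) = Normc.normc c * sobolev_seminorm F.
Proof.
move=> WF; rewrite /sobolev_seminorm mulr_sumr.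
by apply: eq_bigr => b bk; exact: weakD_normZ.
Qed.

(** Every entry of a multi-index is at most its length. *)
Lemma idx_of a : (mlen a <= k)%N -> exists b : idx, idx_nat b = a.
Proof.
move=> ak; exists [ffun i => inord (a i)]; apply/funext => i.
rewrite /idx_nat ffunE inordK// ltnS (leq_trans _ ak)// /mlen (bigD1 i)//=.
exact: leq_addr.
Qed.

Lemma mlen_cst0 : mlen (fun _ : 'I_n => 0%N) = 0%N.
Proof. exact: mlen0. Qed.

Lemma weakD_norm_le a F : (mlen a <= k)%N ->
  weakD_norm a F <= sobolev_seminorm F.
Proof.
move=> ak; have [b ba] := idx_of ak; rewrite -ba in ak *.
rewrite /sobolev_seminorm (bigD1 b)//= lerDl.
by apply: sumr_ge0 => c _; exact: weakD_norm_ge0.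
Qed.

(** F is its own derivative of order zero. *)
Lemma Lp_norm_le_seminorm F : W F -> (nrm F <= (sobolev_seminorm F)%:E)%E.
Proof.
move=> WF; have FF := weak_derivative_id (sobolev_locint WF).
rewrite -(weakD_normE FF (sobolev_Lp WF)) lee_fin weakD_norm_le//.
by rewrite mlen_cst0.
Qed.

Lemma sobolev_seminorm_eq0 F : W F ->
  sobolev_seminorm F = 0 <-> ae_eq_on Om F (fun=> cf_zero A).
Proof.
move=> WF; split=> [F0|F0].
  have mF := (sobolev_Lp WF).1.
  apply: (Lp_norm_eq0 openOm p1 mF); apply/eqP.
  rewrite eq_le (Lp_norm_ge0 Om p F) andbT.
  by have := Lp_norm_le_seminorm WF; rewrite F0.
rewrite /sobolev_seminorm big1// => b bk.
have D0 := weak_derivative_null (idx_nat b) (sobolev_locint WF) F0.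
by apply: EFin_inj; rewrite (weakD_normE D0 Lp_space0) (Lp_norm0 asymA Om p1).
Qed.

Lemma ae_eq_sub F G :
  ae_eq_on Om F G <-> ae_eq_on Om (fun_sub F G) (fun=> cf_zero A).
Proof.
split=> /ae_eq_cfc FG; apply/ae_eq_cfc => j; apply: filterS (FG j) => x.
  by move=> /[apply] E; rewrite cfc_fun_sub// E subrr cfc0.
by move=> /[apply]; rewrite cfc_fun_sub// cfc0// => /subr0_eq.
Qed.

(** The limit of F_i in L^p has the limits of the D^a F_i as weak derivatives,
    because the weak derivative is a closed relation. *)
Lemma sobolev_complete (f : nat -> T -> CF A) : (forall i, W (f i)) ->
  (forall e : R, 0 < e -> exists N, forall i j, (N <= i)%N -> (N <= j)%N ->
    sobolev_seminorm (fun_sub (f i) (f j)) < e) ->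
  exists2 F, W F & forall e : R, 0 < e -> exists N, forall i, (N <= i)%N ->
    sobolev_seminorm (fun_sub (f i) F) < e.
Proof.
move=> Wf fC.
have Lf i := sobolev_Lp (Wf i).
have Wij i j := sobolev_sub (Wf i) (Wf j).
have fC' (e : R) : 0 < e -> exists N, forall i j, (N <= i)%N -> (N <= j)%N ->
    (nrm (fun_sub (f i) (f j)) <= e%:E)%E.
  move=> e0; have [N NP] := fC e e0; exists N => i j Ni Nj.
  apply: (le_trans (Lp_norm_le_seminorm (Wij i j))).
  by rewrite lee_fin ltW// NP.
have [F LF FC] := cf_Lp_complete asymA openOm p1 Lf fC'.
have fDC a : (mlen a <= k)%N -> exists G, Lp_space Om p G /\
    forall e : R, 0 < e -> exists N, forall i, (N <= i)%N ->
    (nrm (fun_sub (weakD Om a (f i)) G) <= e%:E)%E.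
  move=> ak; pose D i := weakD Om a (f i).
  have LD i : Lp_space Om p (D i) := (sobolev_weakD (Wf i) ak).2.
  have DD i : weak_derivative Om a (f i) (D i) := (sobolev_weakD (Wf i) ak).1.
  have DC (e : R) : 0 < e -> exists N, forall i j, (N <= i)%N -> (N <= j)%N ->
      (nrm (fun_sub (D i) (D j)) <= e%:E)%E.
    move=> e0; have [N NP] := fC e e0; exists N => i j Ni Nj.
    rewrite -(weakD_normE (weak_derivative_sub (DD i) (DD j))
      (Lp_space_sub asymA openOm p1 (LD i) (LD j))) lee_fin.
    exact: le_trans (weakD_norm_le _ ak) (ltW (NP i j Ni Nj)).
  have [G LG GC] := cf_Lp_complete asymA openOm p1 LD DC.
  by exists G; split; [exact: LG|exact: GC].
have wF a G : (mlen a <= k)%N -> Lp_space Om p G ->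
    (forall e : R, 0 < e -> exists N, forall i, (N <= i)%N ->
      (nrm (fun_sub (weakD Om a (f i)) G) <= e%:E)%E) ->
    weak_derivative Om a F G.
  move=> ak LG GC.
  have LD i := (sobolev_weakD (Wf i) ak).2.
  have DD i := (sobolev_weakD (Wf i) ak).1.
  apply/(weak_derivativeP asymA openOm).
  have lF := Lp_space_locint openOm p1 LF.
  have lG := Lp_space_locint openOm p1 LG.
  split=> // j; apply: (real_weakD_cvg openOm (f := fun i x => cfc j (f i x))
    (g := fun i x => cfc j (weakD Om a (f i) x)) _ _ (lF j) (lG j)).
  - by move=> i; exact: (Lp_space_locint openOm p1 (Lf i)).
  - by move=> i; exact: (Lp_space_locint openOm p1 (LD i)).
  - exact: (Lp_cvg_L1loc asymA openOm p1 Lf LF FC j).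
  - exact: (Lp_cvg_L1loc asymA openOm p1 LD LG GC j).
  - by move=> i; have /(weak_derivativeP asymA openOm)[_ _ +] := DD i; exact.
have WF : W F.
  split; first exact: LF.
  move=> a ak; have [G [LG GC]] := fDC a ak.
  by exists G; [exact: wF ak LG GC|exact: LG].
exists F; first exact: WF.
(* The successor keeps the total of the #|idx| errors strictly below e. *)
move=> e e0; pose e' := e / #|idx|.+1%:R.
have e'0 : 0 < e' by rewrite divr_gt0// ltr0n.
have /choice[N NP] : forall b : idx, exists N, (mlen (idx_nat b) <= k)%N ->
    forall i, (N <= i)%N ->
    weakD_norm (idx_nat b) (fun_sub (f i) F) <= e'.
  move=> b; case: (leqP (mlen (idx_nat b)) k) => [bk|_]; last by exists 0%N.
  have [G [LG GC]] := fDC _ bk; have [N NP] := GC e' e'0.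
  exists N => _ i Ni; have [DD LD] := sobolev_weakD (Wf i) bk.
  have FG := wF _ _ bk LG GC.
  rewrite -lee_fin (weakD_normE (weak_derivative_sub DD FG)
    (Lp_space_sub asymA openOm p1 LD LG)).
  exact: NP.
exists (\max_b N b)%N => i Ni.
apply: (@le_lt_trans _ _ (\sum_(b : idx) e')).
  rewrite /sobolev_seminorm big_mkcond; apply: ler_sum => b _.
  case: ifPn => [bk|_]; last exact: ltW.
  by apply: NP => //; exact: leq_trans (leq_bigmax b) Ni.
rewrite sumr_const -mulr_natl /e' mulrCA gtr_pMr//.
by rewrite ltr_pdivrMr ?ltr0n// mul1r ltr_nat.
Qed.

Definition sobolev_complete_seminorm :
    complete_seminorm (T -> cf_space asymA) :=
  @CompleteSeminorm R (T -> cf_space asymA) W sobolev_seminorm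
    sobolev_add sobolev_scale sobolev0 sobolev_seminormD sobolev_seminormZ
    sobolev_complete.

End sobolev_space.

Theorem corollary4p11 (R : realType) (A : fuzzy_number R) (asymA : asymmetric A)
    (n : nat) (Om : set 'rV[R]_n) (openOm : open Om) (k : nat)
    (p : R) (p1 : 1 <= p) :
  banach_modulo (sobolev Om k p) (ae_eq_on Om) (@fun_add R A n)
    (@fun_scale R A n) (sobolev_norm Om k p).
Proof.
apply: (seminorm_banach (S := sobolev_complete_seminorm asymA openOm k p1)).
  move=> F G WF WG.
  have WFG := sobolev_sub asymA openOm p1 WF WG.
  rewrite (ae_eq_sub asymA Om F G).
  exact: iff_sym (sobolev_seminorm_eq0 asymA openOm p1 WFG).
by move=> F WF; exact: (sobolev_normE asymA openOm p1 WF).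
Qed.
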